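(* Let $d\ge1$. A family $\{\rho_n\}_{n\ge1}$ of linear functions $\rho_n:Y_{d,n}\to\mathbb C[u^{\pm1},v^{\pm1}]$ is a Markov trace on the family of algebras $\{Y_{d,n}\}_{n\ge1}$ if and only if there is a set of parameters $\{\alpha_{\mu^0},\ \mu^0\in\operatorname{Comp}^0_d\}\subset\mathbb C[u^{\pm1},v^{\pm1}]$ such that $$\rho_n(x)=\sum_{\mu\in\operatorname{Comp}_d(n)}\rho^\mu\circ\operatorname{Tr}_{\operatorname{Mat}_{m_\mu}}\circ\Psi_\mu(E_\mu x),\qquad\text{for } n\ge1\text{ and }x\in Y_{d,n},$$ where the trace functions $\rho^\mu:\mathcal H^\mu\to\mathbb C[u^{\pm1},v^{\pm1}]$ are given by $$\rho^\mu=\alpha_{[\mu]}\cdot\tau_{\mu_1}\otimes\dots\otimes\tau_{\mu_d},\qquad\text{for any }\mu\in\operatorname{Comp}_d(n).$$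
   Context: Let $u,v$ be indeterminates, $B=\mathbb C[u^{\pm1},v^{\pm1}]$, and let $\xi_1,\dots,\xi_d$ be the $d$-th roots of unity in $\mathbb C$. Hecke algebra: $\mathcal H_n$ ($n\ge1$) is the associative unital $B$-algebra with generators $T_1,\dots,T_{n-1}$ and relations $T_iT_j=T_jT_i$ ($|i-j|>1$), $T_iT_{i+1}T_i=T_{i+1}T_iT_{i+1}$, $T_i^2=u^2+vT_i$; $\mathcal H_0=B$. Permutations are multiplied as functions, $s_i=(i,i+1)$. For $w=s_{i_1}\cdots s_{i_r}$ reduced, $\tilde T_w=u^{-r}T_{i_1}\cdots T_{i_r}$. $\mathcal H_n$ is naturally embedded in $\mathcal H_{n+1}$. Markov trace on Hecke algebras: $\{\tau_n:\mathcal H_n\to B\}_{n\ge1}$ is the unique family of $B$-linear maps with $\tau_1(1)=1$, $\tau_n(xy)=\tau_n(yx)$ for $x,y\in\mathcal H_n$, and $\tau_{n+1}(xT_n)=\tau_{n+1}(xT_n^{-1})=\tau_n(x)$ for $n\ge1$, $x\in\mathcal H_n$. Also $\tau_0:\mathcal H_0=B\to B$ is the identity. Compositions: $\operatorname{Comp}_d(n)$ is the set of $d$-tuples of non-negative integers with sum $n$. For $\mu\in\operatorname{Comp}_d(n)$, $[\mu]$ is the $d$-tuple with $[\mu]_a=1$ if $\mu_a\ge1$ and $[\mu]_a=0$ if $\mu_a=0$. $\operatorname{Comp}^0_d$ is the set of all non-zero $d$-tuples with entries in $\{0,1\}$. $\mathfrak S^\mu=\mathfrak S_{\mu_1}\times\dots\times\mathfrak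 S_{\mu_d}\subset\mathfrak S_n$ is the Young subgroup acting on consecutive blocks of sizes $\mu_1,\dots,\mu_d$; $\mathcal H^\mu\subset\mathcal H_n$ is the subalgebra generated by the $T_i$ with $s_i\in\mathfrak S^\mu$, identified with $\mathcal H_{\mu_1}\otimes\dots\otimes\mathcal H_{\mu_d}$; it has basis $\{\tilde T_w\mid w\in\mathfrak S^\mu\}$. $m_\mu=n!/(\mu_1!\cdots\mu_d!)$. Yokonuma--Hecke algebra: $Y_{d,n}$ is the associative unital $B$-algebra with generators $g_1,\dots,g_{n-1},t_1,\dots,t_n$ and relations $g_ig_j=g_jg_i$ ($|i-j|>1$), $g_ig_{i+1}g_i=g_{i+1}g_ig_{i+1}$, $t_it_j=t_jt_i$, $g_it_j=t_{s_i(j)}g_i$, $t_j^d=1$, $g_i^2=u^2+v\,e_ig_i$, where $e_i=\frac1d\sum_{s=0}^{d-1}t_i^st_{i+1}^{-s}$. $Y_{d,n}$ is naturally embedded in $Y_{d,n+1}$. For $w=s_{i_1}\cdots s_{i_r}$ reduced, $\tilde g_w=u^{-r}g_{i_1}\cdots g_{i_r}$. A Markov trace on $\{Y_{d,n}\}_{n\ge1}$ is a family of linear functions $\rho_n:Y_{d,n}\to B$ with (M1) $\rho_n(xy)=\rho_n(yx)$ for $n\ge1$, $x,y\in Y_{d,n}$; (M2) $\rho_{n+1}(xg_n)=\rho_{n+1}(xg_n^{-1})=\rho_n(x)$ for $n\ge1$, $x\in Y_{d,n}$. Characters and idempotents: for a character $\chi$ of $(\mathbb Z/d\mathbb Z)^n=\langle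 t_1,\dots,t_n\rangle$, $E_\chi=\prod_{i=1}^n\bigl(\frac1d\sum_{s=0}^{d-1}\chi(t_i)^st_i^{-s}\bigr)$; $\mathfrak S_n$ acts by $w(\chi)(t_i)=\chi(t_{w^{-1}(i)})$; $\operatorname{Comp}(\chi)=\mu$ with $\mu_a=\#\{j:\chi(t_j)=\xi_a\}$; $E_\mu=\sum_{\operatorname{Comp}(\chi)=\mu}E_\chi$ (these are complete central orthogonal idempotents of $Y_{d,n}$). $\chi_1^\mu$ takes value $\xi_1$ on the first $\mu_1$ of the $t_j$'s, $\xi_2$ on the next $\mu_2$, etc.; $\pi_{1,\mu}=1,\dots,\pi_{m_\mu,\mu}$ are the minimal length representatives of the left cosets $\mathfrak S_n/\mathfrak S^\mu$; $\chi_k^\mu=\pi_{k,\mu}(\chi_1^\mu)$. The set $\{E_{\chi_k^\mu}\tilde g_w\}$ ($1\le k\le m_\mu$, $w\in\mathfrak S_n$) is a basis of $E_\mu Y_{d,n}$, and $\Psi_\mu:E_\mu Y_{d,n}\to\operatorname{Mat}_{m_\mu}(\mathcal H^\mu)$ is the algebra isomorphism $\Psi_\mu(E_{\chi_k^\mu}\tilde g_w)=\tilde T_{\pi_{k,\mu}^{-1}w\pi_{j,\mu}}\mathrm M_{k,j}$, where $j$ is determined by $w(\chi_j^\mu)=\chi_k^\mu$ and $\mathrm M_{k,j}$ is the elementary matrix. $\operatorname{Tr}_{\operatorname{Mat}_{m_\mu}}:\operatorname{Mat}_{m_\mu}(\mathcal H^\mu)\to\mathcal H^\mu$ is the sum of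 diagonal entries. *)

(* Defs.v *)
From HB Require Import structures.
From mathcomp Require Import all_boot all_order all_algebra all_fingroup.
From mathcomp Require Import boolp classical_sets reals.
From mathcomp Require Import complex generic_quotient.
From mathcomp.multinomials Require Import monalg.

Set Implicit Arguments.
Unset Strict Implicit.
Unset Printing Implicit Defensive.

Import GRing.Theory.
Local Open Scope ring_scope.
Local Open Scope quotient_scope.

(* Definite description: an object satisfying [P], or [x0] if there is none.  *)
Definition the (T : Type) (x0 : T) (P : T -> Prop) : T :=
  @xget {classic T} x0 P.

Lemma theP (T : Type) (x0 : T) (P : T -> Prop) :
  (exists x, P x) -> P (the x0 P).
Proof. by case=> x Px; exact: (@xgetPex {classic T} x0 P (ex_intro _ x Px)). Qed.

Lemma monomial_frac_subring (A : comNzRingType) (F : fieldType)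
    (f : {rmorphism A -> F}) (a b : A) (S : {pred F}) :
  f a != 0 -> f b != 0 ->
  (forall x, reflect (exists (p : A) (i j : nat),
                        x = f p / (f a ^+ i * f b ^+ j)) (x \in S)) ->
  subring_closed S.
Proof.
move=> a0 b0 SP.
have H0 i j : f a ^+ i * f b ^+ j != 0 by rewrite mulf_neq0 // expf_neq0.
split.
- by apply/SP; exists 1, 0, 0; rewrite rmorph1 !expr0 mulr1 divr1.
- move=> x y /SP[p [i [j ->]]] /SP[q [k [l ->]]]; apply/SP.
  exists (p * (a ^+ k * b ^+ l) - q * (a ^+ i * b ^+ j)), (i + k)%N, (j + l)%N.
  rewrite -mulNr addf_div // mulNr.
  by rewrite rmorphB !rmorphM !rmorphXn /= !exprD mulrACA.
- move=> x y /SP[p [i [j ->]]] /SP[q [k [l ->]]]; apply/SP.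
  exists (p * q), (i + k)%N, (j + l)%N.
  by rewrite mulf_div rmorphM !exprD [in RHS]mulrACA.
Qed.

(* The ring K[u^{+-1}, v^{+-1}], as the subring of the field of fractions of  *)
(* K[u][v] formed by the fractions whose denominator is a monomial.           *)
Section Laurent.
Variable K : fieldType.
Local Notation poly2 := {poly {poly K}}.

Definition frac_u : {fraction poly2} := tofrac ('X)%:P.
Definition frac_v : {fraction poly2} := tofrac 'X.

Definition is_laurent : {pred {fraction poly2}} :=
  fun x => `[< exists (p : poly2) (a b : nat),
                 x = tofrac p / (frac_u ^+ a * frac_v ^+ b) >].

Lemma is_laurentP x :
  reflect (exists (p : poly2) (a b : nat),
             x = tofrac p / (frac_u ^+ a * frac_v ^+ b)) (x \in is_laurent).
Proof. exact: asboolP. Qed.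

Lemma frac_u_neq0 : frac_u != 0.
Proof. by rewrite tofrac_eq0 polyC_eq0 polyX_eq0. Qed.

Lemma frac_v_neq0 : frac_v != 0.
Proof. by rewrite tofrac_eq0 polyX_eq0. Qed.

Lemma is_laurent_tofrac (p : poly2) : tofrac p \in is_laurent.
Proof.
by apply/is_laurentP; exists p, 0, 0; rewrite !expr0 mulr1 divr1.
Qed.

Fact is_laurent_subring : subring_closed is_laurent.
Proof. exact: monomial_frac_subring frac_u_neq0 frac_v_neq0 is_laurentP. Qed.
HB.instance Definition _ :=
  GRing.isSubringClosed.Build {fraction poly2} is_laurent is_laurent_subring.

Record laurent :=
  Laurent { laurent_val : {fraction poly2}; _ : laurent_val \in is_laurent }.

HB.instance Definition _ := [isSub for laurent_val].
HB.instance Definition _ := [Choice of laurent by <:].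
HB.instance Definition _ := [SubChoice_isSubComNzRing of laurent by <:].

Definition laurent_unit : {pred laurent} :=
  [pred x | (val x != 0) && ((val x)^-1 \in is_laurent)].
Definition laurent_inv (x : laurent) : laurent :=
  if x \in laurent_unit then insubd x (val x)^-1 else x.

Fact laurent_mulVx : {in laurent_unit, left_inverse 1 laurent_inv *%R}.
Proof.
move=> x xU; rewrite /laurent_inv xU; move: xU; rewrite inE => /andP[x0 xL].
by apply: val_inj; rewrite rmorphM rmorph1 /= insubdK // mulVf.
Qed.

Fact laurent_unitPl x y : y * x = 1 -> x \in laurent_unit.
Proof.
move=> /(congr1 val); rewrite rmorphM rmorph1 /= => yx1.
have x0 : val x != 0.
  by apply: contra_eq_neq yx1 => ->; rewrite mulr0 eq_sym oner_eq0.
rewrite inE x0 /=; suff -> : (val x)^-1 = val y by exact: valP.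
by apply: (mulIf x0); rewrite yx1 mulVf.
Qed.

Fact laurent_inv_out : {in [predC laurent_unit], laurent_inv =1 id}.
Proof. by move=> x; rewrite inE /= /laurent_inv => /negPf ->. Qed.

HB.instance Definition _ :=
  GRing.ComNzRing_hasMulInverse.Build laurent
    laurent_mulVx laurent_unitPl laurent_inv_out.
HB.instance Definition _ :=
  [SubComUnitRing_isSubIntegralDomain of laurent by <:].

Definition laurent_of_poly (p : poly2) : laurent :=
  Laurent (is_laurent_tofrac p).
Definition laurent_cst (c : K) : laurent := laurent_of_poly c%:P%:P.
Definition laurent_u : laurent := laurent_of_poly ('X)%:P.
Definition laurent_v : laurent := laurent_of_poly 'X.

Lemma laurent_u_unit : laurent_u \is a GRing.unit.
Proof.
rewrite /in_mem /= /laurent_unit inE /=.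
rewrite -/frac_u frac_u_neq0 /=; apply/is_laurentP.
by exists 1, 1, 0; rewrite tofrac1 div1r expr1 expr0 mulr1.
Qed.

Lemma laurent_v_unit : laurent_v \is a GRing.unit.
Proof.
rewrite /in_mem /= /laurent_unit inE /=.
rewrite -/frac_v frac_v_neq0 /=; apply/is_laurentP.
by exists 1, 0, 1; rewrite tofrac1 div1r expr1 expr0 mul1r.
Qed.

End Laurent.

(* Associative unital algebras given by generators and relations: the free    *)
(* algebra modulo the two-sided ideal generated by the relators.  The         *)
(* operations are locked because unification otherwise unfolds the quotient.  *)
Fact presented_key : unit. Proof. exact: tt. Qed.

Section FreeAlgebra.
Variables (B : comNzRingType) (I : choiceType).
Implicit Types x y : {malg B[{fmonom I}]}.

Definition free_gen : I -> {malg B[{fmonom I}]} :=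
  locked_with presented_key (fun i => mkmalgU (fmu i) 1).

Lemma free_scalerAr c x y : c *: (x * y) = x * (c *: y).
Proof.
suff cC : c%:MP * x = x * c%:MP.
  rewrite -(mul_malgC c (x * y)) -(mul_malgC c y) [LHS]mulrA cC.
  exact: esym (mulrA _ _ _).
rewrite (malgMEw (msuppC_le _) (finmap.fsubset_refl _)).
rewrite (malgMEw (finmap.fsubset_refl _) (msuppC_le _)).
rewrite finmap.big_seq_fset1; apply: eq_bigr => k _.
by rewrite finmap.big_seq_fset1 mulrC mul1m mulm1.
Qed.

Section Eval.
Variables (S : pzRingType) (phi : {rmorphism B -> S}) (f : I -> S).

Definition free_eval : {malg B[{fmonom I}]} -> S :=
  locked_with presented_key (fun x =>
    \sum_(k <- finmap.enum_fset (msupp x))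
       phi (mcoeff k x) * \prod_(i <- (k : seq I)) f i).

Lemma free_evalEw (D : finmap.finset_of (Phant {fmonom I})) x :
  finmap.fsubset (msupp x) D ->
  free_eval x = \sum_(k <- finmap.enum_fset D)
     phi (mcoeff k x) * \prod_(i <- (k : seq I)) f i.
Proof.
rewrite /free_eval locked_withE => le; rewrite [LHS](finmap.big_fset_incl _ le) => //= k kD /mcoeff_outdom ->.
by rewrite rmorph0 mul0r.
Qed.

Fact free_eval_is_zmod_morphism : zmod_morphism free_eval.
Proof.
move=> x y.
pose D := finmap.fsetU (msupp x) (msupp y).
rewrite (@free_evalEw D (x - y)) ?msuppB_le //.
rewrite (@free_evalEw D x) ?finmap.fsubsetUl //.
rewrite (@free_evalEw D y) ?finmap.fsubsetUr //.
by rewrite -sumrB; apply: eq_bigr => k _; rewrite mcoeffB rmorphB mulrBl.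
Qed.
HB.instance Definition _ :=
  GRing.isZmodMorphism.Build {malg B[{fmonom I}]} S free_eval
    free_eval_is_zmod_morphism.

Lemma free_evalU c k :
  free_eval (mkmalgU k c) = phi c * \prod_(i <- (k : seq I)) f i.
Proof. by rewrite (free_evalEw msuppU_le) finmap.big_seq_fset1 mcoeffUU. Qed.

Lemma free_eval_gen i : free_eval (free_gen i) = f i.
Proof.
by rewrite /free_gen locked_withE free_evalU rmorph1 mul1r fmU big_seq1.
Qed.

Lemma free_evalZ c x : free_eval (c *: x) = phi c * free_eval x.
Proof.
rewrite (free_evalEw (msuppZ_le _ _)) (free_evalEw (finmap.fsubset_refl _)).
rewrite mulr_sumr.
by apply: eq_bigr => k _; rewrite mcoeffZ rmorphM mulrA.
Qed.

Lemma free_eval1 : free_eval 1 = 1.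
Proof. by rewrite free_evalU fm1 big_nil rmorph1 mulr1. Qed.

Hypothesis phi_central : forall c s, phi c * s = s * phi c.

Lemma free_evalM x y : free_eval (x * y) = free_eval x * free_eval y.
Proof.
rewrite malgME raddf_sum [free_eval x](free_evalEw (finmap.fsubset_refl _)).
rewrite [free_eval y](free_evalEw (finmap.fsubset_refl _)).
rewrite mulr_suml /=; apply: eq_bigr => k _.
rewrite raddf_sum mulr_sumr /=; apply: eq_bigr => l _.
rewrite free_evalU fmM big_cat rmorphM /= -!mulrA; congr (_ * _).
by rewrite mulrA phi_central -!mulrA.
Qed.

End Eval.
End FreeAlgebra.

Section Presented.
Variables (B : comNzRingType) (I : choiceType).
Local Notation free := {malg B[{fmonom I}]}.
Variable R : free -> free -> Prop.

Inductive rel_ideal : free -> Prop :=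
| rel_ideal0 : rel_ideal 0
| rel_idealD x y : rel_ideal x -> rel_ideal y -> rel_ideal (x + y)
| rel_ideal_gen a x y b : R x y -> rel_ideal (a * (x - y) * b).

Lemma rel_idealN x : rel_ideal x -> rel_ideal (- x).
Proof.
elim=> [|{}x y _ Ix _ Iy|a {}x y b Rxy]; first by rewrite oppr0; exact: rel_ideal0.
  by rewrite opprD; exact: rel_idealD.
by rewrite -!mulNr; exact: rel_ideal_gen.
Qed.

Lemma rel_idealMl a x : rel_ideal x -> rel_ideal (a * x).
Proof.
elim=> [|{}x y _ Ix _ Iy|c {}x y b Rxy]; first by rewrite mulr0; exact: rel_ideal0.
  by rewrite mulrDr; exact: rel_idealD.
by rewrite !mulrA; exact: rel_ideal_gen.
Qed.

Lemma rel_idealMr a x : rel_ideal x -> rel_ideal (x * a).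
Proof.
elim=> [|{}x y _ Ix _ Iy|c {}x y b Rxy]; first by rewrite mul0r; exact: rel_ideal0.
  by rewrite mulrDl; exact: rel_idealD.
by rewrite -mulrA; exact: rel_ideal_gen.
Qed.

Definition rel_equiv (x y : free) : bool := `[< rel_ideal (x - y) >].

Fact rel_equiv_is_equiv : equiv_class_of rel_equiv.
Proof.
split=> [x|x y|y x z]; rewrite /rel_equiv.
- by rewrite subrr; apply/asboolP; exact: rel_ideal0.
- by apply/asboolP/asboolP => /rel_idealN; rewrite opprB.
- move=> /asboolP xy /asboolP yz; apply/asboolP.
  by rewrite -(subrK y x) -addrA; exact: rel_idealD.
Qed.
Canonical rel_equiv_equiv := EquivRelPack rel_equiv_is_equiv.
Canonical rel_equiv_encModRel := defaultEncModRel rel_equiv.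

Definition presented := {eq_quot rel_equiv}.
HB.instance Definition _ := EqQuotient.on presented.
HB.instance Definition _ := Choice.on presented.

Local Notation pi := (\pi_presented).

Lemma pi_presentedP x y : rel_ideal (x - y) <-> pi x = pi y.
Proof.
by split=> [h|/eqmodP/asboolP//]; apply/eqmodP/asboolP.
Qed.

Lemma pi_repr (x : presented) : pi (repr x) = x. Proof. exact: reprK. Qed.

Definition pres_zero : presented := locked_with presented_key (pi 0).
Definition pres_one : presented := locked_with presented_key (pi 1).
Definition pres_opp : presented -> presented :=
  locked_with presented_key (fun x => pi (- repr x)).
Definition pres_add : presented -> presented -> presented :=
  locked_with presented_key (fun x y => pi (repr x + repr y)).
Definition pres_mul : presented -> presented -> presented :=
  locked_with presented_key (fun x y => pi (repr x * repr y)).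
Definition pres_scale : B -> presented -> presented :=
  locked_with presented_key (fun c x => pi (c *: repr x)).

Lemma ideal_repr x : rel_ideal (repr (pi x) - x).
Proof. by apply/pi_presentedP; rewrite pi_repr. Qed.

Fact pi_pres_zero : pi 0 = pres_zero.
Proof. by rewrite /pres_zero locked_withE. Qed.

Fact pi_pres_one : pi 1 = pres_one.
Proof. by rewrite /pres_one locked_withE. Qed.

Fact pi_pres_add x y : pres_add (pi x) (pi y) = pi (x + y).
Proof.
rewrite /pres_add locked_withE.
apply/pi_presentedP; rewrite opprD addrACA.
by apply: rel_idealD; exact: ideal_repr.
Qed.

Fact pi_pres_opp x : pres_opp (pi x) = pi (- x).
Proof.
rewrite /pres_opp locked_withE.
by apply/pi_presentedP; rewrite -opprD; apply/rel_idealN/ideal_repr.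
Qed.

Fact pi_pres_mul x y : pres_mul (pi x) (pi y) = pi (x * y).
Proof.
rewrite /pres_mul locked_withE.
apply/pi_presentedP.
have -> : repr (pi x) * repr (pi y) - x * y =
   (repr (pi x) - x) * repr (pi y) + x * (repr (pi y) - y).
  by rewrite mulrBl mulrBr addrA subrK.
by apply: rel_idealD; [apply: rel_idealMr | apply: rel_idealMl];
  exact: ideal_repr.
Qed.

Fact pi_pres_scale c x : pres_scale c (pi x) = pi (c *: x).
Proof.
rewrite /pres_scale locked_withE.
apply/pi_presentedP; rewrite -scalerBr -mul_malgC.
by apply/rel_idealMl/ideal_repr.
Qed.

Let piE := (pi_pres_add, pi_pres_opp, pi_pres_mul, pi_pres_scale).

Fact pres_addA : associative pres_add.
Proof.
by move=> x y z; rewrite -[x]pi_repr -[y]pi_repr -[z]pi_repr !piE addrA.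
Qed.
Fact pres_addC : commutative pres_add.
Proof. by move=> x y; rewrite -[x]pi_repr -[y]pi_repr !piE addrC. Qed.
Fact pres_add0 : left_id pres_zero pres_add.
Proof. by move=> x; rewrite -[x]pi_repr -pi_pres_zero !piE add0r. Qed.
Fact pres_addN : left_inverse pres_zero pres_opp pres_add.
Proof. by move=> x; rewrite -[x]pi_repr -pi_pres_zero !piE addNr. Qed.
HB.instance Definition _ :=
  GRing.isZmodule.Build presented pres_addA pres_addC pres_add0 pres_addN.

Fact pres_mulA : associative pres_mul.
Proof.
by move=> x y z; rewrite -[x]pi_repr -[y]pi_repr -[z]pi_repr !piE mulrA.
Qed.
Fact pres_mul1l : left_id pres_one pres_mul.
Proof. by move=> x; rewrite -[x]pi_repr -pi_pres_one !piE mul1r. Qed.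
Fact pres_mul1r : right_id pres_one pres_mul.
Proof. by move=> x; rewrite -[x]pi_repr -pi_pres_one !piE mulr1. Qed.
Fact pres_mulDl : left_distributive pres_mul +%R.
Proof.
move=> x y z; rewrite -[x]pi_repr -[y]pi_repr -[z]pi_repr.
by rewrite /GRing.add /= !piE mulrDl.
Qed.
Fact pres_mulDr : right_distributive pres_mul +%R.
Proof.
move=> x y z; rewrite -[x]pi_repr -[y]pi_repr -[z]pi_repr.
by rewrite /GRing.add /= !piE mulrDr.
Qed.
HB.instance Definition _ :=
  GRing.Zmodule_isPzRing.Build presented
    pres_mulA pres_mul1l pres_mul1r pres_mulDl pres_mulDr.

Fact pres_scaleA a b x : pres_scale a (pres_scale b x) = pres_scale (a * b) x.
Proof. by rewrite -[x]pi_repr !piE scalerA. Qed.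
Fact pres_scale1 : left_id 1 pres_scale.
Proof. by move=> x; rewrite -[x]pi_repr !piE scale1r. Qed.
Fact pres_scaleDr : right_distributive pres_scale +%R.
Proof.
move=> a x y; rewrite -[x]pi_repr -[y]pi_repr.
by rewrite /GRing.add /= !piE scalerDr.
Qed.
Fact pres_scaleDl x : {morph pres_scale^~ x : a b / a + b}.
Proof.
move=> a b; rewrite -[x]pi_repr.
by rewrite {2}/GRing.add /= !piE scalerDl.
Qed.
HB.instance Definition _ :=
  GRing.Zmodule_isLmodule.Build B presented
    pres_scaleA pres_scale1 pres_scaleDr pres_scaleDl.

Definition pres_gen : I -> presented :=
  locked_with presented_key (fun i => pi (free_gen B i)).

Lemma pres_genE i : pres_gen i = pi (free_gen B i).
Proof. by rewrite /pres_gen locked_withE. Qed.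

Lemma pi_pres0 : pi 0 = 0. Proof. exact: pi_pres_zero. Qed.
Lemma pi_pres1 : pi 1 = 1. Proof. exact: pi_pres_one. Qed.
Lemma pi_presD x y : pi (x + y) = pi x + pi y.
Proof. exact: esym (pi_pres_add x y). Qed.
Lemma pi_presB x y : pi (x - y) = pi x - pi y.
Proof. by rewrite -pi_pres_add -pi_pres_opp. Qed.
Lemma pi_presM x y : pi (x * y) = pi x * pi y.
Proof. exact: esym (pi_pres_mul x y). Qed.
Lemma pi_presZ c x : pi (c *: x) = c *: pi x.
Proof. exact: esym (pi_pres_scale c x). Qed.

Fact pi_presented_is_monoid_morphism : monoid_morphism pi.
Proof. by split=> [|x y]; [exact: pi_pres1|exact: pi_presM]. Qed.
HB.instance Definition _ :=
  GRing.isZmodMorphism.Build free presented pi pi_presB.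
HB.instance Definition _ :=
  GRing.isMonoidMorphism.Build free presented pi
    pi_presented_is_monoid_morphism.
HB.instance Definition _ :=
  GRing.isScalable.Build B free presented *:%R pi pi_presZ.

Lemma pres_scalerAl c (x y : presented) : c *: (x * y) = (c *: x) * y.
Proof.
rewrite -[x]pi_repr -[y]pi_repr -pi_presM -pi_presZ scalerAl.
by rewrite pi_presM pi_presZ.
Qed.

Lemma pres_scalerAr c (x y : presented) : c *: (x * y) = x * (c *: y).
Proof.
rewrite -[x]pi_repr -[y]pi_repr -pi_presM -pi_presZ free_scalerAr.
by rewrite pi_presM pi_presZ.
Qed.

Lemma pres_rel x y : R x y -> pi x = pi y.
Proof.
move=> Rxy; apply/pi_presentedP; rewrite -[x - y]mul1r -[1 * _]mulr1.
exact: rel_ideal_gen.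
Qed.

Definition pres_cst (c : B) : presented := c *: (1 : presented).

Fact pres_cst_is_zmod_morphism : zmod_morphism pres_cst.
Proof. by move=> a b; rewrite /pres_cst scalerBl. Qed.
HB.instance Definition _ :=
  GRing.isZmodMorphism.Build B presented pres_cst pres_cst_is_zmod_morphism.

Fact pres_cst_is_monoid_morphism : monoid_morphism pres_cst.
Proof.
split=> [|a b]; first by rewrite /pres_cst scale1r.
by rewrite /pres_cst -pres_scalerAl mul1r scalerA.
Qed.
HB.instance Definition _ :=
  GRing.isMonoidMorphism.Build B presented pres_cst
    pres_cst_is_monoid_morphism.

Lemma pres_cstC c x : pres_cst c * x = x * pres_cst c.
Proof. by rewrite /pres_cst -pres_scalerAl -pres_scalerAr mul1r mulr1. Qed.

(* The morphism prescribed by the images [f] of the generators; [phi] is the  *)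
(* structure map of the target.  It is meaningful when [pres_lift_spec]       *)
(* applies.                                                                   *)
Section Lift.
Variables (S : pzRingType) (phi : {rmorphism B -> S}) (f : I -> S).

Definition pres_lift (x : presented) : S := free_eval phi f (repr x).

Hypothesis phi_central : forall c s, phi c * s = s * phi c.
Hypothesis fR : forall x y, R x y -> free_eval phi f x = free_eval phi f y.

Lemma pres_liftE x : pres_lift (pi x) = free_eval phi f x.
Proof.
suff ev0 y : rel_ideal y -> free_eval phi f y = 0.
  by apply/eqP; rewrite -subr_eq0 -raddfB /= ev0 //; exact: ideal_repr.
elim=> [|{}y z _ Iy _ Iz|a {}y z b Ryz]; first exact: raddf0.
  by rewrite raddfD /= Iy Iz addr0.
by rewrite !free_evalM // raddfB /= (fR Ryz) subrr mulr0 mul0r.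
Qed.

Lemma pres_lift_spec :
  [/\ zmod_morphism pres_lift, monoid_morphism pres_lift,
      forall c x, pres_lift (c *: x) = phi c * pres_lift x &
      forall i, pres_lift (pres_gen i) = f i].
Proof.
split=> [x y||c x|i].
- by rewrite -[x]pi_repr -[y]pi_repr -pi_presB !pres_liftE raddfB.
- split=> [|x y]; first by rewrite -pi_pres1 pres_liftE free_eval1.
  by rewrite -[x]pi_repr -[y]pi_repr -pi_presM !pres_liftE free_evalM.
- by rewrite -[x]pi_repr -pi_presZ !pres_liftE free_evalZ.
- by rewrite pres_genE pres_liftE free_eval_gen.
Qed.

End Lift.
End Presented.

(* Symmetric groups.  Indices are shifted by one: [i : 'I_n.-1] stands for    *)
(* the simple transposition (i, i+1) on {0, .., n-1}.  Products in 'S_n are   *)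
(* read from left to right, whence the reversal in [perm_comp], which         *)
(* multiplies permutations as functions.                                      *)
Section SimpleReflections.
Variable n : nat.

Definition perm_comp (w1 w2 : 'S_n) : 'S_n := (w2 * w1)%g.

Lemma perm_compE w1 w2 x : perm_comp w1 w2 x = w1 (w2 x).
Proof. exact: permM. Qed.

Lemma ord_hi_proof (i : 'I_n.-1) : (i.+1 < n)%N.
Proof. by have := ltn_ord i; rewrite ltn_predRL. Qed.
Definition ord_lo (i : 'I_n.-1) : 'I_n := widen_ord (leq_pred n) i.
Definition ord_hi (i : 'I_n.-1) : 'I_n := Ordinal (ord_hi_proof i).
Definition simple_perm (i : 'I_n.-1) : 'S_n := tperm (ord_lo i) (ord_hi i).

Definition word_perm (s : seq 'I_n.-1) : 'S_n :=
  foldr (fun i w => perm_comp (simple_perm i) w) 1%g s.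

Definition is_reduced_word (w : 'S_n) (s : seq 'I_n.-1) : Prop :=
  word_perm s = w /\ forall s', word_perm s' = w -> (size s <= size s')%N.

Definition reduced_word (w : 'S_n) : seq 'I_n.-1 := the [::] (is_reduced_word w).

Definition perm_length (w : 'S_n) : nat := size (reduced_word w).

End SimpleReflections.

Definition ring_inv (A : pzRingType) (x : A) : A :=
  the 0 (fun y => x * y = 1 /\ y * x = 1).

Section Hecke.
Variables (B : comUnitRingType) (u v : B).

Section HeckeAlgebra.
Variable n : nat.
Local Notation free := {malg B[{fmonom 'I_n.-1}]}.
Local Notation T i := (free_gen B i).

Inductive hecke_rel : free -> free -> Prop :=
| hecke_rel_comm (i j : 'I_n.-1) : (i.+1 < j)%N || (j.+1 < i)%N ->
    hecke_rel (T i * T j) (T j * T i)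
| hecke_rel_braid (i j : 'I_n.-1) : i.+1 = j :> nat ->
    hecke_rel (T i * T j * T i) (T j * T i * T j)
| hecke_rel_quad (i : 'I_n.-1) :
    hecke_rel (T i ^+ 2) ((u ^+ 2)%:A + v *: T i).

Definition hecke := presented hecke_rel.
HB.instance Definition _ := GRing.PzRing.on hecke.
HB.instance Definition _ := GRing.Lmodule.on hecke.

Definition heckeT (i : 'I_n.-1) : hecke := pres_gen hecke_rel i.

(* By Matsumoto's theorem the choice of the reduced word is irrelevant.       *)
Definition heckeTw (w : 'S_n) : hecke :=
  (u^-1 ^+ perm_length w) *: \prod_(i <- reduced_word w) heckeT i.

End HeckeAlgebra.

Definition hecke_emb (n : nat) : hecke n -> hecke n.+1 :=
  pres_lift (pres_cst (@hecke_rel n.+1))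
    (fun i : 'I_n.-1 => heckeT (widen_ord (leq_pred n) i : 'I_n.+1.-1)).

(* [hecke 0] is the base ring, so [hecke_markov_0] says that the component at *)
(* 0 is the identity.                                                         *)
Record is_hecke_markov_trace (tau : forall n, hecke n -> B) : Prop := {
  hecke_markov_linear : forall n, scalar (@tau n);
  hecke_markov_0 : @tau 0 1 = 1;
  hecke_markov_1 : @tau 1 1 = 1;
  hecke_markov_trace : forall n (x y : hecke n.+1),
    tau n.+1 (x * y) = tau n.+1 (y * x);
  hecke_markov_pos : forall n (x : hecke n.+1),
    tau n.+2 (hecke_emb x * @heckeT n.+2 ord_max) = tau n.+1 x;
  hecke_markov_neg : forall n (x : hecke n.+1),
    tau n.+2 (hecke_emb x * ring_inv (@heckeT n.+2 ord_max)) = tau n.+1 x }.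

Definition hecke_tau : forall n, hecke n -> B :=
  the (fun _ _ => 0) is_hecke_markov_trace.

End Hecke.
Arguments hecke_rel {B} u v n _ _.

Section Compositions.
Variables d n : nat.

Definition Comp := {mu : {ffun 'I_d -> 'I_n.+1} | (\sum_(a < d) mu a == n)%N}.

Definition part (mu : Comp) (a : 'I_d) : nat := sval mu a.

Definition mult_coef (mu : Comp) : nat :=
  (n`! %/ \prod_(a < d) (part mu a)`!)%N.

(* Block [a] consists of the [i] with                                         *)
(* [block_start mu a <= i < block_start mu a + part mu a].                    *)
Definition block_start (mu : Comp) (a : 'I_d) : nat :=
  (\sum_(b < d | b < a) part mu b)%N.

Lemma block_end mu (a : 'I_d) :
  (block_start mu a + part mu a = \sum_(b < d | b <= a) part mu b)%N.
Proof.
rewrite [RHS](bigD1 a) //= addnC; congr addn; apply: eq_bigl => b.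
by rewrite ltn_neqAle andbC.
Qed.

Lemma block_end_le mu (a : 'I_d) : (block_start mu a + part mu a <= n)%N.
Proof.
rewrite block_end -[leqRHS](eqP (svalP mu)) [leqRHS](bigID (fun b : 'I_d => b <= a)%N).
exact: leq_addr.
Qed.

Lemma block_exists mu (i : 'I_n) :
  exists a : 'I_d, (block_start mu a <= i < block_start mu a + part mu a)%N.
Proof.
pose S k := (\sum_(b < d | b < k) part mu b)%N.
have Sd : S d = n.
  by rewrite /S -[RHS](eqP (svalP mu)); apply: eq_bigl => b; rewrite ltn_ord.
have exS : exists k, (i < S k)%N by exists d; rewrite Sd.
case: (ex_minnP exS) => [[|k]] iS kmin.
  by move: iS; rewrite /S big_pred0.
have kd : (k < d)%N by apply: kmin; rewrite Sd.
exists (Ordinal kd); rewrite block_end iS andbT leqNgt.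
by apply/negP => /kmin; rewrite ltnn.
Qed.

Definition block (mu : Comp) (i : 'I_n) : 'I_d := xchoose (block_exists mu i).

Definition young (mu : Comp) : {set 'S_n} :=
  [set w : 'S_n | [forall i, block mu (w i) == block mu i]].

(* Minimal length representatives of the left cosets of [young mu], listed    *)
(* with the identity first.                                                   *)
Definition min_reps (mu : Comp) : {set 'S_n} :=
  [set p | [forall w in young mu, perm_length p <= perm_length (perm_comp p w)]%N].

Definition coset_rep (mu : Comp) (k : 'I_(mult_coef mu)) : 'S_n :=
  nth 1%g (1%g :: enum (min_reps mu :\ 1%g)) k.

Lemma block_gen_proof (mu : Comp) (a : 'I_d) (i : 'I_(part mu a).-1) :
  (block_start mu a + i < n.-1)%N.
Proof.
have := ltn_ord i; rewrite !ltn_predRL -addnS => h.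
by apply: leq_trans (block_end_le mu a); rewrite ltn_add2l.
Qed.
Definition block_gen (mu : Comp) (a : 'I_d) (i : 'I_(part mu a).-1) : 'I_n.-1 :=
  Ordinal (block_gen_proof i).

End Compositions.

(* Non-zero d-tuples with entries in {0, 1}, the entries being booleans.      *)
Definition Comp0 (d : nat) := {m : {ffun 'I_d -> bool} | [exists a, m a]}.

Lemma comp_supp_proof d n (mu : Comp d n.+1) :
  [exists a, [ffun a => 0 < part mu a]%N a].
Proof.
rewrite -[X in is_true X]negbK negb_exists; apply/negP => /forallP h.
have := svalP mu; rewrite big1 // => a _; apply/eqP.
by have := h a; rewrite ffunE lt0n negbK.
Qed.
Definition comp_supp d n (mu : Comp d n.+1) : Comp0 d :=
  exist _ [ffun a => 0 < part mu a]%N (comp_supp_proof mu).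

Section YoungSubalgebra.
Variables (B : comUnitRingType) (u v : B) (d n : nat) (mu : Comp d n).
Local Notation hecke := (hecke u v).

Inductive in_heckeY : hecke n -> Prop :=
| in_heckeY_gen i : simple_perm i \in young mu -> in_heckeY (heckeT u v i)
| in_heckeY_1 : in_heckeY 1
| in_heckeYD x y : in_heckeY x -> in_heckeY y -> in_heckeY (x + y)
| in_heckeYM x y : in_heckeY x -> in_heckeY y -> in_heckeY (x * y)
| in_heckeYZ c x : in_heckeY x -> in_heckeY (c *: x).

Definition heckeY_pred : {pred hecke n} := fun x => `[< in_heckeY x >].

Lemma heckeY_predP x : reflect (in_heckeY x) (x \in heckeY_pred).
Proof. exact: asboolP. Qed.

Fact heckeY_subring : subring_closed heckeY_pred.
Proof.
split=> [|x y /heckeY_predP hx /heckeY_predP hy|x y /heckeY_predP hx /heckeY_predP hy];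
  apply/heckeY_predP.
- exact: in_heckeY_1.
- by rewrite -scaleN1r; apply: in_heckeYD => //; exact: in_heckeYZ.
- exact: in_heckeYM.
Qed.
HB.instance Definition _ :=
  GRing.isSubringClosed.Build (hecke n) heckeY_pred heckeY_subring.

Fact heckeY_scale : GRing.scaler_closed heckeY_pred.
Proof. by move=> c x /heckeY_predP hx; apply/heckeY_predP; exact: in_heckeYZ. Qed.
HB.instance Definition _ :=
  GRing.isScaleClosed.Build B (hecke n) heckeY_pred heckeY_scale.

Record heckeY := HeckeY { heckeY_val : hecke n; _ : heckeY_val \in heckeY_pred }.
HB.instance Definition _ := [isSub for heckeY_val].
HB.instance Definition _ := [Choice of heckeY by <:].
HB.instance Definition _ :=
  GRing.SubChoice_isSubPzRing.Build (hecke n) heckeY_pred heckeY heckeY_subring.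
HB.instance Definition _ := [SubZmodule_isSubLmodule of heckeY by <:].

(* The embedding of the a-th tensor factor.                                   *)
Definition block_emb (a : 'I_d) : hecke (part mu a) -> hecke n :=
  pres_lift (pres_cst (hecke_rel u v n))
    (fun i : 'I_(part mu a).-1 => heckeT u v (block_gen i)).

(* The tensor product of the traces [hecke_tau (part mu a)], the pure tensor  *)
(* of the [x a] being identified with the product of their images.            *)
Definition is_tau_tensor (phi : heckeY -> B) : Prop :=
  scalar phi /\
  forall (x : forall a : 'I_d, hecke (part mu a)) (z : heckeY),
    val z = \prod_(a < d) block_emb (x a) ->
    phi z = \prod_(a < d) hecke_tau (x a).

Definition tau_tensor : heckeY -> B := the (fun _ => 0) is_tau_tensor.

End YoungSubalgebra.
Arguments heckeY {B} u v {d n} mu.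

Definition rho_mu (B : comUnitRingType) (u v : B) (d n : nat)
    (alpha : Comp0 d -> B) (mu : Comp d n.+1) (h : heckeY u v mu) : B :=
  alpha (comp_supp mu) * tau_tensor h.

Section YokonumaHecke.
Variables (B : comUnitRingType) (u v : B) (d : nat).

Section YokonumaHeckeAlgebra.
Variable n : nat.
Local Notation free := {malg B[{fmonom ('I_n.-1 + 'I_n)%type}]}.
Local Notation g i := (free_gen B (inl i : 'I_n.-1 + 'I_n)%type).
Local Notation t j := (free_gen B (inr j : 'I_n.-1 + 'I_n)%type).

(* Since [t j ^+ d = 1], the power [t j ^+ (d - s)] is the inverse of         *)
(* [t j ^+ s] for [s < d].                                                    *)
Definition free_e (i : 'I_n.-1) : free :=
  (d%:R)^-1 *: \sum_(s < d) t (ord_lo i) ^+ s * t (ord_hi i) ^+ (d - s).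

Inductive yh_rel : free -> free -> Prop :=
| yh_rel_comm (i j : 'I_n.-1) : (i.+1 < j)%N || (j.+1 < i)%N ->
    yh_rel (g i * g j) (g j * g i)
| yh_rel_braid (i j : 'I_n.-1) : i.+1 = j :> nat ->
    yh_rel (g i * g j * g i) (g j * g i * g j)
| yh_rel_tt (i j : 'I_n) : yh_rel (t i * t j) (t j * t i)
| yh_rel_gt (i : 'I_n.-1) (j : 'I_n) :
    yh_rel (g i * t j) (t (simple_perm i j) * g i)
| yh_rel_tpow (j : 'I_n) : yh_rel (t j ^+ d) 1
| yh_rel_quad (i : 'I_n.-1) :
    yh_rel (g i ^+ 2) ((u ^+ 2)%:A + v *: (free_e i * g i)).

Definition yh := presented yh_rel.
HB.instance Definition _ := GRing.PzRing.on yh.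
HB.instance Definition _ := GRing.Lmodule.on yh.

Definition yh_g (i : 'I_n.-1) : yh := pres_gen yh_rel (inl i).
Definition yh_t (j : 'I_n) : yh := pres_gen yh_rel (inr j).

Definition yh_gw (w : 'S_n) : yh :=
  (u^-1 ^+ perm_length w) *: \prod_(i <- reduced_word w) yh_g i.

End YokonumaHeckeAlgebra.

Definition yh_emb (n : nat) : yh n -> yh n.+1 :=
  pres_lift (pres_cst (@yh_rel n.+1))
    (fun x : 'I_n.-1 + 'I_n =>
       match x with
       | inl i => yh_g (widen_ord (leq_pred n) i : 'I_n.+1.-1)
       | inr j => yh_t (widen_ord (leqnSn n) j)
       end).

(* The family is indexed from 1 on: the component at 0 is unconstrained.      *)
(* Linearity is not part of the predicate.                                    *)
Record is_yh_markov_trace (rho : forall n, yh n -> B) : Prop := {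
  yh_markov_trace : forall n (x y : yh n.+1),
    rho n.+1 (x * y) = rho n.+1 (y * x);
  yh_markov_pos : forall n (x : yh n.+1),
    rho n.+2 (yh_emb x * @yh_g n.+2 ord_max) = rho n.+1 x;
  yh_markov_neg : forall n (x : yh n.+1),
    rho n.+2 (yh_emb x * ring_inv (@yh_g n.+2 ord_max)) = rho n.+1 x }.

(* [xi] enumerates the d-th roots of unity.  A character [chi] of (Z/d)^n is  *)
(* given by the indices of its values: chi(t_j) = xi (chi j).                 *)
Variable xi : 'I_d -> B.

Section Idempotents.
Variable n : nat.

Definition E_chi (chi : {ffun 'I_n -> 'I_d}) : yh n :=
  \prod_(j < n)
     ((d%:R)^-1 *: \sum_(s < d) xi (chi j) ^+ s *: yh_t j ^+ (d - s)).

Definition perm_char (w : 'S_n) (chi : {ffun 'I_n -> 'I_d}) :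
    {ffun 'I_n -> 'I_d} :=
  [ffun j => chi ((w^-1)%g j)].

Definition has_comp (mu : Comp d n) (chi : {ffun 'I_n -> 'I_d}) : bool :=
  [forall a, #|[set j | chi j == a]| == part mu a].

Definition E_mu (mu : Comp d n) : yh n := \sum_(chi | has_comp mu chi) E_chi chi.

Definition chi_mu (mu : Comp d n) (k : 'I_(mult_coef mu)) :
    {ffun 'I_n -> 'I_d} :=
  perm_char (coset_rep k) [ffun i => block mu i].

End Idempotents.

Section Psi.
Variables (n : nat) (mu : Comp d n).

Definition EY_pred : {pred yh n} := fun z => `[< exists x, z = E_mu mu * x >].

Lemma EY_predP z : reflect (exists x, z = E_mu mu * x) (z \in EY_pred).
Proof. exact: asboolP. Qed.

Fact EY_submod : submod_closed EY_pred.
Proof.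
split=> [|c x y /EY_predP[x' ->] /EY_predP[y' ->]]; apply/EY_predP.
  by exists 0; rewrite mulr0.
by exists (c *: x' + y'); rewrite mulrDr; congr (_ + _); exact: pres_scalerAr.
Qed.
HB.instance Definition _ :=
  GRing.isSubmodClosed.Build B (yh n) EY_pred EY_submod.

Record EY := MkEY { EY_val : yh n; _ : EY_val \in EY_pred }.
HB.instance Definition _ := [isSub for EY_val].
HB.instance Definition _ := [Choice of EY by <:].
HB.instance Definition _ := [SubChoice_isSubZmodule of EY by <:].
HB.instance Definition _ := [SubZmodule_isSubLmodule of EY by <:].

Lemma EY_mul_proof (x : yh n) : E_mu mu * x \in EY_pred.
Proof. by apply/EY_predP; exists x. Qed.
Definition EY_mul (x : yh n) : EY := MkEY (EY_mul_proof x).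

Local Notation matY := 'M[heckeY u v mu]_(mult_coef mu).

(* Scaling is written entrywise, the scalars of [matY] in the library being   *)
(* the elements of [heckeY u v mu].  The basis element [E_chi * yh_gw w] of   *)
(* [EY] is entered as [E_mu * (E_chi * yh_gw w)], which is equal to it.       *)
Definition is_Psi (Psi : EY -> matY) : Prop :=
  (forall (c : B) x y i j, Psi (c *: x + y) i j = c *: Psi x i j + Psi y i j) /\
  (forall (k j : 'I_(mult_coef mu)) (w : 'S_n),
     perm_char w (chi_mu j) = chi_mu k ->
     map_mx val (Psi (EY_mul (E_chi (chi_mu k) * yh_gw w))) =
     heckeTw u v (perm_comp (perm_comp ((coset_rep k)^-1)%g w) (coset_rep j))
       *: delta_mx k j).

Definition Psi : EY -> matY := the (fun _ => 0) is_Psi.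

End Psi.
End YokonumaHecke.

Definition enumerates_unity_roots (K : fieldType) (d : nat) (xi : 'I_d -> K) :
    Prop :=
  injective xi /\ forall z, z ^+ d = 1 <-> exists a, xi a = z.

(* Main.v *)
(** Let Y act on the right ideal E_chi Y by explicit matrices: this shows that the E_chi g_w are
    linearly independent, and on this basis the right-hand side of the theorem vanishes unless w
    fixes chi, when it is alpha_[supp chi] times the product of the tau (T_p), p running over the
    permutations that w induces on the colour classes of chi (relabelled increasingly).  From
    this formula one reads off that it is a Markov trace.  The tau_n themselves come from the
    conditional expectations H_(n+1) -> H_n, built from the freeness of H_(n+1) over H_n.
    Conversely, the trace property allows us to permute the colours of chi, and if two points have
    the same colour they can be moved to the last two positions, where (M2) lowers n.  So a Markov
    trace is determined by its values at the E_chi with chi injective; these depend only on the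
    support of chi, and they are the parameters alpha. *)

(* Reduced words, [hecke_tau], [tau_tensor] and [Psi] are all given by definite descriptions, so
   nothing can be computed with them before an object with the required properties is exhibited.
   Hence the explicit models below; once they exist, only the specifications are used. In an algebra
   given by generators and relations, spanning is obtained by rewriting, but independence needs a
   representation. The one on [E_chi Y] is built over any ring carrying a [root_system], so that its
   case d = 1 also yields coordinates on the Hecke algebra. The two halves of (M2) together fix a
   constant: since T^-1 = u^-2 (T - v), an element viewed one size higher has its trace multiplied
   by z = (1 - u^2) / v. In Y, where g^-1 = u^-2 (g - v e), the same computation gives rho (x e_n) =
   z rho (x). This is what handles, in both directions of the theorem, a last point that is fixed
   and has the colour of its neighbour. Colour classes are relabelled increasingly because descents
   inside a class are then those of the induced permutation, which lets the relations of Y be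
   compared with those of the Hecke algebras of the classes. *)
Require Import Defs.
From HB Require Import structures.
From mathcomp Require Import all_boot all_order all_algebra all_fingroup.
From mathcomp Require Import generic_quotient.
From mathcomp.multinomials Require Import monalg.
From mathcomp Require Import zify ring.

Set Implicit Arguments.
Unset Strict Implicit.
Unset Printing Implicit Defensive.

Import GRing.Theory.

(** * Descents and Matsumoto's theorem *)

Ltac split_nat_ifs :=
  repeat match goal with
  | |- context [ if ?b then _ else _ ] =>
      lazymatch b with
      | context [ if _ then _ else _ ] => fail
      | _ => let e := fresh "e" in case e: b
      end
  end.

Section Inversions.
Variable n : nat.
Implicit Types (w p : 'S_n) (i j : 'I_n.-1) (s : seq 'I_n.-1).
Local Open Scope group_scope.
Local Notation s_ i := (simple_perm i).

Definition inversions w : {set 'I_n * 'I_n} :=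
  [set p : 'I_n * 'I_n | (p.1 < p.2)%N && (w p.2 < w p.1)%N].
Definition inv_number w := #|inversions w|.

(** Products in ['S_n] being read from left to right, [w * s_i] is the function [s_i] after [w]; it
    is shorter than [w] exactly when [ldescent i w]. Right descents concern [s_i * w]. *)
Definition ldescent i w := (w^-1 (ord_hi i) < w^-1 (ord_lo i))%N.
Definition rdescent i w := (w (ord_hi i) < w (ord_lo i))%N.

Lemma ldescentV i w : ldescent i w^-1 = rdescent i w.
Proof. by rewrite /ldescent invgK. Qed.

Lemma rdescentV i w : rdescent i w^-1 = ldescent i w.
Proof. by []. Qed.

Lemma simple_permE i (x : 'I_n) :
  s_ i x = (if (x == i :> nat) then i.+1 else if (x == i.+1 :> nat) then i : nat else x) :> nat.
Proof.
rewrite /simple_perm; case: tpermP => [->|->|/eqP x1 /eqP x2] /=.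
- by rewrite eqxx.
- by rewrite eqxx; case: eqP => // h; lia.
- by move: x1 x2; rewrite -!(inj_eq val_inj) /= => /negPf -> /negPf ->.
Qed.

Lemma simple_perm_lo i : s_ i (ord_lo i) = ord_hi i.
Proof. exact: tpermL. Qed.

Lemma simple_perm_hi i : s_ i (ord_hi i) = ord_lo i.
Proof. exact: tpermR. Qed.

Lemma simple_permK i : s_ i * s_ i = 1.
Proof. exact: tperm2. Qed.

Lemma simple_permV i : (s_ i)^-1 = s_ i.
Proof. exact: tpermV. Qed.

Lemma simple_permKg i w : w * s_ i * s_ i = w.
Proof. by rewrite -mulgA simple_permK mulg1. Qed.

Lemma simple_perm_comm i j : (i.+1 < j)%N || (j.+1 < i)%N ->
  s_ i * s_ j = s_ j * s_ i.
Proof.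
move=> ij; apply/permP => x; apply: val_inj.
by rewrite /= !permM !simple_permE; split_nat_ifs; lia.
Qed.

Lemma simple_perm_braid i j : i.+1 = j :> nat ->
  s_ i * s_ j * s_ i = s_ j * s_ i * s_ j.
Proof.
move=> ij; apply/permP => x; apply: val_inj.
by rewrite /= !permM !simple_permE; split_nat_ifs; lia.
Qed.

Lemma ord_lo_neq_hi i : ord_lo i != ord_hi i.
Proof. by apply/eqP => /(congr1 val) /=; lia. Qed.

Lemma ldescentM i w : ldescent i (w * s_ i) = ~~ ldescent i w.
Proof.
rewrite /ldescent invMg simple_permV !permM /simple_perm tpermL tpermR -leqNgt.
by rewrite ltn_neqAle (inj_eq val_inj) (inj_eq perm_inj) ord_lo_neq_hi.
Qed.

(** Exchanging the values i and i+1 only affects the pair formed by their preimages [a < b], which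
    becomes the one new inversion. *)
Lemma inv_number_up i w : ~~ ldescent i w -> inv_number (w * s_ i) = (inv_number w).+1.
Proof.
rewrite /ldescent -leqNgt => le.
set a := w^-1 (ord_lo i) in le; set b := w^-1 (ord_hi i) in le.
have wa : w a = ord_lo i by rewrite permKV.
have wb : w b = ord_hi i by rewrite permKV.
clearbody a b.
have ab : (a < b)%N.
  rewrite ltn_neqAle le andbT; apply/eqP => /val_inj/(congr1 w)/(congr1 val) /=.
  by rewrite wa wb /=; lia.
rewrite /inv_number; have -> : inversions (w * s_ i) = (a, b) |: inversions w.
  apply/setP => -[x y]; rewrite !inE /= !permM !simple_permE xpair_eqE.
  have xa : (x == a) = (w x == i :> nat).
    by rewrite -(inj_eq (@perm_inj _ w)) wa -(inj_eq val_inj).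
  have xb : (x == b) = (w x == i.+1 :> nat).
    by rewrite -(inj_eq (@perm_inj _ w)) wb -(inj_eq val_inj).
  have ya : (y == a) = (w y == i :> nat).
    by rewrite -(inj_eq (@perm_inj _ w)) wa -(inj_eq val_inj).
  have yb : (y == b) = (w y == i.+1 :> nat).
    by rewrite -(inj_eq (@perm_inj _ w)) wb -(inj_eq val_inj).
  rewrite xa yb; case: (ltnP x y) => xy /=; last first.
    rewrite orbF -xa -yb; apply/esym/negP => /andP[/eqP ? /eqP ?]; subst x y; lia.
  have nxy : w x <> w y :> nat by move=> /val_inj/perm_inj exy; subst y; lia.
  have nba : (w x == i.+1 :> nat) && (w y == i :> nat) = false.
    rewrite -xb -ya; apply/negP => /andP[/eqP ? /eqP ?]; subst x y; lia.
  by move: nba nxy xy; split_nat_ifs; lia.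
rewrite cardsU1 !inE /= wa wb /= ab /=.
by rewrite (_ : (i.+1 < i)%N = false) //; lia.
Qed.

Lemma inv_number_down i w : ldescent i w -> inv_number w = (inv_number (w * s_ i)).+1.
Proof.
move=> d; rewrite -[in LHS](simple_permKg i w) inv_number_up //.
by rewrite ldescentM d.
Qed.

Lemma inv_numberV w : inv_number w^-1 = inv_number w.
Proof.
have inj : injective (fun p : 'I_n * 'I_n => (w p.2, w p.1)).
  by case=> [a b] [c e] [] /perm_inj-> /perm_inj->.
rewrite /inv_number -(card_imset (mem (inversions w)) inj).
apply: eq_card => -[x y]; rewrite !inE /=.
apply/andP/imsetP => [[xy yx]|[[a b]]].
  exists (w^-1 y, w^-1 x); rewrite ?inE /= ?permKV //; exact/andP.
by rewrite inE /= => /andP[ab ba] [-> ->]; rewrite !permK.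
Qed.

Lemma inv_number_rup i w : ~~ rdescent i w -> inv_number (s_ i * w) = (inv_number w).+1.
Proof.
rewrite -ldescentV => d.
by rewrite -inv_numberV invMg simple_permV inv_number_up // inv_numberV.
Qed.

Lemma rdescentM i w : rdescent i (s_ i * w) = ~~ rdescent i w.
Proof. by rewrite -!ldescentV invMg simple_permV ldescentM. Qed.

Lemma inv_number_rdown i w : rdescent i w -> inv_number w = (inv_number (s_ i * w)).+1.
Proof.
move=> d; have e : w = s_ i * (s_ i * w) by rewrite mulgA simple_permK mul1g.
by rewrite {1}e inv_number_rup // rdescentM d.
Qed.

Lemma inv_number_simple_le i w : (inv_number (w * s_ i) <= (inv_number w).+1)%N.
Proof.
by case: (boolP (ldescent i w)) => [/inv_number_down|/inv_number_up] ->; lia.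
Qed.

Lemma inv_number1 : inv_number 1 = 0.
Proof. by apply/eqP; rewrite cards_eq0; apply/eqP/setP => -[x y]; rewrite !inE !perm1 /=; lia. Qed.

(** Without descents [w] is increasing, hence dominates the identity pointwise; the sums of values
    agree, so every inequality is an equality. *)
Lemma no_rdescent w : (forall i, ~~ rdescent i w) -> w = 1.
Proof.
move=> nd.
have le k (x : 'I_n) : x = k :> nat -> (x <= w x)%N.
  elim: k x => [|k IH] x xk; first by lia.
  have kn : (k < n.-1)%N by rewrite ltn_predRL -xk; exact: ltn_ord.
  pose i := Ordinal kn.
  have xi : x = ord_hi i by apply: val_inj; rewrite /= xk.
  have := nd i; rewrite /rdescent -leqNgt -xi leq_eqVlt => /orP[/eqP/val_inj/perm_inj|].
    by move=> /(congr1 val) /=; lia.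
  have := IH (ord_lo i) erefl; rewrite /=; lia.
have /leqif_sum [_ h] : forall x : 'I_n, predT x -> (x <= w x ?= iff (x == w x))%N.
  by move=> x _; split; [exact: le | rewrite -(inj_eq val_inj)].
have : (\sum_(x < n) x == \sum_(x < n) w x)%N.
  by rewrite (reindex_inj (@perm_inj _ w)).
rewrite h => /forall_inP e.
by apply/permP => x; rewrite perm1 -(eqP (e x isT)).
Qed.

Lemma exists_ldescent w : w != 1 -> exists i, ldescent i w.
Proof.
move=> w1; case: (pickP (fun i => ldescent i w)) => [i d|nd]; first by exists i.
by move: w1; rewrite -invg_eq1 (no_rdescent (w := w^-1)) ?eqxx // => i; rewrite rdescentV nd.
Qed.

Lemma inv_number_eq0 w : inv_number w = 0 -> w = 1.
Proof.
move=> l0; apply/eqP; apply: contraT => /exists_ldescent [i] /inv_number_down.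
by rewrite l0.
Qed.

Lemma word_perm_cons i s : word_perm (i :: s) = word_perm s * s_ i.
Proof. by []. Qed.

Lemma word_perm_cat s s' : word_perm (s ++ s') = word_perm s' * word_perm s.
Proof. by elim: s => [|i s IH]; rewrite ?mulg1 // cat_cons !word_perm_cons IH mulgA. Qed.

Lemma word_perm_rcons i s : word_perm (rcons s i) = s_ i * word_perm s.
Proof. by rewrite -cats1 word_perm_cat word_perm_cons mul1g. Qed.

Lemma inv_number_word s : (inv_number (word_perm s) <= size s)%N.
Proof.
elim: s => [|i s IH]; first by rewrite inv_number1.
by rewrite word_perm_cons (leq_trans (inv_number_simple_le _ _)).
Qed.

Lemma short_word_exists w : exists s, word_perm s = w /\ size s = inv_number w.
Proof.
move eqm : (inv_number w) => m; elim: m w eqm => [|m IH] w wm.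
  by exists [::]; rewrite (inv_number_eq0 wm).
have [|i d] := @exists_ldescent w.
  by apply: contra_eq_neq wm => ->; rewrite inv_number1.
have [|s [ws sm]] := IH (w * s_ i); first by have := inv_number_down d; lia.
by exists (i :: s); rewrite word_perm_cons ws simple_permKg /= sm.
Qed.

Lemma reduced_wordP w : is_reduced_word w (reduced_word w).
Proof.
apply: theP; have [s [ws sm]] := short_word_exists w.
by exists s; split=> // s' ws'; rewrite sm -ws'; exact: inv_number_word.
Qed.

Lemma reduced_wordK w : word_perm (reduced_word w) = w.
Proof. by have [] := reduced_wordP w. Qed.

Lemma perm_lengthE w : perm_length w = inv_number w.
Proof.
have [e h] := reduced_wordP w; apply/eqP; rewrite eqn_leq.
have [s [ws sm]] := short_word_exists w.
by rewrite -{1}sm h //= -{1}e inv_number_word.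
Qed.

(** Each letter changes the number of inversions by exactly one, so a word as short as this number
    must gain an inversion at every letter. *)
Lemma word_perm_reduced s : size s = inv_number (word_perm s) ->
  forall i s', s = i :: s' -> size s' = inv_number (word_perm s') /\ ldescent i (word_perm s).
Proof.
move=> e0 i s' ?; subst s.
have e : (size s').+1 = inv_number (word_perm (i :: s')) by [].
have := inv_number_word s'.
case: (boolP (ldescent i (word_perm s'))) => d; last first.
  by move: e; rewrite word_perm_cons ldescentM d inv_number_up //; lia.
by have := inv_number_down d; rewrite -word_perm_cons; lia.
Qed.

End Inversions.

Section Matsumoto.
Variables (n : nat) (A : pzRingType) (f : 'I_n.-1 -> A).
Local Open Scope ring_scope.
Hypothesis f_comm : forall i j : 'I_n.-1, (i.+1 < j)%N || (j.+1 < i)%N ->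
  f i * f j = f j * f i.
Hypothesis f_braid : forall i j : 'I_n.-1, i.+1 = j :> nat ->
  f i * f j * f i = f j * f i * f j.
Implicit Types (w : 'S_n) (i j : 'I_n.-1) (s : seq 'I_n.-1).
Local Notation s_ i := (simple_perm i).
Local Notation prod s := (\prod_(i <- s) f i).

Lemma ldescent_far i j w : (i.+1 < j)%N || (j.+1 < i)%N ->
  ldescent i (w * s_ j)%g = ldescent i w.
Proof.
move=> ij; rewrite /ldescent invMg simple_permV !permM.
have -> : s_ j (ord_hi i) = ord_hi i.
  by apply: val_inj; rewrite /= simple_permE /=; split_nat_ifs; lia.
have -> // : s_ j (ord_lo i) = ord_lo i.
by apply: val_inj; rewrite /= simple_permE /=; split_nat_ifs; lia.
Qed.

(** If two neighbouring reflections are both left descents, three letters in a row can be peeled off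
    [w], so that a braid move applies at the beginning of a reduced word. *)
Lemma ldescent_braid i j w : i.+1 = j :> nat \/ j.+1 = i :> nat ->
  ldescent i w -> ldescent j w ->
  ldescent j (w * s_ i)%g /\ ldescent i (w * s_ i * s_ j)%g.
Proof.
rewrite /ldescent => -[ij|ij] di dj.
- have e : ord_hi i = ord_lo j by apply: val_inj; rewrite /= ij.
  have e1 : s_ i (ord_hi j) = ord_hi j.
    by apply: val_inj; rewrite /= simple_permE /=; split_nat_ifs; lia.
  have e2 : s_ j (ord_lo i) = ord_lo i.
    by apply: val_inj; rewrite /= simple_permE /=; split_nat_ifs; lia.
  rewrite !invMg !simple_permV !permM e1 -e simple_perm_hi e2 simple_perm_lo.
  rewrite e simple_perm_lo e1; rewrite e in di.
  by split=> //; exact: ltn_trans dj di.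
- have e : ord_lo i = ord_hi j by apply: val_inj; rewrite /= ij.
  have e1 : s_ i (ord_lo j) = ord_lo j.
    by apply: val_inj; rewrite /= simple_permE /=; split_nat_ifs; lia.
  have e2 : s_ j (ord_hi i) = ord_hi i.
    by apply: val_inj; rewrite /= simple_permE /=; split_nat_ifs; lia.
  rewrite !invMg !simple_permV !permM e1 -e simple_perm_lo e2 simple_perm_hi.
  rewrite e simple_perm_hi e1; rewrite e in di.
  by split=> //; exact: ltn_trans di dj.
Qed.

(** Reduced words with distinct first letters i and j are compared through two intermediate words
    with a common tail [c], whose beginnings differ by one commutation or braid move. All other
    comparisons are between words with the same first letter, where the induction hypothesis applies
    to the tails. *)
Theorem matsumoto s s' : word_perm s = word_perm s' ->
  size s = inv_number (word_perm s) -> size s' = inv_number (word_perm s') ->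
  prod s = prod s'.
Proof.
move eqm : (size s) => m; elim: m s s' eqm => [|m IH] [|i a] [|j b] // sm ws rs rs'.
- by move: rs'; rewrite -ws -rs.
- by move: rs; rewrite ws -rs'.
have ra : size (i :: a) = inv_number (word_perm (i :: a)) by rewrite sm.
have [ra1 di] := word_perm_reduced ra erefl.
have [rb1 dj] := word_perm_reduced rs' erefl.
have sa : size a = m by case: sm.
rewrite !big_cons.
case: (eqVneq i j) => [ij|ij].
  subst j; congr (_ * _); apply: IH => //; last by rewrite -sa.
  by move: ws; rewrite !word_perm_cons => /mulIg.
set w := word_perm (i :: a) in ws di; rewrite -/w in ws dj; rewrite -ws in dj.
have wa : word_perm a = (w * s_ i)%g by rewrite /w word_perm_cons simple_permKg.
have wb : word_perm b = (w * s_ j)%g by rewrite ws word_perm_cons simple_permKg.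
have lw : inv_number w = m.+1 by rewrite -rs.
have la := inv_number_down di; have lb := inv_number_down dj.
have sb : size b = m by rewrite rb1 wb; lia.
case: (boolP ((i.+1 < j)%N || (j.+1 < i)%N)) => [far|near].
  have d2 : ldescent j (w * s_ i)%g by rewrite ldescent_far // orbC.
  have := inv_number_down d2 => l2.
  have [c [wc sc]] := short_word_exists (w * s_ i * s_ j)%g.
  have wjc : word_perm (j :: c) = (w * s_ i)%g.
    by rewrite word_perm_cons wc simple_permKg.
  have wic : word_perm (i :: c) = (w * s_ j)%g.
    by rewrite word_perm_cons wc -mulgA -simple_perm_comm // mulgA simple_permKg.
  rewrite (IH a (j :: c)) ?wa ?wjc //=; try lia.
  rewrite (IH b (i :: c)) ?wb ?wic //=; try lia.
  by rewrite !big_cons !mulrA f_comm.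
have nij : i.+1 = j :> nat \/ j.+1 = i :> nat.
  by move: near ij; rewrite -(inj_eq val_inj) /=; lia.
have [d2 d3] := ldescent_braid nij di dj.
have l2 := inv_number_down d2; have l3 := inv_number_down d3.
(* [c] is what remains of [w] once the longest element of the group generated by [s_i] and [s_j] is
   removed. *)
have [c [wc sc]] := short_word_exists (w * s_ i * s_ j * s_ i)%g.
have br : (s_ i * s_ j * s_ i = s_ j * s_ i * s_ j)%g.
  by case: nij => e; [exact: simple_perm_braid | exact/esym/simple_perm_braid].
have wjc : word_perm (j :: i :: c) = (w * s_ i)%g.
  by rewrite !word_perm_cons wc !simple_permKg.
have wic : word_perm (i :: j :: c) = (w * s_ j)%g.
  rewrite !word_perm_cons wc; have -> : (w * s_ i * s_ j * s_ i = w * (s_ j * s_ i * s_ j))%g.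
    by rewrite -br !mulgA.
  by rewrite !mulgA !simple_permKg.
rewrite (IH a (j :: i :: c)) ?wa ?wjc //=; try lia.
rewrite (IH b (i :: j :: c)) ?wb ?wic //=; try lia.
rewrite !big_cons !mulrA.
by case: nij => /f_braid ->.
Qed.

Definition Tword w : A := prod (reduced_word w).

Lemma TwordE s : size s = inv_number (word_perm s) -> Tword (word_perm s) = prod s.
Proof.
move=> rs; apply: matsumoto; rewrite ?reduced_wordK //.
exact: perm_lengthE.
Qed.

Lemma Tword1 : Tword 1%g = 1.
Proof. by rewrite (@TwordE [::]) ?big_nil //= inv_number1. Qed.

Lemma Tword_up i w : ~~ ldescent i w -> Tword (w * s_ i)%g = f i * Tword w.
Proof.
move=> d; rewrite -{1}(reduced_wordK w) -word_perm_cons TwordE ?big_cons //.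
by rewrite word_perm_cons reduced_wordK inv_number_up //= -perm_lengthE.
Qed.

Lemma Tword_rup i w : ~~ rdescent i w -> Tword (s_ i * w)%g = Tword w * f i.
Proof.
move=> d; rewrite -{1}(reduced_wordK w) -word_perm_rcons TwordE ?big_rcons //.
by rewrite word_perm_rcons reduced_wordK inv_number_rup //= size_rcons -perm_lengthE.
Qed.

End Matsumoto.

(** * Standardization of permutations along increasing maps *)

Section Standardization.
Variables (m n : nat) (f : 'I_m -> 'I_n).
Implicit Types (w : 'S_n) (p : 'S_m) (x y : 'I_m).
Local Open Scope group_scope.

Definition stable w := forall x, exists y, f y = w (f x).

(** The default value 1 makes [std] total, so that it can be rewritten without carrying a proof of
    stability. For an increasing [f] with stable image it is the permutation that [w] induces on
    this image. *)
Definition std w : 'S_m := odflt 1 [pick p : 'S_m | [forall x, f (p x) == w (f x)]].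

Hypothesis f_incr : forall x y, (x < y)%N -> (f x < f y)%N.

Lemma incr_ltE x y : (f x < f y)%N = (x < y)%N.
Proof.
apply/idP/idP => [fxy|]; last exact: f_incr.
rewrite ltnNge; apply: contraL fxy; rewrite -leqNgt leq_eqVlt.
by case/orP => [/eqP/val_inj ->|/f_incr/ltnW].
Qed.

Lemma incr_inj : injective f.
Proof.
move=> x y e; apply: val_inj; apply/eqP; rewrite eqn_leq.
by rewrite (leqNgt x) (leqNgt y) -(incr_ltE x y) -(incr_ltE y x) e ltnn.
Qed.

Lemma stdE w x : stable w -> f (std w x) = w (f x).
Proof.
move=> st; rewrite /std; case: pickP => [p /forallP/(_ x)/eqP //|/= h].
have stb y : exists y', f y' == w (f y) by have [y' <-] := st y; exists y'.
pose g y := xchoose (stb y).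
have gE y : f (g y) = w (f y) by exact/eqP/(xchooseP (stb y)).
have g_inj : injective g.
  by move=> y y' /(congr1 f); rewrite !gE => /perm_inj/incr_inj.
have /negP[] := negbT (h (perm g_inj)).
by apply/forallP => y; rewrite permE gE.
Qed.

Lemma std_uniq w p : (forall x, f (p x) = w (f x)) -> std w = p.
Proof.
move=> h; have st : stable w by move=> x; exists (p x).
by apply/permP => x; apply: incr_inj; rewrite stdE.
Qed.

Lemma std1 : std 1 = 1.
Proof. by apply: std_uniq => x; rewrite !perm1. Qed.

Lemma stdM w w' : stable w -> stable w' -> std (w * w') = std w * std w'.
Proof. by move=> st st'; apply: std_uniq => x; rewrite !permM !stdE. Qed.

Lemma stdV w x : stable w -> w^-1 (f x) = f ((std w)^-1 x).
Proof. by move=> st; rewrite -{1}(permKV (std w) x) stdE // permK. Qed.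

Section SimpleInside.
Variables (i : 'I_n.-1) (k : 'I_m.-1).
Hypotheses (flo : f (ord_lo k) = ord_lo i) (fhi : f (ord_hi k) = ord_hi i).

Lemma std_simple_spec x : f (simple_perm k x) = simple_perm i (f x).
Proof.
rewrite {1}/simple_perm; case: tpermP => [->|->|/eqP xl /eqP xh].
- by rewrite flo simple_perm_lo fhi.
- by rewrite fhi simple_perm_hi flo.
- by rewrite /simple_perm tpermD // eq_sym -?flo -?fhi (inj_eq incr_inj).
Qed.

Lemma stable_simple_in : stable (simple_perm i).
Proof. by move=> x; exists (simple_perm k x); exact: std_simple_spec. Qed.

Lemma std_simple_in : std (simple_perm i) = simple_perm k.
Proof. exact/std_uniq/std_simple_spec. Qed.

(** This is the gain of increasing labels: neighbours lying in the image of [f] keep being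
    neighbours, and their order under [w^-1] is that of the induced permutation. *)
Lemma ldescent_std w : stable w -> ldescent k (std w) = ldescent i w.
Proof. by move=> st; rewrite /ldescent -flo -fhi !stdV // incr_ltE. Qed.

Lemma rdescent_std w : stable w -> rdescent k (std w) = rdescent i w.
Proof. by move=> st; rewrite /rdescent -flo -fhi -!stdE // incr_ltE. Qed.

End SimpleInside.

Section SimpleOutside.
Variable i : 'I_n.-1.
Hypothesis f_out : forall x, f x != ord_lo i /\ f x != ord_hi i.

Lemma simple_out x : simple_perm i (f x) = f x.
Proof. by have [a b] := f_out x; rewrite /simple_perm tpermD // eq_sym. Qed.

Lemma stable_simple_out : stable (simple_perm i).
Proof. by move=> x; exists x; rewrite simple_out. Qed.

Lemma std_simple_out : std (simple_perm i) = 1.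
Proof. by apply: std_uniq => x; rewrite simple_out perm1. Qed.

End SimpleOutside.

(** A position strictly between [x] and [y] would be sent strictly between two consecutive
    values. *)
Lemma incr_adjacent (i : 'I_n.-1) x y : f x = ord_lo i -> f y = ord_hi i ->
  exists k : 'I_m.-1, f (ord_lo k) = ord_lo i /\ f (ord_hi k) = ord_hi i.
Proof.
move=> fx fy; have xy : (x < y)%N by rewrite -incr_ltE fx fy /=.
have yx : y = x.+1 :> nat.
  apply/eqP; rewrite eqn_leq xy andbT leqNgt; apply/negP => lt.
  have xm : (x.+1 < m)%N by exact: ltn_trans lt (ltn_ord y).
  have := f_incr (x := x) (y := Ordinal xm) (ltnSn x).
  have := f_incr (x := Ordinal xm) (y := y) lt.
  by rewrite fx fy /=; lia.
have km : (x < m.-1)%N by rewrite ltn_predRL -yx.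
exists (Ordinal km); split; [rewrite -fx | rewrite -fy]; congr f; exact: val_inj.
Qed.

End Standardization.

(** As a function, the permutation on the right is p^-1 w p. This turns the conjugates by coset
    representatives occurring in [Psi] into permutations induced by [w] itself. *)
Lemma std_conj m n (f : 'I_m -> 'I_n) (p w : 'S_n) :
  std (fun x => p (f x)) w = std f (p * w * p^-1)%g.
Proof.
rewrite /std; congr odflt; apply: eq_pick => q; apply: eq_forallb => x.
by rewrite !permM -[RHS](inj_eq (@perm_inj _ p)) permKV.
Qed.

Lemma incr_perm_id m (p : 'S_m) : (forall x y : 'I_m, (x < y)%N -> (p x < p y)%N) -> p = 1%g.
Proof.
move=> p_incr; apply: no_rdescent => i; rewrite /rdescent -leqNgt ltnW //.
by apply: p_incr => /=.
Qed.

(** Comparing the two enumerations gives an increasing permutation of the indices, which is the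
    identity. It makes the traces below independent of how a colour class is enumerated. *)
Lemma incr_enum_eq m m' n (f : 'I_m -> 'I_n) (f' : 'I_m' -> 'I_n) :
  (forall x y : 'I_m, (x < y)%N -> (f x < f y)%N) ->
  (forall x y : 'I_m', (x < y)%N -> (f' x < f' y)%N) ->
  (forall x, exists y, f' y = f x) -> (forall y, exists x, f x = f' y) ->
  exists e : m = m', forall x, f' (cast_ord e x) = f x.
Proof.
move=> fi fi' h h'.
have inj := incr_inj fi; have inj' := incr_inj fi'.
have e : m = m'.
  rewrite -(card_ord m) -(card_ord m') -(card_codom inj) -(card_codom inj').
  apply: eq_card => z; apply/codomP/codomP => [[x ->]|[x ->]].
    by have [y <-] := h x; exists y.
  by have [y <-] := h' x; exists y.
exists e; subst m' => x; rewrite cast_ord_id.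
have hb y : exists y', f' y' == f y by have [y' <-] := h y; exists y'.
pose g y := xchoose (hb y).
have gE y : f' (g y) = f y by exact/eqP/(xchooseP (hb y)).
have g_inj : injective g by move=> y y' /(congr1 f'); rewrite !gE => /inj.
have /permP/(_ x) : perm g_inj = 1%g.
  by apply: incr_perm_id => y y' lt; rewrite !permE -(incr_ltE fi') !gE fi.
by rewrite permE perm1 => e; rewrite -[RHS]gE e.
Qed.

(** * Blocks of a composition and Young subgroups *)

Section Blocks.
Variables (d n : nat) (mu : Comp d n).
Implicit Types (a b : 'I_d) (x y : 'I_n).

Lemma blockP x :
  (block_start mu (block mu x) <= x <
   block_start mu (block mu x) + part mu (block mu x))%N.
Proof. exact: xchooseP (block_exists mu x). Qed.

Lemma block_end_start a b : (a < b)%N -> (block_start mu a + part mu a <= block_start mu b)%N.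
Proof.
move=> ab; rewrite block_end /block_start [leqRHS](bigID (fun c : 'I_d => c <= a)%N) /=.
rewrite (eq_bigl (fun c : 'I_d => (c < b)%N && (c <= a)%N)) ?leq_addr // => c.
by case: (leqP c a) => h; rewrite ?andbF //= andbT; lia.
Qed.

Lemma block_unique a x : (block_start mu a <= x < block_start mu a + part mu a)%N -> block mu x = a.
Proof.
move=> /andP[h1 h2]; have /andP[h3 h4] := blockP x.
apply/val_inj; case: (ltngtP (block mu x) a) => // /block_end_start; lia.
Qed.

Lemma block_mono x y : (x <= y)%N -> (block mu x <= block mu y)%N.
Proof.
move=> xy; rewrite leqNgt; apply/negP => /block_end_start.
have := blockP x; have := blockP y; lia.
Qed.

Lemma block_inj_proof a (k : 'I_(part mu a)) : (block_start mu a + k < n)%N.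
Proof. by have := block_end_le mu a; have := ltn_ord k; lia. Qed.
Definition block_inj a (k : 'I_(part mu a)) : 'I_n := Ordinal (block_inj_proof k).

Lemma block_inj_incr a (x y : 'I_(part mu a)) : (x < y)%N -> (block_inj x < block_inj y)%N.
Proof. by rewrite /= ltn_add2l. Qed.

Lemma block_block_inj a (k : 'I_(part mu a)) : block mu (block_inj k) = a.
Proof. by apply: block_unique => /=; rewrite leq_addr ltn_add2l ltn_ord. Qed.

Lemma block_inj_surj a x : block mu x = a -> exists k : 'I_(part mu a), block_inj k = x.
Proof.
move=> <-; have /andP[h1 h2] := blockP x.
have k : (x - block_start mu (block mu x) < part mu (block mu x))%N by lia.
by exists (Ordinal k); apply: val_inj => /=; rewrite subnKC.
Qed.

Lemma young_stable a (w : 'S_n) : w \in young mu -> stable (@block_inj a) w.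
Proof.
by rewrite inE => /forallP h k; apply: block_inj_surj; rewrite (eqP (h _)) block_block_inj.
Qed.

Lemma youngP (w : 'S_n) : reflect (forall x, block mu (w x) = block mu x) (w \in young mu).
Proof. by rewrite inE; apply: (iffP forallP) => h x; apply/eqP. Qed.

Lemma young1 : 1%g \in young mu.
Proof. by apply/youngP => x; rewrite perm1. Qed.

Lemma youngM (w w' : 'S_n) : w \in young mu -> w' \in young mu -> (w * w')%g \in young mu.
Proof. by move=> /youngP h /youngP h'; apply/youngP => x; rewrite permM h' h. Qed.

Lemma youngV (w : 'S_n) : w \in young mu -> (w^-1)%g \in young mu.
Proof. by move=> /youngP h; apply/youngP => x; rewrite -{2}(permKV w x) h. Qed.

Lemma young_simple (i : 'I_n.-1) :
  (simple_perm i \in young mu) = (block mu (ord_lo i) == block mu (ord_hi i)).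
Proof.
apply/youngP/eqP => [h|e x]; first by rewrite -(h (ord_lo i)) simple_perm_lo.
by rewrite /simple_perm; case: tpermP => // ->.
Qed.

(** Blocks are intervals and [w^-1] preserves each of them, so it cannot reverse two points of
    different blocks. *)
Lemma young_ldescent (i : 'I_n.-1) (w : 'S_n) : w \in young mu -> ldescent i w ->
  block mu (ord_lo i) = block mu (ord_hi i).
Proof.
move=> /youngV/youngP h; rewrite /ldescent => /ltnW/block_mono; rewrite !h => le.
by apply: val_inj; apply/eqP; rewrite eqn_leq le andbT block_mono //=.
Qed.

Lemma block_gen_lo a (k : 'I_(part mu a).-1) : ord_lo (block_gen k) = block_inj (ord_lo k).
Proof. exact: val_inj. Qed.

Lemma block_gen_hi a (k : 'I_(part mu a).-1) : ord_hi (block_gen k) = block_inj (ord_hi k).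
Proof. by apply: val_inj; rewrite /= addnS. Qed.

Lemma block_genP (i : 'I_n.-1) : block mu (ord_lo i) = block mu (ord_hi i) ->
  exists k : 'I_(part mu (block mu (ord_lo i))).-1, block_gen k = i.
Proof.
move=> e; have [x ex] := block_inj_surj (erefl (block mu (ord_lo i))).
have [y ey] := block_inj_surj (esym e).
have [k [kl kh]] := incr_adjacent (@block_inj_incr _) ex ey.
by exists k; apply: val_inj; have := congr1 val kl.
Qed.

Lemma simple_outside a (i : 'I_n.-1) : block mu (ord_lo i) = block mu (ord_hi i) ->
  a != block mu (ord_lo i) ->
  forall k : 'I_(part mu a), block_inj k != ord_lo i /\ block_inj k != ord_hi i.
Proof.
move=> e ne k; split; apply: contraNneq ne => h.
  by rewrite -h block_block_inj.
by rewrite e -h block_block_inj.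
Qed.

End Blocks.

Local Open Scope ring_scope.

(** * Spanning by the elements indexed by permutations *)

Section PresentedTheory.
Local Open Scope quotient_scope.
Variables (B : comNzRingType) (I : choiceType).
Local Notation free := {malg B[{fmonom I}]}.

Lemma mkmalgUM (k l : {fmonom I}) (x y : B) :
  mkmalgU k x * mkmalgU l y = mkmalgU (monalg.mmul k l) (x * y) :> free.
Proof.
rewrite (malgMEw (msuppU_le) (msuppU_le)) !finmap.big_seq_fset1 !mcoeffUU //.
Qed.

Lemma free_ind (P : free -> Prop) :
  P 1 -> (forall x y, P x -> P y -> P (x + y)) -> (forall c x, P x -> P (c *: x)) ->
  (forall i x, P x -> P (free_gen B i * x)) -> forall x, P x.
Proof.
move=> P1 PD PZ PM x; rewrite [x]monalgE.
have P0 : P 0 by rewrite -(scale0r 1); exact: PZ.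
elim/big_ind: _ => //= k _.
have -> : mkmalgU k (mcoeff k x) = mcoeff k x *: mkmalgU k 1.
  by apply/malgP => l; rewrite mcoeffZ !mcoeffU mulrnAr mulr1.
apply: PZ; case: k => s; elim: s => [|i s IH].
  by rewrite -fmoneE.
have -> : mkmalgU (FMonom (i :: s)) 1 = free_gen B i * mkmalgU (FMonom s) 1.
  rewrite /free_gen locked_withE mkmalgUM mulr1; congr mkmalgU.
  by apply: val_inj; rewrite /= fmM fmU.
exact: PM.
Qed.

Section FreeEvalX.
Variables (S : pzRingType) (phi : {rmorphism B -> S}) (f : I -> S).
Hypothesis phi_central : forall c s, phi c * s = s * phi c.

Lemma free_evalM3 x y z :
  free_eval phi f (x * y * z) = free_eval phi f x * free_eval phi f y * free_eval phi f z.
Proof.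
apply: etrans (free_evalM f phi_central (x * y) z) _; congr (_ * _).
exact: free_evalM.
Qed.

Lemma free_evalX x k : free_eval phi f (x ^+ k) = free_eval phi f x ^+ k.
Proof.
elim: k => [|k IH]; first by rewrite !expr0 free_eval1.
rewrite exprS [RHS]exprS -IH; exact: free_evalM.
Qed.
End FreeEvalX.

Variable R : free -> free -> Prop.
Local Notation A := (presented R).

Lemma pres_ind (P : A -> Prop) :
  P 1 -> (forall x y, P x -> P y -> P (x + y)) -> (forall c x, P x -> P (c *: x)) ->
  (forall i x, P x -> P (pres_gen R i * x)) -> forall x, P x.
Proof.
move=> P1 PD PZ PM x; rewrite -[x]pi_repr.
elim/free_ind: (repr x) => [|y z Py Pz|c y Py|i y Py].
- by rewrite pi_pres1.
- by rewrite pi_presD; exact: PD.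
- by rewrite pi_presZ; exact: PZ.
- by rewrite pi_presM -pres_genE; exact: PM.
Qed.

End PresentedTheory.

Section HeckeAlgebras.
Local Open Scope quotient_scope.
Variables (B : comUnitRingType) (u v : B).
Local Notation hecke := (hecke u v).

Lemma hecke_scalerAl n c (x y : hecke n) : c *: (x * y) = (c *: x) * y.
Proof. exact: pres_scalerAl. Qed.

Lemma hecke_scalerAr n c (x y : hecke n) : c *: (x * y) = x * (c *: y).
Proof. exact: pres_scalerAr. Qed.

Lemma hecke_ind n (P : hecke n -> Prop) :
  P 1 -> (forall x y, P x -> P y -> P (x + y)) -> (forall c x, P x -> P (c *: x)) ->
  (forall i x, P x -> P (heckeT u v i * x)) -> forall x, P x.
Proof. exact: pres_ind. Qed.

Lemma heckeT_comm n (i j : 'I_n.-1) : (i.+1 < j)%N || (j.+1 < i)%N ->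
  heckeT u v i * heckeT u v j = heckeT u v j * heckeT u v i.
Proof.
by move=> ij; rewrite /heckeT !pres_genE -!pi_presM; apply/pres_rel/hecke_rel_comm.
Qed.

Lemma heckeT_braid n (i j : 'I_n.-1) : i.+1 = j :> nat ->
  heckeT u v i * heckeT u v j * heckeT u v i =
  heckeT u v j * heckeT u v i * heckeT u v j.
Proof.
by move=> ij; rewrite /heckeT !pres_genE -!pi_presM; apply/pres_rel/hecke_rel_braid.
Qed.

Lemma heckeT_quad n (i : 'I_n.-1) :
  heckeT u v i * heckeT u v i = u ^+ 2 *: (1 : hecke n) + v *: heckeT u v i.
Proof.
rewrite /heckeT !pres_genE -!pi_presM -pi_pres1 -!pi_presZ -pi_presD.
exact/pres_rel/hecke_rel_quad.
Qed.

(** The scalars enter through [phi] because the targets include matrix rings over a smaller Hecke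
    algebra, whose own scaling is not by [B]. *)
Lemma hecke_lift_spec n (S : pzRingType) (phi : {rmorphism B -> S}) (f : 'I_n.-1 -> S) :
  (forall c s, phi c * s = s * phi c) ->
  (forall i j : 'I_n.-1, (i.+1 < j)%N || (j.+1 < i)%N -> f i * f j = f j * f i) ->
  (forall i j : 'I_n.-1, i.+1 = j :> nat -> f i * f j * f i = f j * f i * f j) ->
  (forall i, f i * f i = phi (u ^+ 2) + phi v * f i) ->
  let F := pres_lift (R := hecke_rel u v n) phi f in
  [/\ zmod_morphism F, monoid_morphism F,
      forall c x, F (c *: x) = phi c * F x & forall i, F (heckeT u v i) = f i].
Proof.
move=> phiC fcomm fbraid fquad.
have evM a b : free_eval phi f (a * b) = free_eval phi f a * free_eval phi f b.
  exact: free_evalM.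
have evM3 a b c : free_eval phi f (a * b * c) =
    free_eval phi f a * free_eval phi f b * free_eval phi f c.
  exact: free_evalM3.
apply: pres_lift_spec => // x y [i j ij|i j ij|i].
- apply: etrans (evM _ _) _; apply: etrans (esym (evM _ _)).
  by rewrite !free_eval_gen fcomm.
- apply: etrans (evM3 _ _ _) _; apply: etrans (esym (evM3 _ _ _)).
  by rewrite !free_eval_gen fbraid.
- apply: etrans (free_evalX f phiC _ _) _.
  rewrite free_eval_gen raddfD /= !free_evalZ free_eval1 mulr1.
  by rewrite free_eval_gen expr2 fquad.
Qed.

End HeckeAlgebras.

Section YokonumaHeckeAlgebras.
Local Open Scope quotient_scope.
Variables (B : comUnitRingType) (u v : B) (d : nat).
Local Notation yh := (yh u v d).

Lemma yh_scalerAl n c (x y : yh n) : c *: (x * y) = (c *: x) * y.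
Proof. exact: pres_scalerAl. Qed.

Lemma yh_scalerAr n c (x y : yh n) : c *: (x * y) = x * (c *: y).
Proof. exact: pres_scalerAr. Qed.

Lemma yh_ind n (P : yh n -> Prop) :
  P 1 -> (forall x y, P x -> P y -> P (x + y)) -> (forall c x, P x -> P (c *: x)) ->
  (forall i x, P x -> P (yh_g u v d i * x)) ->
  (forall i x, P x -> P (yh_t u v d i * x)) -> forall x, P x.
Proof. by move=> P1 PD PZ Pg Pt; apply: pres_ind => // -[]. Qed.

Definition yh_e n (i : 'I_n.-1) : yh n :=
  (d%:R)^-1 *: \sum_(s < d) yh_t u v d (ord_lo i) ^+ s * yh_t u v d (ord_hi i) ^+ (d - s).

Variable n : nat.
Local Notation g := (@yh_g B u v d n).
Local Notation t := (@yh_t B u v d n).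

Lemma yh_g_comm (i j : 'I_n.-1) : (i.+1 < j)%N || (j.+1 < i)%N -> g i * g j = g j * g i.
Proof.
by move=> ij; rewrite /g !pres_genE -!pi_presM; apply/pres_rel/yh_rel_comm.
Qed.

Lemma yh_g_braid (i j : 'I_n.-1) : i.+1 = j :> nat -> g i * g j * g i = g j * g i * g j.
Proof.
by move=> ij; rewrite /g !pres_genE -!pi_presM; apply/pres_rel/yh_rel_braid.
Qed.

Lemma yh_tt (i j : 'I_n) : t i * t j = t j * t i.
Proof. by rewrite /t !pres_genE -!pi_presM; apply/pres_rel/yh_rel_tt. Qed.

Lemma yh_gt (i : 'I_n.-1) (j : 'I_n) : g i * t j = t (simple_perm i j) * g i.
Proof. by rewrite /g /t !pres_genE -!pi_presM; apply/pres_rel/yh_rel_gt. Qed.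

Lemma pi_presX (J : choiceType) (R : {malg B[{fmonom J}]} -> {malg B[{fmonom J}]} -> Prop)
    (x : {malg B[{fmonom J}]}) k :
  \pi_(presented R) (x ^+ k) = (\pi_(presented R) x : presented R) ^+ k.
Proof. by elim: k => [|k IH]; rewrite ?expr0 ?pi_pres1 // !exprS pi_presM IH. Qed.

Lemma yh_tpow (j : 'I_n) : t j ^+ d = 1.
Proof. by rewrite /t !pres_genE -pi_presX -pi_pres1; apply/pres_rel/yh_rel_tpow. Qed.

Lemma pi_free_e (i : 'I_n.-1) : \pi_(presented (@yh_rel B u v d n)) (free_e B d i) = yh_e i.
Proof.
rewrite /free_e pi_presZ (big_morph _ (@pi_presD _ _ _) (@pi_pres0 _ _ _)); congr (_ *: _).
apply: eq_bigr => s _.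
by rewrite pi_presM !pi_presX -!pres_genE.
Qed.

Lemma yh_quad (i : 'I_n.-1) : g i * g i = u ^+ 2 *: (1 : yh n) + v *: (yh_e i * g i).
Proof.
rewrite -pi_free_e /g !pres_genE -!pi_presM -pi_pres1 -!pi_presZ -pi_presD.
exact/pres_rel/yh_rel_quad.
Qed.

Lemma yh_lift_spec (S : pzRingType) (phi : {rmorphism B -> S}) (f : ('I_n.-1 + 'I_n) -> S) :
  (forall c s, phi c * s = s * phi c) ->
  (forall i j : 'I_n.-1, (i.+1 < j)%N || (j.+1 < i)%N ->
     f (inl i) * f (inl j) = f (inl j) * f (inl i)) ->
  (forall i j : 'I_n.-1, i.+1 = j :> nat ->
     f (inl i) * f (inl j) * f (inl i) = f (inl j) * f (inl i) * f (inl j)) ->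
  (forall i j : 'I_n, f (inr i) * f (inr j) = f (inr j) * f (inr i)) ->
  (forall (i : 'I_n.-1) (j : 'I_n),
     f (inl i) * f (inr j) = f (inr (simple_perm i j)) * f (inl i)) ->
  (forall j, f (inr j) ^+ d = 1) ->
  (forall i, f (inl i) * f (inl i) = phi (u ^+ 2) +
     phi v * (phi (d%:R^-1) * (\sum_(s < d) f (inr (ord_lo i)) ^+ s *
                               f (inr (ord_hi i)) ^+ (d - s)) * f (inl i))) ->
  let F := pres_lift (R := @yh_rel B u v d n) phi f in
  [/\ zmod_morphism F, monoid_morphism F,
      forall c x, F (c *: x) = phi c * F x &
      (forall i, F (g i) = f (inl i)) /\ (forall j, F (t j) = f (inr j))].
Proof.
move=> phiC fcomm fbraid ftt fgt ftpow fquad F.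
have [] : [/\ zmod_morphism F, monoid_morphism F,
      forall c x, F (c *: x) = phi c * F x & forall i, F (pres_gen (@yh_rel B u v d n) i) = f i].
  have evM a b : free_eval phi f (a * b) = free_eval phi f a * free_eval phi f b.
    exact: free_evalM.
  have evM3 a b c : free_eval phi f (a * b * c) =
      free_eval phi f a * free_eval phi f b * free_eval phi f c.
    exact: free_evalM3.
  apply: pres_lift_spec => // x y [i j ij|i j ij|i j|i j|j|i].
  - apply: etrans (evM _ _) _; apply: etrans (esym (evM _ _)).
    by rewrite !free_eval_gen fcomm.
  - apply: etrans (evM3 _ _ _) _; apply: etrans (esym (evM3 _ _ _)).
    by rewrite !free_eval_gen fbraid.
  - apply: etrans (evM _ _) _; apply: etrans (esym (evM _ _)).
    by rewrite !free_eval_gen ftt.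
  - apply: etrans (evM _ _) _; apply: etrans (esym (evM _ _)).
    by rewrite !free_eval_gen fgt.
  - apply: etrans (free_evalX f phiC _ _) _.
    by rewrite free_eval_gen ftpow free_eval1.
  - apply: etrans (free_evalX f phiC _ _) _.
    rewrite free_eval_gen expr2 fquad raddfD /= !free_evalZ free_eval1 mulr1.
    congr (_ + _ * _); apply: esym; apply: etrans (evM _ _) _.
    rewrite free_eval_gen /free_e free_evalZ raddf_sum /=.
    congr (_ * _ * _); apply: eq_bigr => s _; apply: etrans (evM _ _) _.
    by congr (_ * _); apply: etrans (free_evalX f phiC _ _) _; rewrite free_eval_gen.
by move=> zF mF sF gF; split=> //; split=> i; exact: gF.
Qed.

End YokonumaHeckeAlgebras.

Section HeckeBasis.
Variables (B : comUnitRingType) (u v : B).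
Hypothesis u_unit : u \is a GRing.unit.
Variable n : nat.
Local Notation hecke := (hecke u v n).
Local Notation T := (@heckeT B u v n).
Local Notation Tw := (@heckeTw B u v n).
Local Notation s_ i := (simple_perm i).
Implicit Types (w : 'S_n) (i : 'I_n.-1).

Lemma heckeTwE w : Tw w = u^-1 ^+ inv_number w *: Tword T w.
Proof. by rewrite /heckeTw perm_lengthE. Qed.

Lemma heckeTw1 : Tw 1%g = 1.
Proof.
rewrite heckeTwE inv_number1 scale1r Tword1 //; [exact: heckeT_comm | exact: heckeT_braid].
Qed.

Lemma heckeTw_up i w : ~~ ldescent i w -> T i * Tw w = u *: Tw (w * s_ i)%g.
Proof.
move=> d; rewrite !heckeTwE inv_number_up // Tword_up //;
  [|exact: heckeT_comm|exact: heckeT_braid].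
by rewrite scalerA exprS mulrA divrr // mul1r hecke_scalerAr.
Qed.

Lemma heckeTw_rup i w : ~~ rdescent i w -> Tw w * T i = u *: Tw (s_ i * w)%g.
Proof.
move=> d; rewrite !heckeTwE inv_number_rup // Tword_rup //;
  [|exact: heckeT_comm|exact: heckeT_braid].
by rewrite scalerA exprS mulrA divrr // mul1r hecke_scalerAl.
Qed.

(** At a descent, [Tw w] is u^-1 T_i times a shorter element and the quadratic relation applies.
    Thanks to the normalization by powers of u, the first term has the same coefficient in both
    cases. *)
Lemma heckeT_Tw i w :
  T i * Tw w = u *: Tw (w * s_ i)%g + (v *+ ldescent i w) *: Tw w.
Proof.
case: (boolP (ldescent i w)) => d /=; last by rewrite mulr0n scale0r addr0 heckeTw_up.
have e : Tw w = u^-1 *: (T i * Tw (w * s_ i)%g).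
  rewrite heckeTw_up ?simple_permKg ?ldescentM ?d //.
  by rewrite scalerA mulVr // scale1r.
rewrite {1}e -hecke_scalerAr mulrA heckeT_quad mulrDl scalerDr.
rewrite -!hecke_scalerAl mul1r scalerA; congr (_ + _).
  by rewrite expr2 mulrA mulVr // mul1r.
by rewrite scalerA mulrC -scalerA -e.
Qed.

Lemma hecke_Tw_T i w :
  Tw w * T i = u *: Tw (s_ i * w)%g + (v *+ rdescent i w) *: Tw w.
Proof.
case: (boolP (rdescent i w)) => d /=; last by rewrite mulr0n scale0r addr0 heckeTw_rup.
have e : Tw w = u^-1 *: (Tw (s_ i * w)%g * T i).
  rewrite heckeTw_rup ?rdescentM ?d // mulgA simple_permK mul1g.
  by rewrite scalerA mulVr // scale1r.
rewrite {1}e -hecke_scalerAl -mulrA heckeT_quad mulrDr scalerDr.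
rewrite -!hecke_scalerAr mulr1 scalerA; congr (_ + _).
  by rewrite expr2 mulrA mulVr // mul1r.
by rewrite scalerA mulrC -scalerA -e.
Qed.

(** The induction on [x] generalizes [P]: for [T i * x] the hypothesis is used for the predicate
    sending [y] to [P (T i * y)], which inherits the closure properties and holds on the basis by
    [heckeT_Tw]. *)
Lemma hecke_basis_ind (P : hecke -> Prop) :
  (forall x y, P x -> P y -> P (x + y)) -> (forall c x, P x -> P (c *: x)) ->
  (forall w, P (Tw w)) -> forall x, P x.
Proof.
move=> PD PZ PT x; elim/hecke_ind: x P PD PZ PT =>
  [P _ _ PT|x y Hx Hy P PD PZ PT|c x Hx P PD PZ PT|i x Hx P PD PZ PT].
- by rewrite -heckeTw1.
- by apply: (PD); [apply: Hx | apply: Hy].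
- by apply: (PZ); apply: Hx.
- apply: (Hx (fun x => P (T i * x))) => [y z|c y|w].
  + by rewrite mulrDr; exact: PD.
  + by rewrite -hecke_scalerAr; exact: PZ.
  + by rewrite heckeT_Tw; apply: PD; apply: PZ.
Qed.

End HeckeBasis.

(** * Idempotents and a spanning set of the Yokonuma--Hecke algebra *)

Section RootsOfUnity.
Variables (B : comUnitRingType) (d : nat) (xi : 'I_d -> B).
Hypothesis d_unit : (d%:R : B) \is a GRing.unit.
Hypothesis xi_orth : forall a b,
  \sum_(s < d) xi a ^+ s * xi b ^+ (d - s) = d%:R * (a == b)%:R.

Hypothesis xi_pow : forall a, xi a ^+ d = 1.

(** The hypothesis says that the character table [X] has right inverse [Y]. For square matrices [Y]
    is also a left inverse, and the claim is row 0 of this second identity. *)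
Lemma xi_orth_dual (s : 'I_d) : \sum_(c < d) xi c ^+ s = d%:R * (s == 0 :> nat)%:R.
Proof.
pose X : 'M[B]_d := \matrix_(c, s) xi c ^+ s.
pose Y : 'M[B]_d := \matrix_(s, b) (d%:R^-1 * xi b ^+ (d - s)).
have XY : X *m Y = 1%:M.
  apply/matrixP => a b; rewrite !mxE.
  under eq_bigr do rewrite !mxE mulrCA.
  by rewrite -mulr_sumr xi_orth mulKr.
have d_gt0 : (0 < d)%N by exact: leq_ltn_trans (ltn_ord s).
have /matrixP/(_ (Ordinal d_gt0) s) := mulmx1C XY.
rewrite !mxE => e; rewrite eq_sym -[_ == _]/(Ordinal d_gt0 == s) -e mulr_sumr.
by apply: eq_bigr => c _; rewrite !mxE subn0 xi_pow mulr1 mulVKr.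
Qed.

End RootsOfUnity.

(** All that is used of u and of the roots of unity. It holds in the Laurent ring, and also for d =
    1 with the single root 1, where Y is the Hecke algebra. *)
Record root_system (B : comUnitRingType) (u : B) (d : nat) (xi : 'I_d -> B) : Prop := {
  rs_u_unit : u \is a GRing.unit;
  rs_d_gt0 : (0 < d)%N;
  rs_d_unit : (d%:R : B) \is a GRing.unit;
  rs_pow : forall a, xi a ^+ d = 1;
  rs_orth : forall a b, \sum_(s < d) xi a ^+ s * xi b ^+ (d - s) = d%:R * (a == b)%:R }.

Section YokonumaHeckeBasis.
Variables (B : comUnitRingType) (u v : B) (d : nat) (xi : 'I_d -> B).
Hypothesis H : root_system u xi.
Let u_unit := rs_u_unit H.
Let d_gt0 := rs_d_gt0 H.
Let d_unit := rs_d_unit H.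
Let xi_pow := rs_pow H.
Let xi_orth := rs_orth H.
Variable n : nat.
Local Notation yh := (yh u v d n).
Local Notation g := (@yh_g B u v d n).
Local Notation t := (@yh_t B u v d n).
Local Notation e := (@yh_e B u v d n).
Local Notation gw := (@yh_gw B u v d n).
Local Notation s_ i := (simple_perm i).
Local Notation E chi := (E_chi u v xi chi).
Implicit Types (w : 'S_n) (i : 'I_n.-1) (j : 'I_n) (chi psi : {ffun 'I_n -> 'I_d}).

Definition E_one (c : 'I_d) j : yh :=
  (d%:R)^-1 *: \sum_(s < d) xi c ^+ s *: t j ^+ (d - s).

Lemma E_chiE chi : E chi = \prod_j E_one (chi j) j.
Proof. by []. Qed.

Lemma tpow_comm j k a b : t j ^+ a * t k ^+ b = t k ^+ b * t j ^+ a.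
Proof. exact: (commrX _ (commr_sym (commrX _ (yh_tt _ _ _ _ _)))). Qed.

Lemma t_E_one_comm k c j : t k * E_one c j = E_one c j * t k.
Proof.
rewrite /E_one -yh_scalerAr -yh_scalerAl; congr (_ *: _).
rewrite mulr_sumr mulr_suml; apply: eq_bigr => s _.
by rewrite -yh_scalerAr -yh_scalerAl -[t k]expr1 tpow_comm.
Qed.

Lemma t_E_one c j : t j * E_one c j = xi c *: E_one c j.
Proof.
rewrite /E_one -yh_scalerAr scalerA mulrC -scalerA; congr (_ *: _).
rewrite mulr_sumr scaler_sumr.
(* The two sides are the sums of [h] over 0, ..., d-1 and over 1, ..., d; they agree because [h d]
   and [h 0] are both equal to [t j]. *)
pose h s := xi c ^+ s *: t j ^+ (d.+1 - s).
have hd : h d = h 0 by rewrite /h xi_pow subSnn subn0 !expr0 !scale1r [RHS]exprS yh_tpow mulr1.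
apply: (addIr (h d)); rewrite {2}hd.
transitivity (\sum_(s < d.+1) h s).
  rewrite big_ord_recr /=; congr (_ + _); apply: eq_bigr => s _.
  by rewrite -yh_scalerAr -exprS -subSn // ltnW.
rewrite big_ord_recl addrC; congr (_ + _); apply: eq_bigr => s _.
by rewrite scalerA -exprS /h subSS.
Qed.

Definition eigen chi (y : yh) := forall j, t j * y = xi (chi j) *: y.

Lemma t_eigen chi y j a : eigen chi y -> t j ^+ a * y = xi (chi j) ^+ a *: y.
Proof.
move=> ey; elim: a => [|a IH]; first by rewrite !expr0 mul1r scale1r.
by rewrite exprSr -mulrA ey -yh_scalerAr IH scalerA -exprS.
Qed.

Lemma E_one_eigen chi y b j : eigen chi y -> E_one b j * y = (b == chi j)%:R *: y.
Proof.
move=> ey; rewrite /E_one -yh_scalerAl mulr_suml.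
under eq_bigr do rewrite -yh_scalerAl (t_eigen _ _ ey) scalerA.
by rewrite -scaler_suml xi_orth scalerA mulKr.
Qed.

Lemma prod_delta chi psi : \prod_j (psi j == chi j)%:R = (psi == chi)%:R :> B.
Proof.
case: (eqVneq psi chi) => [->|ne]; first by rewrite big1 // => j _; rewrite eqxx.
have [j nj] : exists j, psi j != chi j.
  by apply/existsP; apply: contraR ne; rewrite negb_exists => /forallP h;
    apply/eqP/ffunP => j; apply/eqP/negPn/h.
by rewrite (bigD1 j) //= (negPf nj) mul0r.
Qed.

Lemma E_eigen chi psi y : eigen chi y -> E psi * y = (psi == chi)%:R *: y.
Proof.
move=> ey; rewrite E_chiE -prod_delta.
elim/big_rec2: _ => [|j b p _ IH]; first by rewrite mul1r scale1r.
by rewrite -mulrA IH -yh_scalerAr (E_one_eigen _ _ ey) scalerA mulrC.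
Qed.

Lemma t_E_comm chi j : t j * E chi = E chi * t j.
Proof.
rewrite E_chiE; elim/big_rec: _ => [|k x _ IH]; first by rewrite mul1r mulr1.
by rewrite mulrA t_E_one_comm -!mulrA IH.
Qed.

Lemma eigen_E chi : eigen chi (E chi).
Proof.
move=> j; rewrite E_chiE.
suff : forall r : seq 'I_n, j \in r ->
    t j * \prod_(k <- r) E_one (chi k) k = xi (chi j) *: \prod_(k <- r) E_one (chi k) k.
  by apply; rewrite mem_index_enum.
elim=> // k r IH; rewrite inE => /orP[/eqP <-|jr]; rewrite big_cons mulrA.
  by rewrite t_E_one yh_scalerAl.
by rewrite t_E_one_comm -mulrA IH // yh_scalerAr.
Qed.

Lemma E_orth chi psi : E psi * E chi = (psi == chi)%:R *: E chi.
Proof. exact/E_eigen/eigen_E. Qed.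

Lemma E_idem chi : E chi * E chi = E chi.
Proof. by rewrite E_orth eqxx scale1r. Qed.

Lemma sum_E_one j : \sum_c E_one c j = 1.
Proof.
rewrite -scaler_sumr exchange_big /=.
under eq_bigr do rewrite -scaler_suml (xi_orth_dual d_unit xi_orth xi_pow).
rewrite (bigD1 (Ordinal d_gt0)) //= big1 ?addr0 => [|s s0].
  by rewrite subn0 yh_tpow scalerA mulr1 mulVr // scale1r.
by rewrite (_ : (s == 0 :> nat) = false) ?mulr0 ?scale0r //; apply/negbTE.
Qed.

Lemma sum_E : \sum_chi E chi = (1 : yh).
Proof.
under eq_bigr do rewrite E_chiE.
by rewrite -(bigA_distr_bigA (fun j c => E_one c j)) big1 // => j _; exact: sum_E_one.
Qed.

Lemma eigen_fixed chi y : eigen chi y -> E chi * y = y.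
Proof. by move=> /E_eigen ->; rewrite eqxx scale1r. Qed.

Lemma E_t chi j : E chi * t j = xi (chi j) *: E chi.
Proof. by rewrite -t_E_comm eigen_E. Qed.

Lemma e_eigen chi y i : eigen chi y ->
  e i * y = (chi (ord_lo i) == chi (ord_hi i))%:R *: y.
Proof.
move=> ey; rewrite /yh_e -yh_scalerAl mulr_suml.
under eq_bigr do rewrite -mulrA (t_eigen _ _ ey) -yh_scalerAr (t_eigen _ _ ey) scalerA mulrC.
by rewrite -scaler_suml xi_orth scalerA mulKr.
Qed.

Lemma perm_charM w w' chi : perm_char (w' * w)%g chi = perm_char w (perm_char w' chi).
Proof. by apply/ffunP => j; rewrite !ffunE invMg permM. Qed.

Lemma perm_char1 chi : perm_char 1%g chi = chi.
Proof. by apply/ffunP => j; rewrite !ffunE invg1 perm1. Qed.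

Lemma perm_charK w : cancel (perm_char w) (perm_char (d := d) w^-1%g).
Proof. by move=> chi; rewrite -perm_charM mulgV perm_char1. Qed.

Lemma perm_charVK w : cancel (perm_char (d := d) w^-1%g) (perm_char w).
Proof. by move=> chi; rewrite -perm_charM mulVg perm_char1. Qed.

Lemma gwE w : gw w = u^-1 ^+ inv_number w *: Tword g w.
Proof. by rewrite /yh_gw perm_lengthE. Qed.

Lemma gw_t w j : gw w * t j = t (w j) * gw w.
Proof.
rewrite /yh_gw -yh_scalerAl -yh_scalerAr; congr (_ *: _).
have -> : t (w j) = t (word_perm (reduced_word w) j) by rewrite reduced_wordK.
elim: (reduced_word w) j => [|i r IH] j.
  by rewrite big_nil perm1 mul1r mulr1.
by rewrite big_cons word_perm_cons permM -mulrA IH !mulrA yh_gt.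
Qed.

(** [gw w * E psi] is an eigenvector for the character w(psi). So when [gw w] is expanded along the
    idempotents on its right, the projection by E_(w(chi)) on its left keeps only the term of
    [chi]. *)
Lemma E_gw w chi : E (perm_char w chi) * gw w = gw w * E chi.
Proof.
have h1 : E (perm_char w chi) * (gw w * E chi) = gw w * E chi.
  apply: eigen_fixed => j; rewrite mulrA -{1}(permKV w j) -gw_t -mulrA eigen_E.
  by rewrite -yh_scalerAr ffunE.
rewrite -{1}h1 -[in LHS](mulr1 (gw w)) -sum_E !mulr_sumr (bigD1 chi) //= big1 ?addr0 // => psi ne.
have : eigen (perm_char w psi) (gw w * E psi).
  by move=> j; rewrite mulrA -{1}(permKV w j) -gw_t -mulrA eigen_E -yh_scalerAr ffunE.
move=> /E_eigen ->; rewrite (inj_eq (can_inj (perm_charK w))).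
by rewrite eq_sym (negPf ne) scale0r.
Qed.

Lemma gw1 : gw 1%g = 1.
Proof.
by rewrite gwE inv_number1 scale1r Tword1 //; [exact: yh_g_comm | exact: yh_g_braid].
Qed.

Lemma gw_up i w : ~~ ldescent i w -> g i * gw w = u *: gw (w * s_ i)%g.
Proof.
move=> dw; rewrite !gwE inv_number_up // Tword_up //;
  [|exact: yh_g_comm|exact: yh_g_braid].
by rewrite scalerA exprS mulrA divrr // mul1r yh_scalerAr.
Qed.

Lemma gw_rup i w : ~~ rdescent i w -> gw w * g i = u *: gw (s_ i * w)%g.
Proof.
move=> dw; rewrite !gwE inv_number_rup // Tword_rup //;
  [|exact: yh_g_comm|exact: yh_g_braid].
by rewrite scalerA exprS mulrA divrr // mul1r yh_scalerAl.
Qed.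

Lemma gw_simple i : gw (s_ i) = u^-1 *: g i.
Proof.
rewrite -[s_ i]mul1g -[u^-1 *: g i]mulr1 -gw1 -yh_scalerAl.
have : ~~ ldescent i (1%g : 'S_n) by rewrite /ldescent invg1 !perm1 /=; lia.
by move=> /gw_up ->; rewrite scalerA mulVr // scale1r.
Qed.

Lemma g_E i chi : g i * E chi = E (perm_char (s_ i) chi) * g i.
Proof.
have -> : g i = u *: gw (s_ i) by rewrite gw_simple scalerA divrr // scale1r.
by rewrite -yh_scalerAl -E_gw yh_scalerAr.
Qed.

Lemma E_e chi i : E chi * e i = (chi (ord_lo i) == chi (ord_hi i))%:R *: E chi.
Proof.
rewrite -(e_eigen i (@eigen_E chi)) /yh_e -yh_scalerAl -yh_scalerAr; congr (_ *: _).
rewrite mulr_sumr mulr_suml; apply: eq_bigr => s _.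
have cX j a : E chi * t j ^+ a = t j ^+ a * E chi.
  by apply: commrX; rewrite /GRing.comm t_E_comm.
by rewrite mulrA cX -!mulrA cX.
Qed.

(** On every [E chi] the element [e i] is the indicator of the equality of two colours, and [g i]
    only exchanges these two. *)
Lemma e_g_comm i : e i * g i = g i * e i.
Proof.
rewrite -[LHS]mulr1 -[RHS]mulr1 -sum_E !mulr_sumr; apply: eq_bigr => chi _.
rewrite -!mulrA g_E (e_eigen _ (@eigen_E chi)) -yh_scalerAr g_E mulrA.
rewrite (e_eigen _ (@eigen_E _)) -yh_scalerAl !ffunE simple_permV.
by rewrite simple_perm_lo simple_perm_hi eq_sym.
Qed.

Lemma g_gw i w : g i * gw w = u *: gw (w * s_ i)%g + (v *+ ldescent i w) *: (e i * gw w).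
Proof.
case: (boolP (ldescent i w)) => dw /=; last by rewrite mulr0n scale0r addr0 gw_up.
have eq : gw w = u^-1 *: (g i * gw (w * s_ i)%g).
  rewrite gw_up ?simple_permKg ?ldescentM ?dw //.
  by rewrite scalerA mulVr // scale1r.
rewrite {1}eq -(yh_scalerAr u^-1) mulrA yh_quad mulrDl scalerDr.
rewrite -(yh_scalerAl (u ^+ 2)) -(yh_scalerAl v) mul1r scalerA; congr (_ + _).
  by rewrite expr2 mulrA mulVr // mul1r.
by rewrite scalerA mulrC -scalerA eq -(yh_scalerAr u^-1) mulrA.
Qed.

Lemma gw_g i w : gw w * g i = u *: gw (s_ i * w)%g + (v *+ rdescent i w) *: (gw w * e i).
Proof.
case: (boolP (rdescent i w)) => dw /=; last by rewrite mulr0n scale0r addr0 gw_rup.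
have eq : gw w = u^-1 *: (gw (s_ i * w)%g * g i).
  rewrite gw_rup ?rdescentM ?dw // mulgA simple_permK mul1g.
  by rewrite scalerA mulVr // scale1r.
rewrite {1}eq -(yh_scalerAl u^-1) -mulrA yh_quad mulrDr scalerDr.
rewrite -(yh_scalerAr (u ^+ 2)) -(yh_scalerAr v) mulr1 scalerA; congr (_ + _).
  by rewrite expr2 mulrA mulVr // mul1r.
by rewrite scalerA mulrC -scalerA eq -(yh_scalerAl u^-1) e_g_comm mulrA.
Qed.

Lemma yh_basis_ind (P : yh -> Prop) :
  (forall x y, P x -> P y -> P (x + y)) -> (forall c x, P x -> P (c *: x)) ->
  (forall chi w, P (E chi * gw w)) -> forall x, P x.
Proof.
move=> PD PZ PT x.
elim/yh_ind: x P PD PZ PT =>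
  [P PD PZ PT|x y Hx Hy P PD PZ PT|c x Hx P PD PZ PT|i x Hx P PD PZ PT|j x Hx P PD PZ PT].
- rewrite -sum_E; apply: (big_ind P) => //.
    by rewrite -(scale0r (E [ffun=> Ordinal d_gt0] * gw 1%g)); exact: PZ.
  by move=> chi _; rewrite -[E chi]mulr1 -gw1.
- by apply: (PD); [apply: Hx | apply: Hy].
- by apply: (PZ); apply: Hx.
- apply: (Hx (fun x => P (g i * x))) => [y z|c y|chi w].
  + by rewrite mulrDr; exact: PD.
  + by rewrite -yh_scalerAr; exact: PZ.
  + rewrite mulrA g_E -mulrA g_gw mulrDr -(yh_scalerAr u) -(yh_scalerAr (v *+ _)).
    apply: (PD); first by apply: (PZ).
    by rewrite mulrA E_e -yh_scalerAl; do 2!apply: (PZ).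
- apply: (Hx (fun x => P (t j * x))) => [y z|c y|chi w].
  + by rewrite mulrDr; exact: PD.
  + by rewrite -yh_scalerAr; exact: PZ.
  + by rewrite mulrA eigen_E -yh_scalerAl; apply: (PZ).
Qed.

End YokonumaHeckeBasis.

(** The six rows are those of the orbit of a permutation under [s_i] and [s_j]; the booleans tell
    which pairs among three points produce a [v] term. Apart from the two hypotheses, the identity
    only uses the idempotence of booleans, in [id3]. *)
Lemma braid_comb (B : comNzRingType) (m : nat) (u v : B) (b1 b2 b3 b4 b5 : bool)
    (e1 ei ej e4 e5 e6 : 'rV[B]_m) :
  (b3 * b5 + b1 * b4)%N = (b1 * b3)%N -> (b3 * b2 + b1 * b4)%N = (b3 * b4)%N ->
  u *: (u *: (u *: e4 + (v *+ b4) *: e6) +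
        (v *+ b3) *: (u *: e1 + (v *+ b2) *: ei)) +
  (v *+ b1) *: (u *: (u *: e5 + (v *+ b3) *: ej) +
                (v *+ b4) *: (u *: ei + (v *+ b1) *: e1)) =
  u *: (u *: (u *: e4 + (v *+ b1) *: e5) +
        (v *+ b3) *: (u *: e1 + (v *+ b5) *: ej)) +
  (v *+ b4) *: (u *: (u *: e6 + (v *+ b3) *: ei) +
                (v *+ b1) *: (u *: ej + (v *+ b4) *: e1)).
Proof.
move=> id1 id2; apply/rowP => l.
have {}id1 : b3%:R * b5%:R + b1%:R * b4%:R - b1%:R * b3%:R = 0 :> B.
  by rewrite -!natrM -natrD id1 subrr.
have {}id2 : b3%:R * b2%:R + b1%:R * b4%:R - b3%:R * b4%:R = 0 :> B.
  by rewrite -!natrM -natrD id2 subrr.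
have id3 : b1%:R * b4%:R * b1%:R - b4%:R * b1%:R * b4%:R = 0 :> B.
  by case: b1 {id1 id2}; case: b4; rewrite ?(mulr0, mul0r, subrr).
rewrite !mxE -!(mulr_natr v).
move: (b1%:R : B) (b2%:R : B) (b3%:R : B) (b4%:R : B) (b5%:R : B) id1 id2 id3.
move: (e1 0 l) (ei 0 l) (ej 0 l) (e4 0 l) (e5 0 l) (e6 0 l) => {e1 ei ej e4 e5 e6}.
move=> e1 ei ej e4 e5 e6 {b1 b2 b3 b4 b5} b1 b2 b3 b4 b5 id1 id2 id3.
apply/eqP; rewrite -subr_eq0; apply/eqP.
transitivity (u * v ^+ 2 * ei * (b3 * b2 + b1 * b4 - b3 * b4)
  - u * v ^+ 2 * ej * (b3 * b5 + b1 * b4 - b1 * b3)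
  + v ^+ 3 * e1 * (b1 * b4 * b1 - b4 * b1 * b4)); first by ring.
by rewrite id1 id2 id3 !mulr0 subr0 addr0.
Qed.

(** * Linear independence of the standard basis *)

Section WordModel.
Variables (B : comUnitRingType) (u v : B) (d : nat) (xi : 'I_d -> B).
Hypothesis H : root_system u xi.
Let u_unit := rs_u_unit H.
Let d_unit := rs_d_unit H.
Let xi_pow := rs_pow H.
Let xi_orth := rs_orth H.
Variables (n : nat) (chi : 'I_n -> 'I_d).
Local Notation s_ i := (simple_perm i).
Local Notation N := #|{perm 'I_n}|.
Local Notation mat := 'M[B]_N.
Implicit Types (w : 'S_n) (i j : 'I_n.-1) (x y z k : 'I_n).

Definition erow w : 'rV[B]_N := delta_mx 0 (enum_rank w).
Definition matrix_of (r : 'S_n -> 'rV[B]_N) : mat := \matrix_i r (enum_val i).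

Lemma erow_matrix_of r w : erow w *m matrix_of r = r w.
Proof. by rewrite -rowE rowK enum_rankK. Qed.

Lemma eq_erow (X Y : mat) : (forall w, erow w *m X = erow w *m Y) -> X = Y.
Proof.
move=> XY; apply/row_matrixP => i; rewrite !rowE.
by have := XY (enum_val i); rewrite /erow enum_valK.
Qed.

(** For the values of [w] at i and i+1, it says that i is a right descent of [w] and that [e_i] acts
    as 1 on [E_chi gw_w]. These are the rows on which [g_i] has a [v] term. *)
Definition bl x y := (y < x)%N && (chi x == chi y).

(* Right multiplication by [g_i] and [t_k] on the basis [E_chi gw_w] of the right ideal
   [E_chi Y]; row [w] is [E_chi gw_w]. *)
Definition Mg i := matrix_of (fun w =>
  u *: erow (s_ i * w)%g + (v *+ bl (w (ord_lo i)) (w (ord_hi i))) *: erow w).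
Definition Mt k := matrix_of (fun w => xi (chi (w k)) *: erow w).

Lemma erow_Mg i w : erow w *m Mg i =
  u *: erow (s_ i * w)%g + (v *+ bl (w (ord_lo i)) (w (ord_hi i))) *: erow w.
Proof. exact: erow_matrix_of. Qed.

Lemma erow_Mt k w : erow w *m Mt k = xi (chi (w k)) *: erow w.
Proof. exact: erow_matrix_of. Qed.

Lemma erow_MtX k a w : erow w *m Mt k ^+ a = xi (chi (w k)) ^+ a *: erow w.
Proof.
elim: a => [|a IH]; first by rewrite !expr0 mulmx1 scale1r.
by rewrite exprS mulmxA erow_Mt -scalemxAl IH scalerA -exprS.
Qed.

(** Provides the hypotheses of [braid_comb]. Both identities come from the transitivity of the order
    and of the equality of colours on three distinct points. *)
Lemma bl_cocycle x y z : x != y -> y != z -> x != z ->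
  (bl x z * bl z y + bl x y * bl y z = bl x y * bl x z)%N /\
  (bl x z * bl y x + bl x y * bl y z = bl x z * bl y z)%N.
Proof.
rewrite -!(inj_eq val_inj) /= /bl => xy yz xz.
rewrite (eq_sym (chi y) (chi x)) (eq_sym (chi z) (chi y)).
have t1 : chi x == chi y -> chi y == chi z -> chi x == chi z by move=> /eqP->.
have t2 : chi x == chi y -> chi x == chi z -> chi y == chi z by move=> /eqP->.
have t3 : chi y == chi z -> chi x == chi z -> chi x == chi y by move=> /eqP->.
move: t1 t2 t3; case: (chi x == chi y); case: (chi y == chi z); case: (chi x == chi z) => t1 t2 t3;
  rewrite ?andbT ?andbF; lia.
Qed.

Lemma Mg_braid i j : i.+1 = j :> nat -> Mg i * Mg j * Mg i = Mg j * Mg i * Mg j.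
Proof.
move=> ij; apply: eq_erow => w; rewrite !mulmxA.
have hl : ord_lo j = ord_hi i by apply: val_inj; rewrite /= ij.
have il : s_ i (ord_hi j) = ord_hi j.
  by apply: val_inj; rewrite /= simple_permE /=; split_nat_ifs; lia.
have jl : s_ j (ord_lo i) = ord_lo i.
  by apply: val_inj; rewrite /= simple_permE /=; split_nat_ifs; lia.
have jh : s_ j (ord_hi i) = ord_hi j by rewrite -hl simple_perm_lo.
have jh' : s_ j (ord_hi j) = ord_hi i by rewrite -hl simple_perm_hi.
do 3!rewrite !erow_Mg ?mulmxDl -?scalemxAl.
rewrite !(hl, permM, simple_perm_lo, simple_perm_hi, il, jl, jh, jh').
have xy : w (ord_lo i) != w (ord_hi i) by rewrite (inj_eq perm_inj) ord_lo_neq_hi.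
have yz : w (ord_hi i) != w (ord_hi j).
  by rewrite (inj_eq perm_inj) -hl ord_lo_neq_hi.
have xz : w (ord_lo i) != w (ord_hi j).
  by rewrite (inj_eq perm_inj) -(inj_eq val_inj) /=; lia.
have [id1 id2] := bl_cocycle xy yz xz.
have si w' : (s_ i * (s_ i * w') = w')%g by rewrite mulgA simple_permK mul1g.
have sj w' : (s_ j * (s_ j * w') = w')%g by rewrite mulgA simple_permK mul1g.
rewrite !(si, sj) !mulgA (simple_perm_braid ij) -!mulgA.
move: id1 id2; set x := w (ord_lo i); set y := w (ord_hi i); set z := w (ord_hi j).
move: (bl x y) (bl y x) (bl x z) (bl y z) (bl z y) => b1 b2 b3 b4 b5.
move: (erow w) (erow (s_ i * w)%g) (erow (s_ j * w)%g) => e1 ei ej.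
move: (erow (s_ i * (s_ j * w))%g) (erow (s_ j * (s_ i * w))%g).
move: (erow (s_ j * (s_ i * (s_ j * w)))%g) => e4 e5 e6 id1 id2.
exact: braid_comb.
Qed.

Lemma Mg_comm i j : (i.+1 < j)%N || (j.+1 < i)%N -> Mg i * Mg j = Mg j * Mg i.
Proof.
move=> ij; apply: eq_erow => w; rewrite !mulmxA !erow_Mg !mulmxDl -!scalemxAl !erow_Mg.
have jl : s_ j (ord_lo i) = ord_lo i.
  by apply: val_inj; rewrite /= simple_permE /=; split_nat_ifs; lia.
have jh : s_ j (ord_hi i) = ord_hi i.
  by apply: val_inj; rewrite /= simple_permE /=; split_nat_ifs; lia.
have il : s_ i (ord_lo j) = ord_lo j.
  by apply: val_inj; rewrite /= simple_permE /=; split_nat_ifs; lia.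
have ih : s_ i (ord_hi j) = ord_hi j.
  by apply: val_inj; rewrite /= simple_permE /=; split_nat_ifs; lia.
rewrite !permM jl jh il ih !mulgA (simple_perm_comm ij).
move: (erow (s_ j * s_ i * w)%g) (erow (s_ i * w)%g) (erow (s_ j * w)%g) (erow w).
move: (v *+ bl (w (ord_lo i)) (w (ord_hi i))) (v *+ bl (w (ord_lo j)) (w (ord_hi j))).
by move=> bi bj e1 e2 e3 e4; apply/rowP => l; rewrite !mxE; ring.
Qed.

Lemma Mt_comm k l : Mt k * Mt l = Mt l * Mt k.
Proof.
apply: eq_erow => w; rewrite !mulmxA !erow_Mt -!scalemxAl !erow_Mt.
by rewrite !scalerA mulrC.
Qed.

Lemma Mt_pow k : Mt k ^+ d = 1.
Proof. by apply: eq_erow => w; rewrite erow_MtX xi_pow mulmx1 scale1r. Qed.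

Lemma Mg_Mt i k : Mg i * Mt k = Mt (s_ i k) * Mg i.
Proof.
apply: eq_erow => w; rewrite !mulmxA erow_Mg erow_Mt mulmxDl -!scalemxAl erow_Mg !erow_Mt.
rewrite permM scalerDr !scalerA [_ * u]mulrC; congr (_ + _).
have [/andP[_ /eqP b]|] := boolP (bl _ _); last by rewrite mulr0n mulr0 mul0r.
rewrite mulrC; congr (xi _ * _ *: _); rewrite /simple_perm.
by case: tpermP => // ->.
Qed.

Lemma erow_e i w : erow w *m ((d%:R^-1)%:M *m
    \sum_(s < d) Mt (ord_lo i) ^+ s * Mt (ord_hi i) ^+ (d - s)) =
  (chi (w (ord_lo i)) == chi (w (ord_hi i)))%:R *: erow w.
Proof.
rewrite mulmxA mul_mx_scalar -scalemxAl mulmx_sumr.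
under eq_bigr do rewrite mulmxA erow_MtX -scalemxAl erow_MtX scalerA.
by rewrite -scaler_suml xi_orth scalerA mulKr.
Qed.

Lemma Mg_quad i : Mg i * Mg i = (u ^+ 2)%:M + v%:M * ((d%:R^-1)%:M *
   (\sum_(s < d) Mt (ord_lo i) ^+ s * Mt (ord_hi i) ^+ (d - s)) * Mg i).
Proof.
apply: eq_erow => w; rewrite mulmxDr mul_mx_scalar.
rewrite [erow w *m (v%:M * _)]mulmxA mul_mx_scalar -scalemxAl [in RHS]mulmxA erow_e.
rewrite [erow w *m (_ * _)]mulmxA.
do 2!rewrite -?scalemxAl !erow_Mg ?mulmxDl.
rewrite !permM simple_perm_lo simple_perm_hi.
rewrite mulgA simple_permK mul1g.
have : w (ord_lo i) != w (ord_hi i) by rewrite (inj_eq perm_inj) ord_lo_neq_hi.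
move: (w (ord_lo i)) (w (ord_hi i)) => x y xy.
move: (erow (s_ i * w)%g) (erow w) => e1 e2.
have [b1 b2] : (bl y x + bl x y = (chi x == chi y) /\ bl x y * (chi x == chi y) = bl x y)%N.
  move: xy; rewrite -(inj_eq val_inj) /= /bl (eq_sym (chi y)).
  by case: (chi x == chi y); rewrite ?andbT ?andbF; lia.
have {}b1 : v *+ bl y x = v *+ (chi x == chi y) - v *+ bl x y by rewrite -b1 mulrnDr addrK.
have {b2} : v *+ bl x y = (chi x == chi y)%:R * (v *+ bl x y) by rewrite mulr_natl -mulrnA b2.
have : (v *+ bl x y) * (v *+ bl x y) = v * (v *+ bl x y).
  by case: bl; rewrite ?mulr0n ?mulr0.
rewrite b1 -[v *+ (_ == _)]mulr_natr.
move: (v *+ bl x y) ((chi x == chi y)%:R : B) => c1 c2 b3 b2.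
apply/rowP => l; rewrite !mxE; move: (e1 0 l) (e2 0 l) => {}e1 {}e2.
apply/eqP; rewrite -subr_eq0; apply/eqP.
transitivity (e2 * (c1 * c1 - v * (c2 * c1))); first by ring.
by rewrite -b2 b3 subrr mulr0.
Qed.

Definition word_rep : yh u v d n -> mat :=
  pres_lift scalar_mx (fun x : 'I_n.-1 + 'I_n => match x with inl i => Mg i | inr k => Mt k end).

Lemma word_rep_spec :
  [/\ zmod_morphism word_rep, monoid_morphism word_rep,
      forall c (y : yh u v d n), word_rep (c *: y) = c%:M * word_rep y &
      (forall i, word_rep (yh_g u v d i) = Mg i) /\
      (forall k, word_rep (yh_t u v d k) = Mt k)].
Proof.
apply: yh_lift_spec => /=.
- by move=> c s; exact/esym/scalar_mxC.
- exact: Mg_comm.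
- exact: Mg_braid.
- exact: Mt_comm.
- exact: Mg_Mt.
- exact: Mt_pow.
- exact: Mg_quad.
Qed.

HB.instance Definition _ := GRing.isZmodMorphism.Build _ _ word_rep
  (let: And4 h _ _ _ := word_rep_spec in h).
HB.instance Definition _ := GRing.isMonoidMorphism.Build _ _ word_rep
  (let: And4 _ h _ _ := word_rep_spec in h).

Lemma word_repZ c (y : yh u v d n) : word_rep (c *: y) = c *: word_rep y.
Proof. by have [_ _ -> _] := word_rep_spec; exact: mul_scalar_mx. Qed.

Lemma word_rep_g i : word_rep (yh_g u v d i) = Mg i.
Proof. by have [_ _ _ [-> _]] := word_rep_spec. Qed.

Lemma word_rep_t k : word_rep (yh_t u v d k) = Mt k.
Proof. by have [_ _ _ [_ ->]] := word_rep_spec. Qed.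

(** [w] is reached from 1 by right ascents, at which no [v] term occurs, so the row of 1 travels to
    the row of [w]. *)
Lemma erow_gw w : erow 1%g *m word_rep (yh_gw u v d w) = erow w.
Proof.
move eqm : (inv_number w) => m; elim: m w eqm => [|m IH] w wm.
  by rewrite (inv_number_eq0 wm) gw1 rmorph1 mulmx1.
have [|i] := @exists_ldescent _ w^-1%g.
  by apply: contra_eq_neq wm => e; rewrite -inv_numberV e inv_number1.
rewrite ldescentV => di.
have nd : ~~ rdescent i (s_ i * w)%g by rewrite rdescentM di.
have := gw_rup v H nd.
have := inv_number_rdown di => e.
rewrite mulgA simple_permK mul1g => h.
have : word_rep (yh_gw u v d (s_ i * w) * yh_g u v d i) = u *: word_rep (yh_gw u v d w).
  by rewrite h word_repZ.
rewrite rmorphM /= word_rep_g => {h} h.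
rewrite -[LHS]scale1r -(mulVr u_unit) -scalerA scalemxAr -h mulmxA IH; last by lia.
rewrite erow_Mg mulgA simple_permK mul1g.
move: nd; rewrite /bl /rdescent => /negPf ->.
by rewrite mulr0n scale0r addr0 scalerA mulVr // scale1r.
Qed.

Lemma erow_E (psi : {ffun 'I_n -> 'I_d}) :
  erow 1%g *m word_rep (E_chi u v xi psi) = (psi == finfun chi)%:R *: erow 1%g.
Proof.
rewrite -prod_delta E_chiE.
elim/big_rec2: _ => [|k b p _ IH]; first by rewrite rmorph1 mulmx1 scale1r.
rewrite rmorphM /= mulmxA /E_one word_repZ raddf_sum /= -scalemxAr mulmx_sumr.
under eq_bigr do rewrite word_repZ rmorphXn /= word_rep_t -scalemxAr erow_MtX scalerA perm1.
rewrite -scaler_suml xi_orth scalerA mulKr // -scalemxAl IH scalerA ffunE.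
by [].
Qed.

(** The coordinate of [x] on [E_chi * gw w]: the row of the identity stands for [E_chi]. *)
Definition word_coef w (x : yh u v d n) : B :=
  (erow 1%g *m word_rep x) 0 (enum_rank w).

Lemma word_coef_scalar w : scalar (word_coef w).
Proof.
by move=> c x y; rewrite /word_coef raddfD /= word_repZ mulmxDr -scalemxAr !mxE.
Qed.

Lemma word_coef_basis w psi w' :
  word_coef w (E_chi u v xi psi * yh_gw u v d w') =
  ((psi == finfun chi) && (w == w'))%:R.
Proof.
rewrite /word_coef rmorphM /= mulmxA erow_E -scalemxAl erow_gw !mxE eqxx /=.
by rewrite (inj_eq enum_rank_inj) -natrM mulnb.
Qed.

End WordModel.

(** * Coordinates on the Hecke algebra *)

Section HeckeCoef.
Variables (B : comUnitRingType) (u v : B).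
Hypothesis u_unit : u \is a GRing.unit.
Variable n : nat.
Local Notation hecke := (hecke u v n).
Local Notation Tw := (@heckeTw B u v n).

Let xi1 : 'I_1 -> B := fun=> 1.

Lemma root_system1 : root_system u xi1.
Proof.
split=> //; first exact: unitr1.
by move=> a b; rewrite /xi1 big_ord1 !expr1n mulr1 (ord1 a) (ord1 b) eqxx mulr1.
Qed.
Let H := root_system1.

Lemma yh_e1 (i : 'I_n.-1) : yh_e u v 1 i = 1.
Proof.
by rewrite /yh_e big_ord1 expr0 mul1r subn0 (yh_tpow u v) invr1 scale1r.
Qed.

(** For d = 1 the elements t_j and e_i are all 1, so the g_i satisfy the Hecke relations and the
    coordinates on Y can be pulled back. *)
Definition hecke_to_yh : hecke -> yh u v 1 n :=
  pres_lift (pres_cst (@yh_rel B u v 1 n)) (@yh_g B u v 1 n).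

Lemma hecke_to_yh_spec :
  [/\ zmod_morphism hecke_to_yh, monoid_morphism hecke_to_yh,
      forall c (x : hecke), hecke_to_yh (c *: x) = pres_cst (@yh_rel B u v 1 n) c * hecke_to_yh x &
      forall i, hecke_to_yh (heckeT u v i) = yh_g u v 1 i].
Proof.
apply: hecke_lift_spec => [c s|||i].
- exact: pres_cstC.
- exact: yh_g_comm.
- exact: yh_g_braid.
- rewrite yh_quad yh_e1 mul1r; congr (_ + _).
  by rewrite /pres_cst -[RHS]yh_scalerAl mul1r.
Qed.

HB.instance Definition _ := GRing.isZmodMorphism.Build _ _ hecke_to_yh
  (let: And4 h _ _ _ := hecke_to_yh_spec in h).
HB.instance Definition _ := GRing.isMonoidMorphism.Build _ _ hecke_to_yh
  (let: And4 _ h _ _ := hecke_to_yh_spec in h).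

Lemma hecke_to_yhZ c (x : hecke) : hecke_to_yh (c *: x) = c *: hecke_to_yh x.
Proof.
by have [_ _ -> _] := hecke_to_yh_spec; rewrite /pres_cst -[LHS]yh_scalerAl mul1r.
Qed.

Lemma hecke_to_yh_T i : hecke_to_yh (heckeT u v i) = yh_g u v 1 i.
Proof. by have [_ _ _ ->] := hecke_to_yh_spec. Qed.

Lemma hecke_to_yh_Tw w : hecke_to_yh (Tw w) = yh_gw u v 1 w.
Proof.
rewrite /heckeTw /yh_gw hecke_to_yhZ rmorph_prod; congr (_ *: _).
by apply: eq_bigr => i _; exact: hecke_to_yh_T.
Qed.

Definition hecke_coef (w : 'S_n) (x : hecke) : B :=
  word_coef xi1 (fun=> ord0) w (hecke_to_yh x).

Lemma hecke_coef_scalar w : scalar (hecke_coef w).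
Proof.
by move=> c x y; rewrite /hecke_coef raddfD /= hecke_to_yhZ (word_coef_scalar H).
Qed.

Lemma hecke_coef_basis w w' : hecke_coef w (Tw w') = (w == w')%:R.
Proof.
rewrite /hecke_coef hecke_to_yh_Tw -[yh_gw _ _ _ _]mul1r -(sum_E v H) mulr_suml.
rewrite (bigD1 [ffun=> ord0]) //= big_pred0 ?addr0 => [|psi]; last first.
  by apply/negbTE; rewrite negbK; apply/eqP/ffunP => j; rewrite ord1 [RHS]ord1.
by rewrite (word_coef_basis v H) eqxx.
Qed.

End HeckeCoef.

(** * The Markov trace of the Hecke algebras *)

Section HeckeMorphisms.
Variables (B : comUnitRingType) (u v : B).
Local Notation hecke := (hecke u v).
Local Notation T := (@heckeT B u v _).

Section Shift.
Variables (m n : nat) (f : 'I_m.-1 -> 'I_n.-1) (k : nat).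
Hypothesis fE : forall i, f i = (k + i)%N :> nat.

(** Covers both kinds of embeddings: from size n to n + 1, with shift 0, and of a block of a
    composition, with shift its starting point. *)
Lemma hecke_shift_spec :
  let F := pres_lift (R := hecke_rel u v m) (pres_cst (hecke_rel u v n)) (fun i => T (f i)) in
  [/\ zmod_morphism F, monoid_morphism F,
      forall c (x : hecke m), F (c *: x) = c *: F x & forall i, F (T i) = T (f i)].
Proof.
have [|i j ij|i j ij|i|a b c' e] := @hecke_lift_spec B u v m (hecke n)
    (pres_cst (hecke_rel u v n)) (fun i => T (f i)).
- exact: pres_cstC.
- by apply: heckeT_comm; rewrite !fE; lia.
- by apply: heckeT_braid; rewrite !fE; lia.
- by rewrite heckeT_quad; congr (_ + _); rewrite /pres_cst -[RHS]hecke_scalerAl mul1r.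
- by split=> // c x; rewrite c' /pres_cst -[LHS]hecke_scalerAl mul1r.
Qed.

End Shift.

Lemma hecke_emb_spec n :
  [/\ zmod_morphism (@hecke_emb B u v n), monoid_morphism (@hecke_emb B u v n),
      forall c (x : hecke n), hecke_emb (c *: x) = c *: hecke_emb x &
      forall i : 'I_n.-1, hecke_emb (T i) = T (widen_ord (leq_pred n) i : 'I_n.+1.-1)].
Proof. by apply: (@hecke_shift_spec n n.+1 (fun i => widen_ord (leq_pred n) i) 0). Qed.

HB.instance Definition _ n := GRing.isZmodMorphism.Build _ _ (@hecke_emb B u v n)
  (let: And4 h _ _ _ := hecke_emb_spec n in h).
HB.instance Definition _ n := GRing.isMonoidMorphism.Build _ _ (@hecke_emb B u v n)
  (let: And4 _ h _ _ := hecke_emb_spec n in h).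

Lemma hecke_embZ n c (x : hecke n) : hecke_emb (c *: x) = c *: hecke_emb x.
Proof. by have [_ _ -> _] := hecke_emb_spec n. Qed.

Lemma hecke_embT n (i : 'I_n.-1) :
  hecke_emb (T i) = T (widen_ord (leq_pred n) i : 'I_n.+1.-1).
Proof. by have [_ _ _ ->] := hecke_emb_spec n. Qed.

Local Notation last n := (@heckeT B u v n.+2 ord_max).

Lemma hecke_emb_last_comm n (x : hecke n.+1) :
  hecke_emb (hecke_emb x) * last n.+1 = last n.+1 * hecke_emb (hecke_emb x).
Proof.
elim/hecke_ind: x => [|x y ex ey|c x ex|i x ex].
- by rewrite !rmorph1 mul1r mulr1.
- by rewrite !rmorphD mulrDl mulrDr ex ey.
- by rewrite !hecke_embZ -hecke_scalerAl -hecke_scalerAr ex.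
- rewrite !rmorphM /= !hecke_embT -mulrA ex !mulrA; congr (_ * _).
  by apply: heckeT_comm => /=; have := ltn_ord i; rewrite /=; lia.
Qed.

Lemma hecke_last_braid n :
  hecke_emb (last n) * last n.+1 * hecke_emb (last n) =
  last n.+1 * hecke_emb (last n) * last n.+1.
Proof. by rewrite hecke_embT; apply: heckeT_braid. Qed.

Lemma hecke_small_comm n (x y : hecke n) : (n <= 2)%N -> x * y = y * x.
Proof.
move=> n2; have gen (i : 'I_n.-1) (z : hecke n) : T i * z = z * T i.
  elim/hecke_ind: z => [|z z' ez ez'|c z ez|j z ez].
  - by rewrite mul1r mulr1.
  - by rewrite mulrDl mulrDr ez ez'.
  - by rewrite -hecke_scalerAl -hecke_scalerAr ez.
  - have -> : j = i by apply: val_inj => /=; have := ltn_ord i; have := ltn_ord j; lia.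
    by rewrite -mulrA -ez.
elim/hecke_ind: x => [|x z ex ez|c x ex|i x ex].
- by rewrite mul1r mulr1.
- by rewrite mulrDl mulrDr ex ez.
- by rewrite -hecke_scalerAl -hecke_scalerAr ex.
- by rewrite -mulrA ex mulrA gen mulrA.
Qed.

Lemma hecke_last_square n (x : hecke n.+1) (y : hecke n.+2) :
  last n.+1 * hecke_emb (hecke_emb x) * last n.+1 * hecke_emb y =
  hecke_emb (u ^+ 2 *: (hecke_emb x * y)) +
  hecke_emb (v *: hecke_emb x) * last n.+1 * hecke_emb y.
Proof.
rewrite -hecke_emb_last_comm -[_ * last _ * last _]mulrA heckeT_quad mulrDr mulrDl.
rewrite -(hecke_scalerAr (u ^+ 2)) -(hecke_scalerAr v) mulr1.
rewrite -(hecke_scalerAl (u ^+ 2)) -rmorphM -hecke_embZ; congr (_ + _ * _).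
by rewrite hecke_embZ -hecke_scalerAl.
Qed.

Lemma hecke_last_sandwich n (x x' : hecke n.+1) :
  last n.+1 * hecke_emb (hecke_emb x * last n * hecke_emb x') * last n.+1 =
  hecke_emb (hecke_emb x * last n) * last n.+1 * hecke_emb (last n * hecke_emb x').
Proof.
rewrite !rmorphM /= !mulrA -(hecke_emb_last_comm x).
rewrite -[_ * hecke_emb (hecke_emb x') * last _]mulrA (hecke_emb_last_comm x').
by rewrite -!mulrA; congr (_ * _); rewrite !mulrA hecke_last_braid.
Qed.

(** With T the last generator, this is the decomposition H_(n+2) = H_(n+1) + H_(n+1) T H_(n+1), in
    the form of an induction principle. *)
Definition hecke_spanning n := forall P : hecke n.+2 -> Prop,
  (forall x y, P x -> P y -> P (x + y)) ->
  (forall a, P (hecke_emb a)) ->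
  (forall a b, P (hecke_emb a * last n * hecke_emb b)) -> forall x, P x.

Lemma hecke_spanning_step n :
  (forall (Q : hecke n.+2 -> Prop),
    (forall x y, Q x -> Q y -> Q (x + y)) ->
    (forall a, Q (hecke_emb a)) ->
    (forall a b, Q (hecke_emb a * last n * hecke_emb b)) ->
    forall a b, Q (last n * (hecke_emb a * last n * hecke_emb b))) ->
  hecke_spanning n.
Proof.
move=> step P PD Pe Pt.
have split_last m (i : 'I_m.+1) : i = ord_max \/
    exists j : 'I_m, i = widen_ord (leq_pred m.+1) j :> 'I_m.+2.-1.
  case: (ltnP i m) => h; first by right; exists (Ordinal h); exact: val_inj.
  by left; apply: val_inj => /=; have := ltn_ord i; lia.
move=> x; elim/hecke_ind: x P PD Pe Pt =>
  [P _ Pe _|x y Hx Hy P PD Pe Pt|c x Hx P PD Pe Pt|i x Hx P PD Pe Pt].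
- by have := Pe 1; rewrite rmorph1.
- by apply: (PD); [apply: Hx | apply: Hy].
- apply: (Hx (fun x => P (c *: x))) => [y z|a|a b].
  + by rewrite scalerDr; exact: PD.
  + by rewrite -hecke_embZ.
  + by rewrite !hecke_scalerAl -hecke_embZ.
- apply: (Hx (fun x => P (T i * x))) => [y z|a|a b].
  + by rewrite mulrDr; exact: PD.
  + have [->|[j ->]] := split_last _ i; last by rewrite -hecke_embT -rmorphM; exact: Pe.
    by have := Pt 1 a; rewrite rmorph1 mul1r.
  + have [->|[j ->]] := split_last _ i; first exact: step.
    by rewrite -hecke_embT !mulrA -rmorphM; exact: Pt.
Qed.

(** The point is to reduce T a T b. If [a] comes from two sizes below, it commutes with T and T^2
    can be expanded. Otherwise a = x T' x' with T' the preceding generator, and the braid relation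
    leaves a single T. *)
Lemma hecke_span n : hecke_spanning n.
Proof.
elim: n => [|n IHn]; apply: hecke_spanning_step => Q QD Qe Qt a b.
  rewrite !mulrA [last 0 * _]hecke_small_comm // -[_ * last 0 * last 0]mulrA.
  rewrite heckeT_quad mulrDr mulrDl -(hecke_scalerAr v) -(hecke_scalerAr (u ^+ 2)) mulr1.
  by rewrite -!hecke_embZ (hecke_scalerAl v) -hecke_embZ -rmorphM; apply: (QD); [exact: Qe | exact: Qt].
rewrite !mulrA; elim/IHn: a => [x y Qx Qy|x|x x'].
- by rewrite rmorphD mulrDr !mulrDl; exact: QD.
- by rewrite hecke_last_square; apply: (QD); [exact: Qe | exact: Qt].
- by rewrite hecke_last_sandwich -mulrA -rmorphM; exact: Qt.
Qed.

End HeckeMorphisms.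

(** Row k = i of the braid relation for [ind_mx], the only row in which the quadratic relation
    intervenes. *)
Lemma braid_middle (A : pzRingType) (M : lmodType A) (cu cv t : A) :
  cu * t = t * cu -> cv * t = t * cv -> cu * cv = cv * cu -> t * t = cu + cv * t ->
  forall e1 e2 e3 : M,
  cu *: (cu *: (t *: e3) + cv *: e1) + cv *: (t *: (cu *: e2 + cv *: e1)) =
  t *: (cu *: (cu *: e3 + cv *: e2) + cv *: (t *: e1)).
Proof.
move=> ut vt uv tt e1 e2 e3; rewrite !scalerDr !scalerA -ut -vt.
rewrite -[cv * t * t]mulrA tt mulrDr scalerDl uv.
rewrite -(mulrA cu t cu) -ut mulrA -(mulrA cu t cv) -vt.
have -> : cv * t * cu = cu * (cv * t) by rewrite -mulrA -ut mulrA -uv mulrA.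
have -> : cv * t * cv = cv * (cv * t) by rewrite -mulrA -vt.
by rewrite addrACA.
Qed.

(** * Freeness over the preceding Hecke algebra and conditional expectation *)

Section InducedModule.
Variables (B : comUnitRingType) (u v : B) (n : nat).
Local Notation A := (hecke u v n.+1).
Local Notation cst := (pres_cst (hecke_rel u v n.+1)).
Local Notation mat := 'M[A]_n.+2.

(** Generators indexed by natural numbers, with value 0 out of range, so that [i.-1] can be used as
    an index without a proof. *)
Definition hT (k : nat) : A := if insub k is Some i then @heckeT B u v n.+1 i else 0.

Lemma hT_ord (i : 'I_n) : hT i = @heckeT B u v n.+1 i.
Proof. by rewrite /hT insubT //= => h; congr heckeT; exact: val_inj. Qed.

Lemma hT_comm i j : (i.+1 < j)%N -> (j < n)%N -> hT i * hT j = hT j * hT i.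
Proof.
move=> ij jn; have iN : (i < n)%N by lia.
by rewrite (hT_ord (Ordinal iN)) (hT_ord (Ordinal jn)) heckeT_comm //= ij.
Qed.

Lemma hT_braid i : (i.+1 < n)%N -> hT i * hT i.+1 * hT i = hT i.+1 * hT i * hT i.+1.
Proof.
move=> jn; have iN : (i < n)%N by lia.
by rewrite (hT_ord (Ordinal iN)) (hT_ord (Ordinal jn)) heckeT_braid.
Qed.

Lemma hT_quad i : (i < n)%N -> hT i * hT i = cst (u ^+ 2) + cst v * hT i.
Proof.
move=> iN; rewrite (hT_ord (Ordinal iN)) heckeT_quad; congr (_ + _).
by rewrite /pres_cst -[RHS]hecke_scalerAl mul1r.
Qed.

(* [H_(n+2)] is free as a left [H_(n+1)]-module on the products [T_n ... T_k],
   [0 <= k <= n+1]; row [k] of [ind_mx i] is the right action of [T_i] on that basis. *)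
Definition ind_row (i : 'I_n.+1) (k : 'I_n.+2) : 'rV[A]_n.+2 :=
  if (k < i)%N then hT i.-1 *: delta_mx 0 k
  else if (k == i :> nat) then
    cst (u ^+ 2) *: delta_mx 0 (ord_hi (i : 'I_n.+2.-1)) + cst v *: delta_mx 0 k
  else if (k == i.+1 :> nat) then delta_mx 0 (ord_lo (i : 'I_n.+2.-1))
  else hT i *: delta_mx 0 k.

Definition ind_mx (i : 'I_n.+1) : mat := \matrix_k ind_row i k.

Section Rows.
Variables (m : nat) (X : 'M[A]_(n.+2, m)) (i : 'I_n.+1) (k : 'I_n.+2).

Lemma row_ind_mx : row k (ind_mx i *m X) = ind_row i k *m X.
Proof. by rewrite row_mul rowK. Qed.

Lemma row_ind_lt : (k < i)%N -> row k (ind_mx i *m X) = hT i.-1 *: row k X.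
Proof. by move=> h; rewrite row_ind_mx /ind_row h -scalemxAl -rowE. Qed.

Lemma row_ind_gt : (i.+1 < k)%N -> row k (ind_mx i *m X) = hT i *: row k X.
Proof.
move=> h; rewrite row_ind_mx /ind_row; do 3!(case: ifP => [|_]; first lia).
by rewrite -scalemxAl -rowE.
Qed.

Lemma row_ind_lo : k = i :> nat -> row k (ind_mx i *m X) =
  cst (u ^+ 2) *: row (ord_hi (i : 'I_n.+2.-1)) X + cst v *: row k X.
Proof.
move=> h; rewrite row_ind_mx /ind_row; rewrite h ltnn eqxx.
by rewrite mulmxDl -!scalemxAl -!rowE.
Qed.

Lemma row_ind_hi : k = i.+1 :> nat ->
  row k (ind_mx i *m X) = row (ord_lo (i : 'I_n.+2.-1)) X.
Proof.
move=> h; rewrite row_ind_mx /ind_row; do 2!(case: ifP => [|_]; first lia).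
by rewrite h eqxx -rowE.
Qed.

End Rows.

Lemma ind_pos (i : 'I_n.+1) (k : 'I_n.+2) :
  [\/ (k < i)%N, k = i :> nat, k = i.+1 :> nat | (i.+1 < k)%N].
Proof.
case: (ltngtP k i) => h; [by constructor 1 | | by constructor 2].
by case: (ltngtP k i.+1) => h'; [lia | constructor 4 | constructor 3].
Qed.

Lemma ind_comm_lt (i j : 'I_n.+1) : (i.+1 < j)%N -> ind_mx i * ind_mx j = ind_mx j * ind_mx i.
Proof.
move=> ij; rewrite -[LHS]mulmx1 -[RHS]mulmx1 -!mulmxA; set X := 1%:M.
apply/row_matrixP => k.
have jn := ltn_ord j; have kn := ltn_ord k.
have lo_i : (ord_lo (i : 'I_n.+2.-1) < j)%N by rewrite /=; lia.
have hi_i : (ord_hi (i : 'I_n.+2.-1) < j)%N by rewrite /=; lia.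
have lo_j : (i.+1 < ord_lo (j : 'I_n.+2.-1))%N by rewrite /=; lia.
have hi_j : (i.+1 < ord_hi (j : 'I_n.+2.-1))%N by rewrite /=; lia.
case: (ind_pos i k) => hi; case: (ind_pos j k) => hj; try (exfalso; lia).
- rewrite (row_ind_lt _ hi) (row_ind_lt _ hj) (row_ind_lt _ hj) (row_ind_lt _ hi).
  by rewrite !scalerA hT_comm //; lia.
- rewrite (row_ind_lo _ hi) (row_ind_lt _ hi_i) (row_ind_lt _ hj) (row_ind_lt _ hj).
  by rewrite (row_ind_lo _ hi) scalerDr !scalerA !pres_cstC.
- rewrite (row_ind_hi _ hi) (row_ind_lt _ lo_i) (row_ind_lt _ hj) (row_ind_hi _ hi).
  by [].
- rewrite (row_ind_gt _ hi) (row_ind_lt _ hj) (row_ind_lt _ hj) (row_ind_gt _ hi).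
  by rewrite !scalerA hT_comm //; lia.
- rewrite (row_ind_gt _ hi) (row_ind_lo _ hj) (row_ind_lo _ hj) (row_ind_gt _ hi).
  by rewrite (row_ind_gt _ hi_j) scalerDr !scalerA !pres_cstC.
- rewrite (row_ind_gt _ hi) (row_ind_hi _ hj) (row_ind_hi _ hj) (row_ind_gt _ lo_j).
  by [].
- rewrite (row_ind_gt _ hi) (row_ind_gt _ hj) (row_ind_gt _ hj) (row_ind_gt _ hi).
  by rewrite !scalerA hT_comm //; lia.
Qed.

Lemma ind_comm (i j : 'I_n.+1) : (i.+1 < j)%N || (j.+1 < i)%N ->
  ind_mx i * ind_mx j = ind_mx j * ind_mx i.
Proof. by case/orP => /ind_comm_lt. Qed.

Lemma ind_braid (i j : 'I_n.+1) : i.+1 = j :> nat ->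
  ind_mx i * ind_mx j * ind_mx i = ind_mx j * ind_mx i * ind_mx j.
Proof.
move=> ij; rewrite -[LHS]mulmx1 -[RHS]mulmx1 -!mulmxA; set X := 1%:M.
apply/row_matrixP => k.
have jn := ltn_ord j; have kn := ltn_ord k.
have hij : ord_hi (i : 'I_n.+2.-1) = ord_lo (j : 'I_n.+2.-1) by apply: val_inj; rewrite /= ij.
have lo_i : (ord_lo (i : 'I_n.+2.-1) < j)%N by rewrite /=; lia.
have lo_i' : (ord_lo (i : 'I_n.+2.-1) = i :> nat)%N by [].
have lo_j : ord_lo (j : 'I_n.+2.-1) = j :> nat by [].
have lo_j' : ord_lo (j : 'I_n.+2.-1) = i.+1 :> nat by rewrite /=.
have hi_j : (i.+1 < ord_hi (j : 'I_n.+2.-1))%N by rewrite /=; lia.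
have hi_j' : ord_hi (j : 'I_n.+2.-1) = j.+1 :> nat by [].
have iN : (i < n)%N by lia.
have ji : j.-1 = i by lia.
have hTi := hT_quad iN.
case: (ind_pos i k) => hi; case: (ind_pos j k) => hj; try (exfalso; lia).
- rewrite (row_ind_lt _ hi) (row_ind_lt _ hj) (row_ind_lt _ hi).
  rewrite (row_ind_lt _ hj) (row_ind_lt _ hi) (row_ind_lt _ hj) !scalerA ji.
  case: {ij lo_i lo_i' lo_j' hi_j hTi ji hj} (i : nat) hi iN => // i' _ i'n.
  by rewrite hT_braid.
- rewrite (row_ind_lo _ hi) (row_ind_lt _ hj) (row_ind_lo _ hi).
  rewrite hij (row_ind_lo _ lo_j) (row_ind_gt _ hi_j) (row_ind_hi _ lo_j').
  rewrite (row_ind_lt _ hj) (row_ind_lo _ hi) hij (row_ind_lo _ lo_j) (row_ind_lt _ hj) ji.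
  have -> : k = ord_lo (i : 'I_n.+2.-1) by apply: val_inj; rewrite /= hi.
  by apply: braid_middle => //; exact: pres_cstC.
- rewrite (row_ind_hi _ hi) (row_ind_lt _ lo_i) (row_ind_lo _ lo_i') ji.
  rewrite (row_ind_lo _ hj) (row_ind_gt _ hi_j) (row_ind_hi _ hi) (row_ind_hi _ hi_j').
  rewrite (row_ind_lt _ lo_i) ji hij !scalerDr !scalerA.
  by congr (_ *: _ + _ *: _); exact/esym/pres_cstC.
- rewrite (row_ind_gt _ hi) (row_ind_hi _ hj) (row_ind_hi _ lo_j').
  rewrite (row_ind_hi _ hj) (row_ind_hi _ lo_j') (row_ind_lt _ lo_i) ji.
  by [].
- rewrite (row_ind_gt _ hi) (row_ind_gt _ hj) (row_ind_gt _ hi).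
  rewrite (row_ind_gt _ hj) (row_ind_gt _ hi) (row_ind_gt _ hj) !scalerA -ij.
  by rewrite hT_braid; last lia.
Qed.

Lemma ind_quad (i : 'I_n.+1) :
  ind_mx i * ind_mx i = (cst (u ^+ 2))%:M + (cst v)%:M * ind_mx i.
Proof.
rewrite -[ind_mx i * ind_mx i]mulmx1 -[_%:M * ind_mx i]mulmx1 -!mulmxA; set X := 1%:M.
rewrite mul_scalar_mx -[(cst (u ^+ 2))%:M]mul1mx.
apply/row_matrixP => k.
have iN := ltn_ord i; have kn := ltn_ord k.
rewrite linearD linearZ /=.
have -> : row k (1%:M *m (cst (u ^+ 2))%:M : mat) = cst (u ^+ 2) *: row k X.
  by rewrite mul1mx -scalemx1 linearZ.
have lo_i : ord_lo (i : 'I_n.+2.-1) = i :> nat by [].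
have hi_i : ord_hi (i : 'I_n.+2.-1) = i.+1 :> nat by [].
case: (ind_pos i k) => hi.
- rewrite (row_ind_lt _ hi) (row_ind_lt _ hi) !scalerA hT_quad; last by lia.
  by rewrite scalerDl.
- rewrite (row_ind_lo _ hi) (row_ind_hi _ hi_i) (row_ind_lo _ hi).
  by congr (_ *: row _ _ + _); apply: val_inj; rewrite /= hi.
- rewrite (row_ind_hi _ hi) (row_ind_lo _ lo_i) (row_ind_hi _ hi).
  by congr (_ *: row _ _ + _); apply: val_inj; rewrite /= hi.
- rewrite (row_ind_gt _ hi) (row_ind_gt _ hi) !scalerA hT_quad; last by lia.
  by rewrite scalerDl.
Qed.

End InducedModule.

Section ConditionalExpectation.
Variables (B : comUnitRingType) (u v : B) (n : nat).
Local Notation A := (hecke u v n.+1).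
Local Notation H := (hecke u v n.+2).
Local Notation cst := (pres_cst (hecke_rel u v n.+1)).
Local Notation mat := 'M[A]_n.+2.
Local Notation hT := (@hT B u v n).
Local Notation ind_mx := (@ind_mx B u v n).

(* [tau (x T) = tau (x T^-1)] and [T^-1 = u^-2 (T - v)] force [tau (hecke_emb x) = z tau x]. *)
Definition markov_z : B := v^-1 * (1 - u ^+ 2).
Local Notation z := markov_z.

Definition mat_cst : B -> mat := fun c => (cst c)%:M.

Fact mat_cst_zmod : zmod_morphism mat_cst.
Proof. by move=> a b; rewrite /mat_cst rmorphB raddfB. Qed.
HB.instance Definition _ := GRing.isZmodMorphism.Build _ _ mat_cst mat_cst_zmod.

Fact mat_cst_monoid : monoid_morphism mat_cst.
Proof.
split=> [|a b]; rewrite /mat_cst; first by rewrite rmorph1.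
by rewrite rmorphM; exact: scalar_mxM.
Qed.
HB.instance Definition _ := GRing.isMonoidMorphism.Build _ _ mat_cst mat_cst_monoid.

Lemma mat_cstC c (X : mat) : mat_cst c * X = X * mat_cst c.
Proof.
rewrite [LHS]mul_scalar_mx; apply/matrixP => k l; rewrite !mxE (bigD1 l) //= !mxE eqxx.
rewrite big1 ?addr0 ?pres_cstC // => j ne; rewrite !mxE (negPf ne) mulr0n mulr0 //.
Qed.

Definition ind_rep : H -> mat :=
  pres_lift (R := hecke_rel u v n.+2) mat_cst ind_mx.

Lemma ind_rep_spec :
  [/\ zmod_morphism ind_rep, monoid_morphism ind_rep,
      forall c (x : H), ind_rep (c *: x) = mat_cst c * ind_rep x &
      forall i, ind_rep (@heckeT B u v n.+2 i) = ind_mx i].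
Proof.
apply: hecke_lift_spec.
- exact: mat_cstC.
- exact: ind_comm.
- exact: ind_braid.
- exact: ind_quad.
Qed.

HB.instance Definition _ := GRing.isZmodMorphism.Build _ _ ind_rep
  (let: And4 h _ _ _ := ind_rep_spec in h).
HB.instance Definition _ := GRing.isMonoidMorphism.Build _ _ ind_rep
  (let: And4 _ h _ _ := ind_rep_spec in h).

Lemma ind_repZ c (x : H) : ind_rep (c *: x) = cst c *: ind_rep x.
Proof. by have [_ _ -> _] := ind_rep_spec; exact: mul_scalar_mx. Qed.

Lemma ind_repT i : ind_rep (@heckeT B u v n.+2 i) = ind_mx i.
Proof. by have [_ _ _ ->] := ind_rep_spec. Qed.

Fixpoint descent_prod (k : nat) : A :=
  if k is k'.+1 then descent_prod k' * hT (n - k) else 1.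

(** The product T_(n-1) ... T_k, that is, the basis element T_n ... T_k deprived of its factor
    T_n. *)
Definition tail_prod (k : nat) : A := descent_prod (n - k).

Lemma tail_prod_rec k : (k < n)%N -> tail_prod k = tail_prod k.+1 * hT k.
Proof.
by move=> kn; rewrite /tail_prod -(subnSK kn) /= subnSK // subKn // ltnW.
Qed.

Lemma tail_prod_last : tail_prod n = 1.
Proof. by rewrite /tail_prod subnn. Qed.

Lemma hT_tail_comm a k : (a.+1 < k)%N -> (k <= n)%N -> hT a * tail_prod k = tail_prod k * hT a.
Proof.
move=> ak kn; move eqm: (n - k)%N => m; elim: m k ak kn eqm => [|m IH] k ak kn e.
  have -> : k = n by lia.
  by rewrite tail_prod_last mul1r mulr1.
have kN : (k < n)%N by lia.
rewrite tail_prod_rec // mulrA IH; try lia.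
by rewrite -!mulrA hT_comm.
Qed.

(** T_(i-1) commutes with the factors preceding T_i T_(i-1); there the braid relation turns it into
    T_i, which commutes with all factors that follow. *)
Lemma hT_tail_shift i k : (k < i)%N -> (i < n)%N ->
  hT i.-1 * tail_prod k = tail_prod k * hT i.
Proof.
case: i => // i; rewrite ltnS /= => ki iN.
move eqm: (i - k)%N => m; elim: m k ki eqm => [|m IH] k ki e.
  have -> : k = i by lia.
  rewrite tail_prod_rec; last by lia.
  rewrite tail_prod_rec // !mulrA hT_tail_comm //.
  by rewrite -!mulrA (mulrA (hT i)) hT_braid // -mulrA.
rewrite tail_prod_rec; last by lia.
have hc : hT k * hT i.+1 = hT i.+1 * hT k by apply: hT_comm; lia.
rewrite mulrA IH; try lia.
by rewrite -!mulrA hc.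
Qed.

(** The expectations of the basis elements: T_n ... T_k loses its factor T_n, and the last basis
    element, which is 1, goes to z. *)
Definition exp_col : 'cV[A]_n.+2 :=
  \col_(k < n.+2) if (k == n.+1 :> nat) then cst z else tail_prod k.

(** Right linearity over H_(n+1), checked on the basis: the generators of H_(n+1) are the T_i with i
    < n. *)
Lemma ind_mx_exp_col (i : 'I_n) :
  ind_mx (widen_ord (leqnSn n) i) *m exp_col = exp_col *m (@heckeT B u v n.+1 i)%:M.
Proof.
have iN := ltn_ord i; apply/row_matrixP => k; have kn := ltn_ord k.
rewrite [RHS]row_mul; set i' := widen_ord _ i.
have row_col l : row l exp_col = (exp_col l 0)%:M by apply/rowP => j; rewrite !mxE ord1 eqxx.
have -> : row k exp_col *m (heckeT u v (i : 'I_n.+1.-1))%:M = (exp_col k 0 * hT i)%:M.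
  by rewrite row_col hT_ord -scalar_mxM.
have i'E : i' = i :> nat by [].
case: (ind_pos i' k) => hi.
- rewrite (row_ind_lt _ hi) row_col -mul_scalar_mx -scalar_mxM; congr _%:M.
  rewrite !mxE /= (_ : (k == n.+1 :> nat) = false); last by lia.
  by rewrite hT_tail_shift.
- rewrite (row_ind_lo _ hi) !row_col -!mul_scalar_mx -!scalar_mxM -raddfD; congr _%:M.
  rewrite !mxE /= hi i'E eqSS (_ : (i == n :> nat) = false); last by lia.
  rewrite (_ : (i == n.+1 :> nat) = false); last by lia.
  rewrite (tail_prod_rec iN) -[RHS]mulrA hT_quad // mulrDr; congr (_ + _); first exact: pres_cstC.
  by rewrite !mulrA pres_cstC.
- rewrite (row_ind_hi _ hi) !row_col; congr _%:M.
  rewrite !mxE /= hi i'E eqSS (_ : (i == n :> nat) = false); last by lia.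
  rewrite (_ : (i == n.+1 :> nat) = false); last by lia.
  by rewrite (tail_prod_rec iN).
- rewrite (row_ind_gt _ hi) row_col -mul_scalar_mx -scalar_mxM; congr _%:M.
  rewrite !mxE /=; case: eqP => h; first by rewrite pres_cstC.
  by rewrite hT_tail_comm //; lia.
Qed.

(** The last basis element being 1, the last row of [ind_rep x] lists the coordinates of [x]. The
    resulting map is one of H_(n+1)-bimodules. *)
Definition cond_exp (x : H) : A := (row ord_max (ind_rep x) *m exp_col) 0 0.

Lemma cond_exp_linear c (x y : H) : cond_exp (c *: x + y) = c *: cond_exp x + cond_exp y.
Proof.
rewrite /cond_exp rmorphD /= ind_repZ linearD linearZ /= mulmxDl -scalemxAl.
by rewrite [LHS]mxE [X in X + _]mxE /pres_cst -hecke_scalerAl mul1r.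
Qed.

Lemma cond_exp_mull (a : A) (x : H) : cond_exp (hecke_emb a * x) = a * cond_exp x.
Proof.
suff e m (X : 'M[A]_(n.+2, m)) : row ord_max (ind_rep (hecke_emb a) *m X) = a *: row ord_max X.
  by rewrite /cond_exp rmorphM /= e -scalemxAl mxE.
elim/hecke_ind: a X => [|a b ea eb|c a ea|i a ea] X.
- by rewrite !rmorph1 mul1mx scale1r.
- by rewrite !rmorphD mulmxDl linearD /= ea eb scalerDl.
- rewrite hecke_embZ ind_repZ -scalemxAl linearZ /= ea scalerA.
  by rewrite /pres_cst -hecke_scalerAl mul1r.
- rewrite !rmorphM /= hecke_embT ind_repT -mulmxA row_ind_gt /=; last first.
    by have := ltn_ord i; rewrite /=; lia.
  by rewrite ea scalerA (hT_ord u v).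
Qed.

Lemma cond_exp_mulr (x : H) (b : A) : cond_exp (x * hecke_emb b) = cond_exp x * b.
Proof.
suff e : ind_rep (hecke_emb b) *m exp_col = exp_col *m b%:M.
  rewrite /cond_exp rmorphM /= row_mul -mulmxA e mulmxA.
  by rewrite [LHS]mxE big_ord1; congr (_ * _); rewrite mxE eqxx mulr1n.
elim/hecke_ind: b => [|a b ea eb|c a ea|i a ea].
- by rewrite !rmorph1 mul1mx mulmx1.
- by rewrite !rmorphD mulmxDl /= ea eb -mulmxDr -raddfD.
- rewrite hecke_embZ ind_repZ -scalemxAl /= ea.
  have -> : c *: a = cst c * a by rewrite /pres_cst -hecke_scalerAl mul1r.
  rewrite scalar_mxM scalemxAl mulmxA; congr (_ *m _); apply/matrixP => k l.
  rewrite !mxE big_ord1 !mxE (ord1 l) eqxx mulr1n.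
  exact: pres_cstC.
- rewrite !rmorphM /= hecke_embT ind_repT -mulmxA ea mulmxA.
  have -> : widen_ord (leq_pred n.+1) i = widen_ord (leqnSn n) (i : 'I_n) :> 'I_n.+1 by exact: val_inj.
  by rewrite ind_mx_exp_col -mulmxA.
Qed.

Lemma cond_exp1 : cond_exp 1 = cst z.
Proof.
by rewrite /cond_exp rmorph1 -row_mul mul1mx !mxE /= eqxx.
Qed.

Lemma cond_exp_last : cond_exp (@heckeT B u v n.+2 ord_max) = 1.
Proof.
rewrite /cond_exp ind_repT -[ind_mx _]mulmx1 row_ind_hi // -row_mul mul1mx !mxE /=.
by case: eqP => [|_]; [lia | exact: tail_prod_last].
Qed.

Lemma cond_exp_emb (a : A) : cond_exp (hecke_emb a) = z *: a.
Proof.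
by rewrite -[hecke_emb a]mulr1 cond_exp_mull cond_exp1 -pres_cstC /pres_cst -hecke_scalerAl mul1r.
Qed.

Lemma cond_exp_sandwich (a b : A) :
  cond_exp (hecke_emb a * @heckeT B u v n.+2 ord_max * hecke_emb b) = a * b.
Proof. by rewrite cond_exp_mulr cond_exp_mull cond_exp_last mulr1. Qed.

End ConditionalExpectation.

(** * The trace as an iterated conditional expectation *)

Section OcneanuTrace.
Variables (B : comUnitRingType) (u v : B).
Hypothesis u_unit : u \is a GRing.unit.
Hypothesis v_unit : v \is a GRing.unit.
Local Notation hecke := (hecke u v).
Local Notation z := (markov_z u v).
Local Notation last n := (@heckeT B u v n.+2 ord_max).

(** There are no generators in sizes 0 and 1, where the lift of the empty family takes the
    coefficient of 1. *)
Definition ocneanu_step (m : nat) : (hecke m -> B) -> hecke m.+1 -> B :=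
  match m with
  | 0 => fun _ => pres_lift (R := hecke_rel u v 1) idfun (fun=> 0)
  | _.+1 => fun f x => f (cond_exp x)
  end.

Fixpoint ocneanu (n : nat) : hecke n -> B :=
  match n with
  | 0 => pres_lift (R := hecke_rel u v 0) idfun (fun=> 0)
  | m.+1 => ocneanu_step (@ocneanu m)
  end.

Lemma ocneanuS n (x : hecke n.+2) : ocneanu x = ocneanu (cond_exp x).
Proof. by []. Qed.

Lemma ocneanu_small n : (n < 2)%N ->
  scalar (@ocneanu n) /\ @ocneanu n 1 = 1.
Proof.
case: n => [|[|//]] _.
- have [|||[]//|zF [mF1 _] sF _] := @hecke_lift_spec B u v 0 B idfun (fun=> 0);
    [by move=> c s; rewrite mulrC | by case | by case |].
  split=> // c x y; have e : y = - (-1 *: y) by rewrite scaleN1r opprK.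
  rewrite {1}e; apply: etrans (zF _ _) _; rewrite !sF /=.
  by rewrite mulN1r opprK.
- have [|||[]//|zF [mF1 _] sF _] := @hecke_lift_spec B u v 1 B idfun (fun=> 0);
    [by move=> c s; rewrite mulrC | by case | by case |].
  split=> // c x y; have e : y = - (-1 *: y) by rewrite scaleN1r opprK.
  rewrite {1}e; apply: etrans (zF _ _) _; rewrite !sF /=.
  by rewrite mulN1r opprK.
Qed.

Lemma ocneanu_scalar n : scalar (@ocneanu n).
Proof.
elim: n => [|[|n] IH]; [exact: (ocneanu_small _).1 | exact: (ocneanu_small _).1 |].
by move=> c x y; rewrite !ocneanuS cond_exp_linear IH.
Qed.

Lemma ocneanuD n (x y : hecke n) : ocneanu (x + y) = ocneanu x + ocneanu y.
Proof. by rewrite -{1}[x]scale1r ocneanu_scalar mul1r. Qed.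

Lemma ocneanu0 n : ocneanu (0 : hecke n) = 0.
Proof. by apply: (addIr (ocneanu (0 : hecke n))); rewrite -ocneanuD add0r add0r. Qed.

Lemma ocneanuZ n c (x : hecke n) : ocneanu (c *: x) = c * ocneanu x.
Proof. by rewrite -[c *: x]addr0 ocneanu_scalar ocneanu0 addr0. Qed.

Lemma ocneanu_emb n (x : hecke n.+1) : ocneanu (hecke_emb x) = z * ocneanu x.
Proof. by rewrite ocneanuS cond_exp_emb ocneanuZ. Qed.

Lemma ocneanu_sandwich n (x y : hecke n.+1) :
  ocneanu (hecke_emb x * last n * hecke_emb y) = ocneanu (x * y).
Proof. by rewrite ocneanuS cond_exp_sandwich. Qed.

(** The expectation of T a T, for T the generator following those of [a]. The trace property for T
    amounts to this operator being self-adjoint for the form tau (a b). *)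
Definition last_conj n (a : hecke n.+2) : hecke n.+2 :=
  cond_exp (last n.+1 * hecke_emb a * last n.+1).

Lemma last_conj_emb n (c : hecke n.+1) :
  last_conj (hecke_emb c) = (u ^+ 2 * z + v) *: hecke_emb c.
Proof.
rewrite /last_conj -[_ * _ * last _]mulr1 -[in X in _ * _ * _ * X](rmorph1 (@hecke_emb B u v n.+2)).
rewrite hecke_last_square -[X in X + _]scale1r cond_exp_linear scale1r.
rewrite cond_exp_emb cond_exp_sandwich !mulr1 scalerA scalerDl.
by rewrite [z * _]mulrC.
Qed.

Lemma last_conj_sandwich n (c e : hecke n.+1) :
  last_conj (hecke_emb c * last n * hecke_emb e) =
  u ^+ 2 *: hecke_emb (c * e) + v *: (hecke_emb c * last n * hecke_emb e).
Proof.
rewrite /last_conj hecke_last_sandwich cond_exp_sandwich !mulrA -[_ * last n * last n]mulrA.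
rewrite heckeT_quad mulrDr mulrDl -(hecke_scalerAr (u ^+ 2)) -(hecke_scalerAr v) mulr1.
by rewrite -(hecke_scalerAl (u ^+ 2)) -(hecke_scalerAl v) rmorphM.
Qed.

Lemma last_conjD n (a b : hecke n.+2) : last_conj (a + b) = last_conj a + last_conj b.
Proof.
rewrite /last_conj rmorphD mulrDr mulrDl -[X in cond_exp (X + _)]scale1r cond_exp_linear.
by rewrite scale1r.
Qed.

(** Both arguments are decomposed by [hecke_span]. In the mixed cases the coefficient u^2 z + v on
    embedded elements matches u^2 and v on sandwiches, because the trace of an embedded element
    carries the factor z. *)
Lemma ocneanu_last_conj n (a b : hecke n.+2) :
  ocneanu (a * last_conj b) = ocneanu (last_conj a * b).
Proof.
elim/hecke_span: a b => [a a' ea ea' b|c b|c c' b].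
- by rewrite last_conjD !mulrDl !ocneanuD ea ea'.
- elim/hecke_span: b => [b b' eb eb'|e|e e'].
  + by rewrite last_conjD !mulrDr !ocneanuD eb eb'.
  + by rewrite !last_conj_emb -hecke_scalerAr -hecke_scalerAl.
  + rewrite last_conj_emb last_conj_sandwich mulrDr ocneanuD.
    rewrite -hecke_scalerAl -!hecke_scalerAr !ocneanuZ !mulrA -!rmorphM.
    by rewrite ocneanu_emb ocneanu_sandwich mulrDl !mulrA.
- elim/hecke_span: b => [b b' eb eb'|e|e e'].
  + by rewrite last_conjD !mulrDr !ocneanuD eb eb'.
  + rewrite last_conj_emb last_conj_sandwich mulrDl ocneanuD.
    rewrite -!hecke_scalerAl -hecke_scalerAr !ocneanuZ -!mulrA -!rmorphM !mulrA.
    by rewrite ocneanu_emb ocneanu_sandwich mulrDl !mulrA.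
  + rewrite !last_conj_sandwich mulrDl mulrDr !ocneanuD.
    rewrite -!hecke_scalerAl -!hecke_scalerAr !ocneanuZ; congr (_ + _); congr (_ * _).
    rewrite -mulrA -rmorphM ocneanu_sandwich !mulrA -!rmorphM ocneanu_sandwich.
    by rewrite ?mulrA.
Qed.

Lemma ocneanu_trace n (x y : hecke n.+1) : ocneanu (x * y) = ocneanu (y * x).
Proof.
elim: n x y => [|[|n] IH] x y; try by rewrite hecke_small_comm.
elim/hecke_span: y x => [y y' ey ey'|a|a b] x.
- by rewrite mulrDr mulrDl !ocneanuD ey ey'.
- by rewrite !(ocneanuS (_ * _)) cond_exp_mull cond_exp_mulr IH.
have emb_cyc (w : hecke n.+3) c : ocneanu (w * hecke_emb c) = ocneanu (hecke_emb c * w).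
  by rewrite !(ocneanuS (_ * _)) cond_exp_mull cond_exp_mulr IH.
(* For w = c T e, tau (c T e T) = tau (c (last_conj e)) = tau ((last_conj c) e) = tau (T c T e). *)
have last_cyc (w : hecke n.+3) : ocneanu (w * last n.+1) = ocneanu (last n.+1 * w).
  elim/hecke_span: w => [w w' ew ew'|c|c e].
  - by rewrite mulrDr mulrDl !ocneanuD ew ew'.
  - have := ocneanu_sandwich c 1; have := ocneanu_sandwich 1 c.
    by rewrite !rmorph1 !mulr1 !mul1r => -> ->.
  - rewrite -!mulrA (ocneanuS (_ * _)) cond_exp_mull mulrA -/(last_conj e) ocneanu_last_conj.
    by rewrite !mulrA [in RHS]ocneanuS cond_exp_mulr.
by rewrite !mulrA emb_cyc !mulrA last_cyc !mulrA -!mulrA -emb_cyc !mulrA.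
Qed.

Lemma heckeT_ring_inv n (i : 'I_n.-1) :
  ring_inv (heckeT u v i) = u^-2 *: (heckeT u v i - v *: (1 : hecke n)).
Proof.
set y := RHS.
have Ty : heckeT u v i * y = 1.
  rewrite /y -hecke_scalerAr mulrBr heckeT_quad -hecke_scalerAr mulr1 addrK scalerA.
  by rewrite mulVr ?scale1r // unitrX.
have yT : y * heckeT u v i = 1.
  rewrite /y -hecke_scalerAl mulrBl heckeT_quad -hecke_scalerAl mul1r addrK scalerA.
  by rewrite mulVr ?scale1r // unitrX.
have : exists y', heckeT u v i * y' = 1 /\ y' * heckeT u v i = 1 by exists y.
move=> /(theP 0) [_ h]; rewrite -/(ring_inv _) in h.
by rewrite -[LHS]mulr1 -Ty mulrA h mul1r.
Qed.

Theorem ocneanu_markov : is_hecke_markov_trace ocneanu.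
Proof.
split.
- exact: ocneanu_scalar.
- exact: (@ocneanu_small 0 isT).2.
- exact: (@ocneanu_small 1 isT).2.
- exact: ocneanu_trace.
- by move=> n x; have := ocneanu_sandwich x 1; rewrite rmorph1 !mulr1.
- move=> n x; rewrite heckeT_ring_inv -hecke_scalerAr mulrBr -hecke_scalerAr mulr1.
  rewrite ocneanuZ -scaleNr addrC ocneanu_scalar ocneanu_emb.
  have := ocneanu_sandwich x 1; rewrite rmorph1 !mulr1 => ->.
  (* Here z is used: - v z = u^2 - 1, which together with the contribution 1 of T gives u^2,
     cancelled by the factor u^-2 of the inverse. *)
  have -> : - v * (z * ocneanu x) = (u ^+ 2 - 1) * ocneanu x.
    by rewrite mulrA mulNr (mulVKr v_unit) opprB.
  by rewrite -{2}[ocneanu x]mul1r -mulrDl subrK mulKr // unitrX.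
Qed.

Lemma hecke_tauP : is_hecke_markov_trace (@hecke_tau B u v).
Proof. by apply: theP; exists ocneanu; exact: ocneanu_markov. Qed.

End OcneanuTrace.

(** The product is ordered and noncommutative: [y] moves past the factors that precede index [a] and
    is absorbed there. *)
Lemma prod_insert (R : pzRingType) (d : nat) (F G : 'I_d -> R) (a : 'I_d) (y : R) :
  (forall b, b != a -> y * F b = F b * y) -> G a = y * F a ->
  (forall b, b != a -> G b = F b) -> y * \prod_b F b = \prod_b G b.
Proof.
move=> yF Ga GF.
suff h r : uniq r -> (a \in r -> y * \prod_(b <- r) F b = \prod_(b <- r) G b) /\
    (a \notin r -> \prod_(b <- r) F b = \prod_(b <- r) G b).
  by apply: (h _ (index_enum_uniq _)).1; rewrite mem_index_enum.
elim: r => [|b r IH] /=; first by split=> //; rewrite !big_nil.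
move=> /andP[br /IH [IH1 IH2]]; rewrite !big_cons inE; split.
  case: (eqVneq a b) => [ab _|ab /= ar]; first by subst b; rewrite Ga mulrA IH2.
  by rewrite mulrA yF 1?eq_sym // -mulrA IH1 // GF // eq_sym.
rewrite negb_or => /andP[ab ar]; rewrite IH2 // GF //; first by rewrite eq_sym.
Qed.

(** * Tensor products of traces on Young subalgebras *)

Section TensorTrace.
Variables (B : comUnitRingType) (u v : B).
Hypothesis u_unit : u \is a GRing.unit.
Hypothesis v_unit : v \is a GRing.unit.
Variables (d n : nat) (mu : Comp d n).
Local Notation hecke := (hecke u v).
Local Notation Tw := (@heckeTw B u v _).
Local Notation emb a := (@block_emb B u v d n mu a).
Local Notation bstd a w := (std (@block_inj d n mu a) w).
Local Notation tau := (@hecke_tau B u v _).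
Implicit Types (w : 'S_n) (a b : 'I_d).

Lemma block_emb_spec a :
  [/\ zmod_morphism (emb a), monoid_morphism (emb a),
      forall c (x : hecke (part mu a)), emb a (c *: x) = c *: emb a x &
      forall i, emb a (heckeT u v i) = heckeT u v (block_gen i)].
Proof. by apply: (@hecke_shift_spec B u v _ _ (fun i => block_gen i) (block_start mu a)). Qed.

HB.instance Definition _ a := GRing.isZmodMorphism.Build _ _ (emb a)
  (let: And4 h _ _ _ := block_emb_spec a in h).
HB.instance Definition _ a := GRing.isMonoidMorphism.Build _ _ (emb a)
  (let: And4 _ h _ _ := block_emb_spec a in h).

Lemma block_embZ a c (x : hecke (part mu a)) : emb a (c *: x) = c *: emb a x.
Proof. by have [_ _ -> _] := block_emb_spec a. Qed.

Lemma block_embT a (i : 'I_(part mu a).-1) : emb a (heckeT u v i) = heckeT u v (block_gen i).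
Proof. by have [_ _ _ ->] := block_emb_spec a. Qed.

Lemma block_emb_comm a b (x : hecke (part mu a)) (y : hecke (part mu b)) : a != b ->
  emb a x * emb b y = emb b y * emb a x.
Proof.
move=> ab.
elim/hecke_ind: x => [|x x' ex ex'|c x ex|i x ex].
- by rewrite rmorph1 mul1r mulr1.
- by rewrite rmorphD mulrDl mulrDr ex ex'.
- by rewrite block_embZ -hecke_scalerAl -hecke_scalerAr ex.
rewrite rmorphM /= -mulrA ex !mulrA; congr (_ * _).
elim/hecke_ind: y {ex} => [|y y' ey ey'|c y ey|j y ey].
- by rewrite rmorph1 mul1r mulr1.
- by rewrite rmorphD mulrDl mulrDr ey ey'.
- by rewrite block_embZ -hecke_scalerAl -hecke_scalerAr ey.
rewrite rmorphM /= -mulrA -ey !mulrA; congr (_ * _).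
rewrite !block_embT heckeT_comm //=.
have := ltn_ord i; have := ltn_ord j; move: ab; rewrite -(inj_eq val_inj) /= neq_ltn.
by case/orP => /(block_end_start mu); lia.
Qed.

Lemma block_emb_heckeY a (x : hecke (part mu a)) : emb a x \in @heckeY_pred B u v d n mu.
Proof.
elim/hecke_ind: x => [|x x' ex ex'|c x ex|i x ex].
- by rewrite rmorph1 rpred1.
- by rewrite rmorphD rpredD.
- by rewrite block_embZ rpredZ.
- rewrite rmorphM /= rpredM // block_embT; apply/heckeY_predP/in_heckeY_gen.
  by rewrite young_simple block_gen_lo block_gen_hi !block_block_inj.
Qed.

Lemma bstdM a w w' : w \in young mu -> w' \in young mu ->
  bstd a (w * w')%g = (bstd a w * bstd a w')%g.
Proof. by move=> h h'; apply: stdM; [exact: block_inj_incr | exact: young_stable..]. Qed.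

Lemma bstd1 a : bstd a 1%g = 1%g.
Proof. by apply: std1; exact: block_inj_incr. Qed.

(** By induction on the length: a left descent of a Young permutation lies inside one block, it is a
    descent of the component on this block, and it does not affect the other components. *)
Lemma heckeTw_young w : w \in young mu -> Tw w = \prod_a emb a (Tw (bstd a w)).
Proof.
move eqm : (inv_number w) => m; elim: m w eqm => [|m IH] w wm wy.
  rewrite (inv_number_eq0 wm) heckeTw1 big1 // => a _.
  by rewrite bstd1 heckeTw1 rmorph1.
have [|i di] := @exists_ldescent _ w; first by apply: contra_eq_neq wm => ->; rewrite inv_number1.
have e := young_ldescent wy di.
have sy : simple_perm i \in young mu by rewrite young_simple e.
have w'y : (w * simple_perm i)%g \in young mu by exact: youngM.
have nd : ~~ ldescent i (w * simple_perm i)%g by rewrite ldescentM di.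
have -> : Tw w = u^-1 *: heckeT u v i * Tw (w * simple_perm i)%g.
  by rewrite -hecke_scalerAl heckeTw_up // scalerA mulVr // scale1r simple_permKg.
have lw' := inv_number_down di.
rewrite (IH (w * simple_perm i)%g) //; last by lia.
have [k ki] := block_genP e.
have eT : heckeT u v i = emb _ (heckeT u v k) by rewrite block_embT ki.
apply: (@prod_insert _ _ _ _ (block mu (ord_lo i))) => [b ba||b ba].
- by rewrite eT -block_embZ block_emb_comm // eq_sym.
- rewrite eT -block_embZ -rmorphM; congr (emb _ _).
  have klo : block_inj (ord_lo k) = ord_lo i by rewrite -block_gen_lo ki.
  have khi : block_inj (ord_hi k) = ord_hi i by rewrite -block_gen_hi ki.
  rewrite -hecke_scalerAl heckeTw_up //; last first.
    by rewrite (ldescent_std (@block_inj_incr _ _ _ _) klo khi) //; exact: young_stable.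
  rewrite scalerA mulVr // scale1r -(std_simple_in (@block_inj_incr _ _ _ _) klo khi).
  by rewrite -bstdM // simple_permKg.
- congr (emb _ (Tw _)); rewrite bstdM //.
  by rewrite (std_simple_out (@block_inj_incr _ _ _ _) (simple_outside e ba)) mulg1.
Qed.

Lemma heckeTw_heckeY w : w \in young mu -> Tw w \in @heckeY_pred B u v d n mu.
Proof.
by move=> /heckeTw_young ->; apply: rpred_prod => a _; exact: block_emb_heckeY.
Qed.

Lemma join_blocks (s : forall a, 'S_(part mu a)) :
  exists2 w : 'S_n, w \in young mu & forall a, bstd a w = s a.
Proof.
have h x : exists y : 'I_n, [exists k : 'I_(part mu (block mu x)),
    (block_inj k == x) && (y == block_inj (s _ k))].
  have [k kx] := block_inj_surj (erefl (block mu x)).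
  by exists (block_inj (s _ k)); apply/existsP; exists k; rewrite kx !eqxx.
pose g x := xchoose (h x).
have gE a (k : 'I_(part mu a)) : g (block_inj k) = block_inj (s a k).
  have /existsP[k' /andP[/eqP ek /eqP gk]] := xchooseP (h (block_inj k)).
  rewrite -/(g _) in gk; rewrite gk; move: k' ek {gk}; rewrite block_block_inj => k' ek.
  by congr (block_inj (s _ _)); exact: (incr_inj (@block_inj_incr _ _ _ _) ek).
have gB x : block mu (g x) = block mu x.
  by have [k <-] := block_inj_surj (erefl (block mu x)); rewrite gE !block_block_inj.
have g_inj : injective g.
  move=> x y gxy; have bxy : block mu x = block mu y by rewrite -gB gxy gB.
  have [k kx] := block_inj_surj bxy; have [l ly] := block_inj_surj (erefl (block mu y)).
  move: gxy {bxy}; move: (block mu y) k kx l ly => a k <- l <-.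
  by rewrite !gE => /(incr_inj (@block_inj_incr _ _ _ _))/perm_inj ->.
exists (perm g_inj); first by apply/youngP => x; rewrite permE.
by move=> a; apply: (std_uniq (@block_inj_incr _ _ _ _)) => k; rewrite permE gE.
Qed.

Let tauP := hecke_tauP u_unit v_unit.

Lemma tau_scalar m : scalar (@hecke_tau B u v m).
Proof. exact: hecke_markov_linear tauP m. Qed.

(** Defined through the coordinates on the [Tw w], since an element has many expressions as a
    product of images of the tensor factors and a value could not be read from any one of them
    without a choice. *)
Definition young_functional (x : hecke n) : B :=
  \sum_(w in young mu) hecke_coef w x * \prod_a tau (Tw (bstd a w)).

Lemma young_functional_scalar : scalar young_functional.
Proof.
move=> c x y; rewrite /young_functional mulr_sumr -big_split; apply: eq_bigr => w _ /=.
by rewrite (hecke_coef_scalar u_unit) mulrDl mulrA.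
Qed.

Lemma young_functional_Tw w : w \in young mu ->
  young_functional (Tw w) = \prod_a tau (Tw (bstd a w)).
Proof.
move=> wy; rewrite /young_functional (bigD1 w) //= hecke_coef_basis // eqxx mul1r.
by rewrite [X in _ + X]big1 ?addr0 // => w' /andP[_ ne]; rewrite hecke_coef_basis // (negPf ne) mul0r.
Qed.

Lemma prod_block_emb_dfwith (x : forall a, hecke (part mu a)) a (y : hecke (part mu a)) :
  \prod_b emb b (dfwith x y b) = emb a y * \prod_b emb b (dfwith x (1 : hecke (part mu a)) b).
Proof.
apply/esym/(@prod_insert _ _ _ _ a) => [b ba||b ba].
- by rewrite block_emb_comm // eq_sym.
- by rewrite !dfwith_in rmorph1 mulr1.
- by rewrite !dfwith_out // eq_sym.
Qed.

Lemma prod_tau_dfwith (x : forall a, hecke (part mu a)) a (y : hecke (part mu a)) :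
  \prod_b tau (dfwith x y b) = tau y * \prod_(b | b != a) tau (x b).
Proof.
rewrite (bigD1 a) //= dfwith_in; congr (_ * _); apply: eq_bigr => b ba.
by rewrite dfwith_out // eq_sym.
Qed.

Lemma young_functional_tensor (x : forall a, hecke (part mu a)) :
  young_functional (\prod_a emb a (x a)) = \prod_a tau (x a).
Proof.
(* Multilinear extension one factor at a time: [l] lists the blocks where the factor is arbitrary;
   elsewhere it is a basis element. For empty [l] the factors come from a single Young
   permutation. *)
suff h (l : seq 'I_d) : forall x : forall a, hecke (part mu a),
    (forall a, a \notin l -> exists w : 'S_(part mu a), x a = Tw w) ->
    young_functional (\prod_a emb a (x a)) = \prod_a tau (x a).
  by apply: (h (enum 'I_d)) => a; rewrite mem_enum.
elim: l => [|a l IH] {}x xb.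
  pose s a : 'S_(part mu a) := odflt 1%g [pick w : 'S_(part mu a) | x a == Tw w].
  have sE a : x a = Tw (s a).
    rewrite /s; case: pickP => [w /eqP //|/= h].
    by have [w e] := xb a isT; have := h w; rewrite e eqxx.
  have [w wy ws] := join_blocks s.
  under eq_bigr do rewrite sE -ws.
  by rewrite -heckeTw_young // young_functional_Tw //; apply: eq_bigr => b _; rewrite sE ws.
have ext : forall b, x b = dfwith x (x a) b.
  move=> b; case: (eqVneq a b) => [<-|ne]; first by rewrite dfwith_in.
  by rewrite dfwith_out.
under eq_bigr do rewrite ext; under [RHS]eq_bigr do rewrite ext.
apply: (hecke_basis_ind u_unit (P := fun y =>
   young_functional (\prod_b emb b (dfwith x y b)) = \prod_b tau (dfwith x y b))).
- move=> y y'; rewrite (prod_block_emb_dfwith x y) (prod_block_emb_dfwith x y').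
  rewrite (prod_block_emb_dfwith x (y + y')) !prod_tau_dfwith => ey ey'.
  rewrite rmorphD mulrDl -[X in X + _]scale1r young_functional_scalar mul1r ey ey'.
  by rewrite -mulrDl -[y in RHS]scale1r tau_scalar mul1r.
- move=> c y; rewrite (prod_block_emb_dfwith x y) (prod_block_emb_dfwith x (c *: y)).
  rewrite !prod_tau_dfwith => ey.
  have y0 : young_functional 0 = 0.
    by rewrite /young_functional big1 // => w _; rewrite -[0](subrr 1) -scaleN1r addrC
       (hecke_coef_scalar u_unit) mulN1r addNr mul0r.
  rewrite block_embZ -hecke_scalerAl -[_ *: _]addr0 young_functional_scalar y0 addr0 ey.
  rewrite mulrA; congr (_ * _).
  have t0 : tau (0 : hecke (part mu a)) = 0.
    by rewrite -[0](subrr 1) -scaleN1r addrC tau_scalar mulN1r addNr.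
  by rewrite -[c *: y]addr0 tau_scalar t0 addr0.
- move=> w; apply: IH => b bl; case: (eqVneq a b) => [<-|ne].
    by rewrite dfwith_in; exists w.
  by rewrite dfwith_out //; apply: xb; rewrite inE negb_or eq_sym ne.
Qed.

Lemma tau_tensorP : is_tau_tensor (@tau_tensor B u v d n mu).
Proof.
apply: theP; exists (fun z => young_functional (val z)); split.
  by move=> c x y; rewrite -young_functional_scalar.
by move=> x z ->; exact: young_functional_tensor.
Qed.

Lemma tau_tensor_Tw w (z : heckeY u v mu) : w \in young mu -> val z = Tw w ->
  tau_tensor z = \prod_a tau (Tw (bstd a w)).
Proof. by move=> wy zw; apply: (tau_tensorP).2; rewrite zw heckeTw_young. Qed.

End TensorTrace.

Lemma incr_of_adjacent m n (f : 'I_m -> 'I_n) :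
  (forall k : 'I_m.-1, (f (ord_lo k) < f (ord_hi k))%N) ->
  forall x y : 'I_m, (x < y)%N -> (f x < f y)%N.
Proof.
move=> h x y xy; move eqt : (y - x.+1)%N => t; elim: t y xy eqt => [|t IH] y xy e.
  have km : (x < m.-1)%N by have := ltn_ord y; lia.
  have := h (Ordinal km).
  have -> : ord_lo (Ordinal km) = x by exact: val_inj.
  by have -> : ord_hi (Ordinal km) = y by apply: val_inj => /=; lia.
have km : (y.-1 < m.-1)%N by have := ltn_ord y; lia.
have ey : ord_hi (Ordinal km) = y by apply: val_inj => /=; lia.
rewrite -ey; apply: ltn_trans (h (Ordinal km)); apply: IH => /=; lia.
Qed.

(** * Minimal coset representatives and characters of a given composition *)

Section MinimalRepresentatives.
Variables (d n : nat) (mu : Comp d n).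
Implicit Types (w p : 'S_n) (a : 'I_d).
Local Open Scope group_scope.

Definition block_increasing p :=
  forall a (k l : 'I_(part mu a)), (k < l)%N -> (p (block_inj k) < p (block_inj l))%N.

Lemma min_repsP p :
  reflect (forall w, w \in young mu -> (inv_number p <= inv_number (w * p))%N) (p \in min_reps mu).
Proof.
rewrite inE; apply: (iffP forall_inP) => h w /h; by rewrite !perm_lengthE.
Qed.

(** A descent at two neighbours of a block could be undone by a reflection of the Young subgroup,
    giving a shorter element of the same coset. *)
Lemma min_reps_increasing p : p \in min_reps mu -> block_increasing p.
Proof.
move=> /min_repsP h a; apply: (@incr_of_adjacent _ _ (fun k => p (block_inj k))) => k.
rewrite -block_gen_lo -block_gen_hi.
have sy : simple_perm (block_gen k) \in young mu.
  by rewrite young_simple block_gen_lo block_gen_hi !block_block_inj.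
have := h _ sy; case: (boolP (rdescent (block_gen k) p)) => [/inv_number_rdown|]; first lia.
rewrite /rdescent -leqNgt leq_eqVlt => /orP[/eqP/val_inj/perm_inj e|//].
by have := ord_lo_neq_hi (block_gen k); rewrite e eqxx.
Qed.

(** On each block [w] induces an increasing permutation, hence the identity. So a coset has a single
    block-increasing element, which is its minimal one. *)
Lemma increasing_unique p w : block_increasing p -> w \in young mu ->
  block_increasing (w * p) -> w = 1.
Proof.
move=> pi wy wpi; apply/permP => x; rewrite perm1.
have [k <-] := block_inj_surj (erefl (block mu x)).
rewrite -(stdE (@block_inj_incr _ _ _ _)); last exact: young_stable.
have -> : std (@block_inj _ _ mu (block mu x)) w = 1; last by rewrite perm1.
apply: incr_perm_id => y z /wpi; rewrite !permM.
have sw k' := stdE (@block_inj_incr _ _ mu (block mu x)) k' (young_stable wy).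
by rewrite -!sw => lt; rewrite -(@incr_ltE _ _ (fun k => p (block_inj k)) (@pi _)).
Qed.

Lemma coset_min p : exists2 w, w \in young mu & w * p \in min_reps mu.
Proof.
have [w wy wmin] := arg_minnP (fun w => inv_number (w * p)) (young1 mu).
exists w => //; apply/min_repsP => w' w'y; rewrite mulgA; apply: wmin.
exact: youngM.
Qed.

Lemma increasing_min_reps p : block_increasing p -> p \in min_reps mu.
Proof.
move=> pi; have [w wy wp] := coset_min p.
by move: (wp); rewrite (increasing_unique pi wy (min_reps_increasing wp)) mul1g.
Qed.

Lemma id_min_reps : 1 \in min_reps mu.
Proof. by apply: increasing_min_reps => a k l; rewrite !perm1; exact: block_inj_incr. Qed.

Lemma card_young : #|young mu| = (\prod_(a < d) (part mu a)`!)%N.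
Proof.
transitivity #|{dffun forall a : 'I_d, 'S_(part mu a)}|.
  pose F w : {dffun forall a : 'I_d, 'S_(part mu a)} :=
    [ffun a => std (@block_inj _ _ mu a) w].
  rewrite -(card_in_imset (f := F)); last first.
    move=> w w' wy w'y /ffunP e; apply/permP => x.
    have [k <-] := block_inj_surj (erefl (block mu x)).
    have := e (block mu x); rewrite !ffunE => {}e.
    by rewrite -!(stdE (@block_inj_incr _ _ _ _)) ?e //; exact: young_stable.
  apply: eq_card => s; rewrite [RHS]inE; apply/imsetP.
  have [w wy ws] := join_blocks s; exists w => //.
  by apply/ffunP => a; rewrite ffunE ws.
rewrite card_dep_ffun foldrE big_map big_enum; apply: eq_bigr => a _.
by rewrite -[RHS]card_Sn.
Qed.

(** Every permutation is uniquely a Young permutation times a minimal representative. The count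
    ensures that [coset_rep], indexed below [mult_coef mu], lists all representatives and never
    reaches the default of [nth]. *)
Lemma card_min_reps : #|min_reps mu| = mult_coef mu.
Proof.
have prod_gt0 : (0 < \prod_(a < d) (part mu a)`!)%N.
  by rewrite prodn_gt0 // => a; exact: fact_gt0.
rewrite /mult_coef -card_Sn -card_young in prod_gt0 *.
suff -> : #|{: 'S_n}| = (#|min_reps mu| * #|young mu|)%N by rewrite mulnK.
rewrite mulnC -cardsX -cardsT.
rewrite -(card_in_imset (f := fun q : 'S_n * 'S_n => q.1 * q.2) (D := mem (setX (young mu) (min_reps mu)))).
  apply: eq_card => p; rewrite inE; apply/esym/imsetP.
  have [w wy wp] := coset_min p; exists (w^-1, w * p); last by rewrite /= mulKg.
  by rewrite in_setX /= wp youngV.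
move=> [w p] [w' p']; rewrite !in_setX /= => /andP[wy pm] /andP[w'y p'm] e.
have ww : w'^-1 * w = 1.
  apply: (increasing_unique (p := p)); [exact: min_reps_increasing | |].
    by apply: youngM => //; exact: youngV.
  by rewrite -mulgA e mulKg; exact: min_reps_increasing.
have {}ww : w = w' by apply/eqP; rewrite eq_mulgV1 -(inj_eq (mulgI w'^-1)) mulgA ww mul1g mulg1.
by move: e; rewrite ww => /mulgI ->.
Qed.

Lemma coset_rep_enum (s := 1 :: enum (min_reps mu :\ 1)) :
  [/\ uniq s, size s = mult_coef mu & forall p, (p \in s) = (p \in min_reps mu)].
Proof.
split; first by rewrite /= enum_uniq mem_enum !inE eqxx.
- by rewrite /= -cardE -card_min_reps [RHS](cardsD1 1) id_min_reps.
- by move=> p; rewrite inE mem_enum in_setD1; case: eqP => [->|_] //=; rewrite id_min_reps.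
Qed.

Lemma coset_rep_min (k : 'I_(mult_coef mu)) : coset_rep k \in min_reps mu.
Proof.
have [_ sz me] := coset_rep_enum.
by rewrite -me /coset_rep mem_nth // sz.
Qed.

Lemma coset_rep_increasing (k : 'I_(mult_coef mu)) : block_increasing (coset_rep k).
Proof. exact/min_reps_increasing/coset_rep_min. Qed.

Lemma coset_rep_inj : injective (@coset_rep d n mu).
Proof.
have [us sz _] := coset_rep_enum => k l /eqP.
by rewrite /coset_rep nth_uniq ?sz // => /eqP/val_inj.
Qed.

Lemma coset_rep_surj p : p \in min_reps mu -> exists k : 'I_(mult_coef mu), coset_rep k = p.
Proof.
have [us sz me] := coset_rep_enum; rewrite -me => ps.
have i_lt : (index p (1%g :: enum (min_reps mu :\ 1%g)) < mult_coef mu)%N by rewrite -sz index_mem.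
by exists (Ordinal i_lt); rewrite /coset_rep nth_index.
Qed.

Local Notation chi0 := [ffun i => block mu i].

Lemma perm_char_young w : (perm_char w chi0 == chi0) = (w \in young mu).
Proof.
apply/eqP/idP => [/ffunP e|/youngV/youngP h].
  by rewrite -(invgK w); apply/youngV/youngP => x; have := e x; rewrite !ffunE.
by apply/ffunP => x; rewrite !ffunE h.
Qed.

Lemma chi_mu_inj : injective (@chi_mu d n mu).
Proof.
move=> k l e; apply: coset_rep_inj.
have wy : coset_rep l * (coset_rep k)^-1 \in young mu.
  rewrite -perm_char_young perm_charM -[X in perm_char _ X]/(chi_mu l) -e.
  by rewrite /chi_mu perm_charK.
have := increasing_unique (coset_rep_increasing k) wy.
rewrite mulgKV => /(_ (coset_rep_increasing l)) /eqP.
by rewrite -eq_mulgV1 => /eqP.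
Qed.

Lemma card_color_perm (w : 'S_n) (chi : {ffun 'I_n -> 'I_d}) a :
  #|[set j | perm_char w chi j == a]| = #|[set j | chi j == a]|.
Proof.
rewrite -(card_imset [set j | chi j == a] (@perm_inj _ w)); apply: eq_card => j.
rewrite !inE ffunE; apply/idP/imsetP => [h|[k]].
  by exists (w^-1 j); rewrite ?inE ?permKV.
by rewrite inE => h ->; rewrite permK.
Qed.

Lemma has_comp_perm (w : 'S_n) (chi : {ffun 'I_n -> 'I_d}) :
  has_comp mu (perm_char w chi) = has_comp mu chi.
Proof. by apply: eq_forallb => a; rewrite card_color_perm. Qed.

Lemma has_comp_block : has_comp mu chi0.
Proof.
apply/forallP => a; rewrite -[X in _ == X]card_ord.
rewrite -(card_imset _ (incr_inj (@block_inj_incr _ _ mu a))); apply/eqP/eq_card => x.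
rewrite !inE ffunE; apply/eqP/imsetP => [/block_inj_surj [k <-]|[k _ ->]]; first by exists k.
exact: block_block_inj.
Qed.

Lemma chi_mu_comp (k : 'I_(mult_coef mu)) : has_comp mu (chi_mu k).
Proof. by rewrite /chi_mu has_comp_perm has_comp_block. Qed.

(** Equal colour counts make the two lists of colours permutations of one another, and the
    permutation may be replaced by the minimal one of its coset because the Young subgroup fixes the
    block colouring. *)
Lemma chi_mu_surj chi : has_comp mu chi -> exists k : 'I_(mult_coef mu), chi_mu k = chi.
Proof.
move=> hc; have /tuple_permP [p ep] : perm_eq [tuple chi i | i < n] [tuple chi0 i | i < n].
  have cnt (psi : {ffun 'I_n -> 'I_d}) a :
      count_mem a [tuple psi i | i < n] = #|[set j | psi j == a]|.
    rewrite /= count_map -sum1_count big_enum_cond -sum1dep_card.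
    by apply: eq_bigl => j.
  apply/allP => a _ /=; rewrite !cnt.
  by move/forallP/(_ a)/eqP: hc => ->; move/forallP/(_ a): has_comp_block; rewrite eq_sym.
have {}ep : chi = perm_char p^-1 chi0.
  apply/ffunP => i; rewrite ffunE invgK.
  have := congr1 (fun s => nth (chi i) s i) ep.
  by rewrite -!tnth_nth !tnth_mktuple => ->.
have [w wy wp] := coset_min p^-1; have [k ek] := coset_rep_surj wp.
exists k; rewrite /chi_mu ek perm_charM ep; congr perm_char.
by apply/eqP; rewrite perm_char_young.
Qed.

End MinimalRepresentatives.

(** * The candidate trace on the basis *)

(** Characterized rather than constructed: enumerations arise from coset representatives, by
    swapping two points of distinct colours, or by adding a last point, and all are compared through
    [tau_std_eq]. *)
Record class_enum (d n : nat) (chi : 'I_n -> 'I_d) (a : 'I_d) (m : nat) (f : 'I_m -> 'I_n) :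
    Prop := {
  ce_incr : forall x y : 'I_m, (x < y)%N -> (f x < f y)%N;
  ce_color : forall x, chi (f x) = a;
  ce_surj : forall y, chi y = a -> exists x, f x = y }.

Section ClassEnum.
Variables (d n : nat).
Implicit Types (chi : {ffun 'I_n -> 'I_d}) (mu : Comp d n).

Lemma perm_char_color chi (w : 'S_n) : perm_char w chi = chi <-> forall x, chi (w x) = chi x.
Proof.
split=> [/ffunP e x|h]; first by rewrite -{1}e ffunE permK.
by apply/ffunP => x; rewrite ffunE -{2}(permKV w x) h.
Qed.

Lemma class_enum_stable chi a m (f : 'I_m -> 'I_n) (w : 'S_n) :
  class_enum chi a f -> perm_char w chi = chi -> stable f w.
Proof.
by move=> ce /perm_char_color h x; apply: (ce_surj ce); rewrite h (ce_color ce).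
Qed.

Lemma has_comp_unique mu mu' chi : has_comp mu chi -> has_comp mu' chi -> mu = mu'.
Proof.
move=> /forallP h /forallP h'; apply/val_inj/ffunP => a; apply/val_inj.
exact: etrans (esym (eqP (h a))) (eqP (h' a)).
Qed.

Definition color_count chi : {ffun 'I_d -> 'I_n.+1} :=
  [ffun a => inord #|[set j | chi j == a]|].

Lemma color_countE chi a : color_count chi a = #|[set j | chi j == a]| :> nat.
Proof.
by rewrite ffunE inordK // ltnS -[X in (_ <= X)%N]card_ord max_card.
Qed.

Lemma sum_color_count chi : (\sum_(a < d) color_count chi a == n)%N.
Proof.
under eq_bigr do rewrite color_countE -sum1dep_card.
rewrite -[X in _ == X]card_ord -sum1_card; apply/eqP/esym.
by rewrite (partition_big chi xpredT).
Qed.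

Definition comp_of chi : Comp d n := exist _ (color_count chi) (sum_color_count chi).

Lemma comp_ofP chi : has_comp (comp_of chi) chi.
Proof. by apply/forallP => a; rewrite /part /= color_countE. Qed.

(** The minimality of the representatives is what makes these enumerations increasing. *)
Lemma coset_rep_class_enum mu (k : 'I_(mult_coef mu)) a :
  class_enum (chi_mu k) a (fun x => coset_rep k (@block_inj _ _ mu a x)).
Proof.
split=> [x y|x|y].
- exact: coset_rep_increasing.
- by rewrite !ffunE permK block_block_inj.
- rewrite !ffunE => /block_inj_surj [x e]; exists x.
  by rewrite e permKV.
Qed.

End ClassEnum.

Definition color_support d n (chi : {ffun 'I_n.+1 -> 'I_d}) : Comp0 d := comp_supp (comp_of chi).

Lemma color_supportE d n (chi : {ffun 'I_n.+1 -> 'I_d}) a :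
  sval (color_support chi) a = [exists j, chi j == a].
Proof.
rewrite ffunE /part /= color_countE card_gt0; apply/set0Pn/existsP => -[j].
  by rewrite inE; exists j.
by exists j; rewrite inE.
Qed.

Lemma color_support_eq d n m (chi : {ffun 'I_n.+1 -> 'I_d}) (psi : {ffun 'I_m.+1 -> 'I_d}) :
  (forall a, [exists j, chi j == a] = [exists j, psi j == a]) ->
  color_support chi = color_support psi.
Proof. by move=> h; apply/val_inj/ffunP => a; rewrite !color_supportE h. Qed.

(** * Existence of the isomorphisms and the trace formula on basis elements *)

Section PsiExists.
Variables (B : comUnitRingType) (u v : B) (d : nat) (xi : 'I_d -> B).
Hypothesis H : root_system u xi.
Hypothesis v_unit : v \is a GRing.unit.
Let u_unit := rs_u_unit H.
Local Notation yh := (yh u v d).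
Local Notation E chi := (E_chi u v xi chi).
Local Notation gw := (@yh_gw B u v d _).
Local Notation Tw := (@heckeTw B u v _).
Local Notation tau := (@hecke_tau B u v _).

Section FixedComp.
Variables (n : nat) (mu : Comp d n).
Local Notation matY := 'M[heckeY u v mu]_(mult_coef mu).
Local Notation conj_rep k w j :=
  (perm_comp (perm_comp ((coset_rep (mu := mu) k)^-1)%g w) (coset_rep (mu := mu) j)).

Lemma conj_rep_young (k j : 'I_(mult_coef mu)) w :
  perm_char w (chi_mu j) = chi_mu k -> conj_rep k w j \in young mu.
Proof.
move=> e; rewrite -perm_char_young /perm_comp mulgA !perm_charM -/(chi_mu j) e.
by rewrite /chi_mu perm_charK.
Qed.

Lemma E_mu_basis chi w :
  E_mu u v xi mu * (E chi * gw w) = (has_comp mu chi)%:R *: (E chi * gw w).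
Proof.
rewrite mulrA /E_mu mulr_suml.
under eq_bigr do rewrite (E_orth v H).
case: (boolP (has_comp mu chi)) => hc.
  rewrite (bigD1 chi) //= eqxx big1 ?addr0 ?scale1r // => psi /andP[_ ne].
  by rewrite (negPf ne) scale0r.
rewrite big1 ?mul0r ?scale0r // => psi hp; case: eqP => [e|_]; last by rewrite scale0r.
by rewrite -e hp in hc.
Qed.

(** Defined on coordinates: entry (k, j) collects the w that send chi_j to chi_k. By
    [conj_rep_young] the elements passed to [insubd] do lie in the Young subalgebra, so they are not
    replaced by 0. *)
Definition Psi_model (y : EY u v xi mu) : matY :=
  \matrix_(k, j) \sum_(w : 'S_n | perm_char w (chi_mu j) == chi_mu k)
     word_coef xi (chi_mu k) w (val y) *: insubd (0 : heckeY u v mu) (Tw (conj_rep k w j)).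

Lemma Psi_modelP : is_Psi Psi_model.
Proof.
split=> [c x y i j|k j w e].
  rewrite !mxE scaler_sumr -big_split; apply: eq_bigr => w _ /=.
  by rewrite (word_coef_scalar H) scalerDl scalerA.
have hk := chi_mu_comp k.
apply/matrixP => k' j'; rewrite !mxE raddf_sum /= E_mu_basis hk scale1r.
under eq_bigr => w' _ do rewrite (word_coef_basis v H) ffunK (inj_eq (@chi_mu_inj _ _ _)).
case: (eqVneq k k') => [<-|ne]; last first.
  rewrite mulr0 big1 // => w' _; by rewrite scale0r.
case: (eqVneq j' j) => [->|nej].
  rewrite mulr1 (bigD1 w) ?e ?eqxx //= scale1r.
  rewrite insubdK; last by apply: (heckeTw_heckeY u_unit v_unit); exact: conj_rep_young.
  by rewrite big1 ?addr0 // => w' /andP[_ ne]; rewrite (negPf ne) scale0r.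
rewrite mulr0 big1 // => w' /eqP e'; case: eqP => [ww|_]; last by rewrite scale0r.
case/eqP: nej; apply: chi_mu_inj; apply: (can_inj (perm_charK w)).
by rewrite e -ww.
Qed.

Lemma PsiP : is_Psi (@Psi B u v d xi n mu).
Proof. by apply: theP; exists Psi_model; exact: Psi_modelP. Qed.

Lemma EY_mulD c (x y : yh n) : EY_mul xi mu (c *: x + y) = c *: EY_mul xi mu x + EY_mul xi mu y.
Proof. by apply: val_inj; rewrite /= mulrDr yh_scalerAr. Qed.

Definition Psi_trace (x : yh n) : heckeY u v mu := \tr (Psi (EY_mul xi mu x)).

Lemma Psi_traceD c x y : Psi_trace (c *: x + y) = c *: Psi_trace x + Psi_trace y.
Proof.
rewrite /Psi_trace /mxtrace scaler_sumr -big_split; apply: eq_bigr => i _ /=.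
by rewrite EY_mulD PsiP.1.
Qed.

Lemma Psi_trace_basis (k : 'I_(mult_coef mu)) w :
  val (Psi_trace (E (chi_mu k) * gw w)) =
  (perm_char w (chi_mu k) == chi_mu k)%:R *: Tw (conj_rep k w k).
Proof.
have [j ej] : exists j : 'I_(mult_coef mu), chi_mu j = perm_char w^-1%g (chi_mu k).
  by apply: chi_mu_surj; rewrite has_comp_perm chi_mu_comp.
have e : perm_char w (chi_mu j) = chi_mu k by rewrite ej perm_charVK.
have /matrixP M := PsiP.2 k j w e.
rewrite /Psi_trace /mxtrace raddf_sum /=.
under eq_bigr => i _ do [have := M i i; rewrite mxE => ->].
rewrite (bigD1 k) //= big1 ?addr0 => [|i ik]; last by rewrite !mxE (negPf ik) mulr0.
rewrite !mxE eqxx /=; case: (eqVneq k j) => [kj|ne].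
  by subst j; rewrite e eqxx mulr1 scale1r.
rewrite mulr0 (_ : (_ == _) = false) ?scale0r //; apply/eqP => ew.
by case/eqP: ne; apply: chi_mu_inj; apply: (can_inj (perm_charK w)); rewrite e ew.
Qed.

Lemma tau_std_eq m m' (f : 'I_m -> 'I_n) (f' : 'I_m' -> 'I_n) (chi : {ffun 'I_n -> 'I_d}) a w :
  class_enum chi a f -> class_enum chi a f' -> tau (Tw (std f w)) = tau (Tw (std f' w)).
Proof.
move=> cf cf'.
have [||e h] := @incr_enum_eq m m' n f f' (ce_incr cf) (ce_incr cf').
- by move=> x; apply: (ce_surj cf'); exact: ce_color cf x.
- by move=> x; apply: (ce_surj cf); exact: ce_color cf' x.
subst m'; congr (tau (Tw _)); rewrite /std; congr odflt; apply: eq_pick => p.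
by apply: eq_forallb => x; rewrite -!h !cast_ord_id.
Qed.

Lemma tau_tensor_scalar : scalar (@tau_tensor B u v d n mu).
Proof. exact: (tau_tensorP u_unit v_unit mu).1. Qed.

Lemma tau_tensor0 : tau_tensor (0 : heckeY u v mu) = 0.
Proof.
by have := tau_tensor_scalar (-1) 0 0; rewrite scaler0 addr0 mulN1r addNr.
Qed.

(** By [std_conj], the component on block [a] of [w] conjugated by a coset representative is the
    permutation [w] induces on class [a], enumerated through this representative. *)
Lemma tau_tensor_Psi_trace chi w (m : 'I_d -> nat) (f : forall a, 'I_(m a) -> 'I_n) :
  has_comp mu chi -> (forall a, class_enum chi a (f a)) ->
  tau_tensor (Psi_trace (E chi * gw w)) =
  (perm_char w chi == chi)%:R * \prod_a tau (Tw (std (f a) w)).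
Proof.
move=> /chi_mu_surj [k <-] ce.
have h := Psi_trace_basis k w.
case: eqP h => [e|_]; rewrite ?scale1r ?scale0r ?mul1r ?mul0r => h; last first.
  by rewrite (_ : Psi_trace _ = 0) ?tau_tensor0 //; apply: val_inj; rewrite h.
rewrite (tau_tensor_Tw u_unit v_unit _ h) ?conj_rep_young //.
apply: eq_bigr => a _; rewrite /perm_comp mulgA -std_conj.
exact: tau_std_eq (coset_rep_class_enum k a) (ce a).
Qed.

Lemma Psi_trace_other chi w : ~~ has_comp mu chi -> Psi_trace (E chi * gw w) = 0.
Proof.
move=> /negPf hc; have : EY_mul xi mu (E chi * gw w) = 0.
  by apply: val_inj; rewrite /= E_mu_basis hc scale0r.
have := Psi_traceD (-1) 0 0; rewrite scaler0 addr0 scaleN1r addNr /Psi_trace => z ->.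
rewrite -[RHS]z; congr (\tr (Psi _)).
by apply: val_inj; rewrite /= mulr0.
Qed.

End FixedComp.

Variable alpha : Comp0 d -> B.

Definition comp_trace n (x : yh n.+1) : B :=
  \sum_(mu : Comp d n.+1) rho_mu alpha (\tr (Psi (EY_mul xi mu x))).

Lemma comp_trace_scalar n : scalar (@comp_trace n).
Proof.
move=> c x y; rewrite /comp_trace mulr_sumr -big_split; apply: eq_bigr => mu _ /=.
rewrite /rho_mu -/(Psi_trace mu _) Psi_traceD tau_tensor_scalar mulrDr.
by rewrite mulrCA.
Qed.

Lemma comp_trace_basis n (chi : {ffun 'I_n.+1 -> 'I_d}) w
    (m : 'I_d -> nat) (f : forall a, 'I_(m a) -> 'I_n.+1) :
  (forall a, class_enum chi a (f a)) ->
  comp_trace (E chi * gw w) = (perm_char w chi == chi)%:R *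
    (alpha (color_support chi) * \prod_a tau (Tw (std (f a) w))).
Proof.
move=> ce; rewrite /comp_trace (bigD1 (comp_of chi)) //= big1 ?addr0 => [|mu ne].
  by rewrite /rho_mu (tau_tensor_Psi_trace w (comp_ofP chi) ce) mulrCA.
rewrite /rho_mu -/(Psi_trace mu _) Psi_trace_other ?tau_tensor0 ?mulr0 //.
apply: contra ne => hc; apply/eqP; exact: has_comp_unique hc (comp_ofP chi).
Qed.

End PsiExists.

(** * Passing from n to n + 1 points *)

Section PermLift.
Variable n : nat.
Implicit Types (w : 'S_n) (i : 'I_n.-1) (x y : 'I_n).
Local Open Scope group_scope.
Local Notation wid := (widen_ord (leqnSn n)).
Local Notation widg := (widen_ord (leq_pred n) : 'I_n.-1 -> 'I_n.+1.-1).

Definition perm_lift w : 'S_n.+1 := lift_perm ord_max ord_max w.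

Lemma lift_max_widen x : lift ord_max x = wid x.
Proof. by apply: val_inj; exact: lift_max. Qed.

Lemma perm_lift_widen w x : perm_lift w (wid x) = wid (w x).
Proof. by rewrite -!lift_max_widen lift_perm_lift. Qed.

Lemma perm_lift_max w : perm_lift w ord_max = ord_max.
Proof. exact: lift_perm_id. Qed.

Lemma widen_or_max (z : 'I_n.+1) : z = ord_max \/ exists x, z = wid x.
Proof.
case: (unliftP ord_max z) => [x ->|->]; last by left.
by right; exists x; rewrite lift_max_widen.
Qed.

Lemma wid_inj : injective wid.
Proof. by move=> x y /(congr1 val) /= /val_inj. Qed.

Lemma perm_lift_uniq w (p : 'S_n.+1) :
  p ord_max = ord_max -> (forall x, p (wid x) = wid (w x)) -> p = perm_lift w.
Proof.
move=> pm pw; apply/permP => z; case: (widen_or_max z) => [->|[x ->]].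
  by rewrite perm_lift_max.
by rewrite perm_lift_widen.
Qed.

Lemma perm_lift1 : perm_lift 1 = 1.
Proof. exact: lift_perm1. Qed.

Lemma perm_liftM w w' : perm_lift (w * w') = perm_lift w * perm_lift w'.
Proof. exact/esym/lift_permM. Qed.

Lemma perm_lift_exists (p : 'S_n.+1) : p ord_max = ord_max -> exists w, p = perm_lift w.
Proof.
move=> pm.
have h x : exists y, wid y == p (wid x).
  case: (widen_or_max (p (wid x))) => [e|[y ->]]; last by exists y.
  by move: e; rewrite -pm => /perm_inj/(congr1 val) /=; have := ltn_ord x; lia.
pose g x := xchoose (h x).
have gE x : wid (g x) = p (wid x) by exact/eqP/(xchooseP (h x)).
have g_inj : injective g by move=> x y /(congr1 wid); rewrite !gE => /perm_inj/wid_inj.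
by exists (perm g_inj); apply: perm_lift_uniq => // x; rewrite permE gE.
Qed.

Lemma widg_lo i : ord_lo (widg i) = wid (ord_lo i).
Proof. exact: val_inj. Qed.

Lemma widg_hi i : ord_hi (widg i) = wid (ord_hi i).
Proof. exact: val_inj. Qed.

Lemma simple_perm_widen i x : simple_perm (widg i) (wid x) = wid (simple_perm i x).
Proof. by apply: val_inj; rewrite /= !simple_permE. Qed.

Lemma perm_lift_simple i : simple_perm (widg i) = perm_lift (simple_perm i).
Proof.
apply: perm_lift_uniq => [|x]; last exact: simple_perm_widen.
by apply: val_inj; rewrite /= simple_permE /=; have := ltn_ord i; split_nat_ifs; lia.
Qed.

Lemma word_perm_lift (s : seq 'I_n.-1) : word_perm (map widg s) = perm_lift (word_perm s).
Proof.
elim: s => [|i s IH]; first by rewrite perm_lift1.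
by rewrite map_cons !word_perm_cons IH perm_liftM perm_lift_simple.
Qed.

Lemma inv_number_lift w : inv_number (perm_lift w) = inv_number w.
Proof.
have inj : injective (fun p : 'I_n * 'I_n => (wid p.1, wid p.2)).
  by case=> [a b] [c e] [/val_inj-> /val_inj->].
rewrite /inv_number -(card_imset (mem (inversions w)) inj).
apply: eq_card => -[z t]; rewrite !inE /=.
apply/andP/imsetP => [[zt tz]|[[a b]]]; last first.
  by rewrite inE /= => /andP[ab ba] [-> ->]; rewrite !perm_lift_widen.
case: (widen_or_max t) zt tz => [->|[y ->]].
  by rewrite perm_lift_max /= => _; have := ltn_ord (perm_lift w z); lia.
case: (widen_or_max z) => [->|[x ->]] /=; first by have := ltn_ord y; lia.
rewrite !perm_lift_widen => xy yx; exists (x, y) => //.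
by rewrite inE /= xy.
Qed.

Section WordLift.
Variables (A : pzRingType) (f : 'I_n.+1.-1 -> A).
Hypothesis f_comm : forall i j : 'I_n.+1.-1, (i.+1 < j)%N || (j.+1 < i)%N ->
  (f i * f j = f j * f i)%R.
Hypothesis f_braid : forall i j : 'I_n.+1.-1, i.+1 = j :> nat ->
  (f i * f j * f i = f j * f i * f j)%R.

Lemma Tword_lift w : Tword f (perm_lift w) = Tword (fun i => f (widg i)) w.
Proof.
rewrite -{1}(reduced_wordK w) -word_perm_lift TwordE //; first by rewrite big_map.
by rewrite size_map word_perm_lift inv_number_lift reduced_wordK -perm_lengthE.
Qed.

End WordLift.

End PermLift.

Section HeckeLift.
Variables (B : comUnitRingType) (u v : B).

Lemma hecke_emb_Tw n (w : 'S_n) :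
  hecke_emb (heckeTw u v w) = heckeTw u v (perm_lift w).
Proof.
rewrite !heckeTwE hecke_embZ inv_number_lift Tword_lift;
  [|exact: heckeT_comm|exact: heckeT_braid].
rewrite /Tword rmorph_prod; congr (_ *: _); apply: eq_bigr => i _; exact: hecke_embT.
Qed.

End HeckeLift.

Section YhEmb.
Variables (B : comUnitRingType) (u v : B) (d n : nat).
Local Notation yh := (yh u v d).
Local Notation g := (@yh_g B u v d _).
Local Notation t := (@yh_t B u v d _).
Local Notation wid := (widen_ord (leqnSn n)).
Local Notation widg := (widen_ord (leq_pred n) : 'I_n.-1 -> 'I_n.+1.-1).
Local Notation emb := (@yh_emb B u v d n).

Lemma yh_emb_spec :
  [/\ zmod_morphism emb, monoid_morphism emb,
      forall c (x : yh n), emb (c *: x) = c *: emb x &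
      (forall i, emb (g i) = g (widg i)) /\ (forall j, emb (t j) = t (wid j))].
Proof.
pose f (x : 'I_n.-1 + 'I_n) : yh n.+1 :=
  match x with inl i => g (widg i) | inr j => t (wid j) end.
have cstE c (y : yh n.+1) : pres_cst (@yh_rel B u v d n.+1) c * y = c *: y.
  by rewrite /pres_cst -[LHS]yh_scalerAl mul1r.
have [|i j ij|i j ij|i j|i j|j|i|zm mm sm gm] := @yh_lift_spec B u v d n (yh n.+1)
    (pres_cst (@yh_rel B u v d n.+1)) f.
- exact: pres_cstC.
- exact: yh_g_comm.
- exact: yh_g_braid.
- exact: yh_tt.
- by rewrite /f yh_gt simple_perm_widen.
- exact: yh_tpow.
- by rewrite /f yh_quad !cstE /yh_e widg_lo widg_hi.
by split=> // c x; rewrite -[RHS]cstE; exact: sm.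
Qed.

HB.instance Definition _ := GRing.isZmodMorphism.Build _ _ emb
  (let: And4 h _ _ _ := yh_emb_spec in h).
HB.instance Definition _ := GRing.isMonoidMorphism.Build _ _ emb
  (let: And4 _ h _ _ := yh_emb_spec in h).

Lemma yh_embZ c (x : yh n) : emb (c *: x) = c *: emb x.
Proof. by have [_ _ -> _] := yh_emb_spec. Qed.

Lemma yh_emb_g i : emb (g i) = g (widg i).
Proof. by have [_ _ _ [-> _]] := yh_emb_spec. Qed.

Lemma yh_emb_t j : emb (t j) = t (wid j).
Proof. by have [_ _ _ [_ ->]] := yh_emb_spec. Qed.

Variable xi : 'I_d -> B.
Hypothesis H : root_system u xi.
Let u_unit := rs_u_unit H.
Local Notation E chi := (E_chi u v xi chi).
Local Notation gw := (@yh_gw B u v d _).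

Lemma yh_emb_gw w : emb (gw w) = gw (perm_lift w).
Proof.
rewrite !gwE yh_embZ inv_number_lift Tword_lift; [|exact: yh_g_comm|exact: yh_g_braid].
rewrite /Tword rmorph_prod; congr (_ *: _); apply: eq_bigr => i _; exact: yh_emb_g.
Qed.

Definition restrict_char (psi : {ffun 'I_n.+1 -> 'I_d}) : {ffun 'I_n -> 'I_d} :=
  [ffun j => psi (wid j)].

Lemma yh_emb_E_one c j : emb (E_one u v xi c j) = E_one u v xi c (wid j).
Proof.
rewrite /E_one yh_embZ raddf_sum /=; congr (_ *: _); apply: eq_bigr => s _.
by rewrite yh_embZ rmorphXn /= yh_emb_t.
Qed.

Lemma yh_emb_E_eigen chi psi (y : yh n.+1) : eigen xi psi y ->
  emb (E chi) * y = (chi == restrict_char psi)%:R *: y.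
Proof.
move=> ey; rewrite -prod_delta E_chiE rmorph_prod.
elim/big_rec2: _ => [|j b p _ IH]; first by rewrite mul1r scale1r.
rewrite -mulrA IH -(yh_scalerAr b) /= yh_emb_E_one (E_one_eigen H _ _ ey) scalerA mulrC.
by rewrite ffunE.
Qed.

(** Multiplied by 1, the sum of all [E psi], the embedded idempotent keeps the characters that
    extend [chi], since it acts on each [E psi] through the restriction of [psi]. *)
Lemma yh_emb_E chi : emb (E chi) = \sum_(psi | restrict_char psi == chi) E psi.
Proof.
rewrite -[LHS]mulr1 -(sum_E v H) mulr_sumr [RHS]big_mkcond; apply: eq_bigr => psi _.
rewrite (yh_emb_E_eigen _ (eigen_E v H psi)) eq_sym.
by case: eqP => _; rewrite ?scale1r ?scale0r.
Qed.

Definition extend_char (chi : {ffun 'I_n -> 'I_d}) (c : 'I_d) : {ffun 'I_n.+1 -> 'I_d} :=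
  [ffun z => if unlift ord_max z is Some x then chi x else c].

Lemma extend_char_wid chi c x : extend_char chi c (wid x) = chi x.
Proof. by rewrite ffunE -lift_max_widen liftK. Qed.

Lemma extend_char_max chi c : extend_char chi c ord_max = c.
Proof. by rewrite ffunE unlift_none. Qed.

Lemma restrict_extend chi c : restrict_char (extend_char chi c) = chi.
Proof. by apply/ffunP => x; rewrite ffunE extend_char_wid. Qed.

Lemma extend_restrict psi : extend_char (restrict_char psi) (psi ord_max) = psi.
Proof.
apply/ffunP => z; case: (widen_or_max z) => [->|[x ->]]; first by rewrite extend_char_max.
by rewrite extend_char_wid ffunE.
Qed.

End YhEmb.

Section YhInverse.
Variables (B : comUnitRingType) (u v : B) (d : nat) (xi : 'I_d -> B).
Hypothesis H : root_system u xi.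
Let u_unit := rs_u_unit H.

Lemma yh_ring_inv_spec n (i : 'I_n.-1) (y := u^-2 *: (yh_g u v d i - v *: yh_e u v d i)) :
  yh_g u v d i * y = 1 /\ y * yh_g u v d i = 1.
Proof.
rewrite /y; split.
  rewrite -(yh_scalerAr (u ^- 2)) mulrBr yh_quad -(yh_scalerAr v) (e_g_comm v H) addrK scalerA.
  by rewrite mulVr ?scale1r // unitrX.
rewrite -(yh_scalerAl (u ^- 2)) mulrBl yh_quad -(yh_scalerAl v) addrK scalerA.
by rewrite mulVr ?scale1r // unitrX.
Qed.

Lemma yh_g_inv n (i : 'I_n.-1) :
  yh_g u v d i * ring_inv (yh_g u v d i) = 1 /\ ring_inv (yh_g u v d i) * yh_g u v d i = 1.
Proof.
have [gy yg] := yh_ring_inv_spec i; set y := _ *: _ in gy yg.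
have : exists y', yh_g u v d i * y' = 1 /\ y' * yh_g u v d i = 1 by exists y.
by move=> /(theP 0).
Qed.

Lemma yh_ring_inv n (i : 'I_n.-1) :
  ring_inv (yh_g u v d i) = u^-2 *: (yh_g u v d i - v *: yh_e u v d i).
Proof.
have [_ h] := yh_g_inv i; have [gy _] := yh_ring_inv_spec i.
by rewrite -[LHS]mulr1 -gy mulrA h mul1r.
Qed.

End YhInverse.

Section HeckeTau.
Variables (B : comUnitRingType) (u v : B).
Hypothesis u_unit : u \is a GRing.unit.
Hypothesis v_unit : v \is a GRing.unit.
Local Notation tau := (@hecke_tau B u v _).
Local Notation Tw := (@heckeTw B u v _).
Let tauP := hecke_tauP u_unit v_unit.

Lemma tau_mulC m (x y : hecke u v m) : tau (x * y) = tau (y * x).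
Proof.
case: m x y => [|m] x y; first by rewrite hecke_small_comm.
exact: hecke_markov_trace tauP _ _ _.
Qed.

Lemma tau0 m : tau (0 : hecke u v m) = 0.
Proof.
have := hecke_markov_linear tauP (-1) (0 : hecke u v m) 0.
by rewrite scaler0 addr0 mulN1r addNr.
Qed.

Lemma tauZ m c (x : hecke u v m) : tau (c *: x) = c * tau x.
Proof. by rewrite -[c *: x]addr0 (hecke_markov_linear tauP) tau0 addr0. Qed.

Lemma tauD m (x y : hecke u v m) : tau (x + y) = tau x + tau y.
Proof. by rewrite -{1}[x]scale1r (hecke_markov_linear tauP) mul1r. Qed.

(** [hecke_tau] is known only through its specification; the conditions on T and T^-1 together
    determine this value. *)
Lemma tau_emb m (x : hecke u v m.+1) : tau (hecke_emb x) = markov_z u v * tau x.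
Proof.
have := hecke_markov_neg tauP x; rewrite (heckeT_ring_inv v u_unit).
rewrite -hecke_scalerAr mulrBr -hecke_scalerAr mulr1 tauZ tauD -scaleNr tauZ.
rewrite (hecke_markov_pos tauP) => /(congr1 (fun c => u ^+ 2 * c)).
rewrite mulVKr ?unitrX // => e.
have {}e : v * tau (hecke_emb x) = (1 - u ^+ 2) * tau x.
  by rewrite mulrBl mul1r -e mulNr opprD opprK addrA subrr add0r.
by rewrite /markov_z -mulrA -e mulKr.
Qed.

Lemma tau_T_commute m (k : 'I_m.-1) (s : 'S_m) :
  u * tau (Tw (s * simple_perm k)%g) + (v *+ ldescent k s) * tau (Tw s) =
  u * tau (Tw (simple_perm k * s)%g) + (v *+ rdescent k s) * tau (Tw s).
Proof.
rewrite -!tauZ -!tauD -(heckeT_Tw v u_unit) -(hecke_Tw_T v u_unit).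
exact: tau_mulC.
Qed.

End HeckeTau.

(** * The candidate is a trace *)

Section CompTraceMarkov.
Variables (B : comUnitRingType) (u v : B) (d : nat) (xi : 'I_d -> B).
Hypothesis H : root_system u xi.
Hypothesis v_unit : v \is a GRing.unit.
Variable alpha : Comp0 d -> B.
Let u_unit := rs_u_unit H.
Local Notation yh := (yh u v d).
Local Notation E chi := (E_chi u v xi chi).
Local Notation gw := (@yh_gw B u v d _).
Local Notation g := (@yh_g B u v d _).
Local Notation e := (@yh_e B u v d _).
Local Notation t := (@yh_t B u v d _).
Local Notation Tw := (@heckeTw B u v _).
Local Notation tau := (@hecke_tau B u v _).
Local Notation F := (@comp_trace B u v d xi alpha _).
Local Notation s_ i := (simple_perm i).

Lemma class_enum_exists n (chi : {ffun 'I_n -> 'I_d}) :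
  exists (m : 'I_d -> nat) (f : forall a, 'I_(m a) -> 'I_n), forall a, class_enum chi a (f a).
Proof.
have [k <-] := chi_mu_surj (comp_ofP chi).
exists (part (comp_of chi)), (fun a x => coset_rep k (block_inj x)).
exact: coset_rep_class_enum.
Qed.

Lemma comp_traceZ n c (x : yh n.+1) : F (c *: x) = c * F x.
Proof.
have F0 : F (0 : yh n.+1) = 0.
  by have := comp_trace_scalar H v_unit alpha (-1) (0 : yh n.+1) 0;
    rewrite scaler0 addr0 mulN1r addNr.
by rewrite -[c *: x]addr0 (comp_trace_scalar H v_unit) F0 addr0.
Qed.

Lemma comp_traceD n (x y : yh n.+1) : F (x + y) = F x + F y.
Proof. by rewrite -{1}[x]scale1r (comp_trace_scalar H v_unit) mul1r. Qed.

Lemma comp_trace0 n : F (0 : yh n.+1) = 0.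
Proof. by rewrite -[0](scale0r 0) comp_traceZ mul0r. Qed.

Lemma comp_trace_sum n (I : finType) (P : pred I) (x : I -> yh n.+1) :
  F (\sum_(i | P i) x i) = \sum_(i | P i) F (x i).
Proof. exact: (big_morph _ (@comp_traceD n) (comp_trace0 n)). Qed.

Lemma comp_trace_moved n (chi : {ffun 'I_n.+1 -> 'I_d}) w :
  perm_char w chi != chi -> F (E chi * gw w) = 0.
Proof.
move=> /negPf ne; have [m [f ce]] := class_enum_exists chi.
by rewrite (comp_trace_basis H v_unit _ _ ce) ne mul0r.
Qed.

Lemma comp_trace_fixed n (chi : {ffun 'I_n.+1 -> 'I_d}) w
    (m : 'I_d -> nat) (f : forall a, 'I_(m a) -> 'I_n.+1) :
  (forall a, class_enum chi a (f a)) -> perm_char w chi = chi ->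
  F (E chi * gw w) = alpha (color_support chi) * \prod_a tau (Tw (std (f a) w)).
Proof. by move=> ce we; rewrite (comp_trace_basis H v_unit _ w ce) we eqxx mul1r. Qed.

Lemma E_gw_t n (chi : {ffun 'I_n -> 'I_d}) w j : E chi * gw w * t j = xi (chi (w j)) *: (E chi * gw w).
Proof. by rewrite -mulrA gw_t mulrA (E_t v H) -yh_scalerAl. Qed.

Lemma E_gw_e n (chi : {ffun 'I_n -> 'I_d}) w i : E chi * gw w * e i =
  (chi (w (ord_lo i)) == chi (w (ord_hi i)))%:R *: (E chi * gw w).
Proof.
rewrite -{1}(perm_charVK w chi) (E_gw v H) -mulrA (E_e v H) -yh_scalerAr -(E_gw v H).
by rewrite perm_charVK !ffunE !invgK.
Qed.

Lemma E_gw_g n (chi : {ffun 'I_n -> 'I_d}) w i :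
  E chi * gw w * g i = u *: (E chi * gw (s_ i * w)%g) +
    (v *+ rdescent i w * (chi (w (ord_lo i)) == chi (w (ord_hi i)))%:R) *: (E chi * gw w).
Proof.
rewrite -mulrA (gw_g v H) mulrDr -(yh_scalerAr u) -(yh_scalerAr (v *+ _)).
by rewrite mulrA E_gw_e scalerA.
Qed.

Lemma g_E_gw n (chi : {ffun 'I_n -> 'I_d}) w i :
  g i * (E chi * gw w) = u *: (E (perm_char (s_ i) chi) * gw (w * s_ i)%g) +
    (v *+ ldescent i w * (chi (ord_hi i) == chi (ord_lo i))%:R) *:
      (E (perm_char (s_ i) chi) * gw w).
Proof.
rewrite mulrA (g_E v H) -mulrA (g_gw v H) mulrDr -(yh_scalerAr u) -(yh_scalerAr (v *+ _)).
rewrite (mulrA _ (e i)) (E_e v H) -(yh_scalerAl _%:R) scalerA !ffunE simple_permV.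
by rewrite simple_perm_lo simple_perm_hi.
Qed.

Lemma comp_trace_t n (x : yh n.+1) j : F (x * t j) = F (t j * x).
Proof.
move: x; apply: (yh_basis_ind H) => [x y ex ey|c x ex|chi w].
- by rewrite mulrDl mulrDr !comp_traceD ex ey.
- by rewrite -yh_scalerAl -yh_scalerAr !comp_traceZ ex.
rewrite E_gw_t mulrA (eigen_E v H) -yh_scalerAl !comp_traceZ.
case: (eqVneq (perm_char w chi) chi) => [/perm_char_color -> //|ne].
by rewrite comp_trace_moved // !mulr0.
Qed.

(** Applying [s_i] only reverses the order of i and i+1, and these two never belong to the same
    class. *)
Lemma swap_class_enum n (chi : {ffun 'I_n -> 'I_d}) (i : 'I_n.-1) a m (f : 'I_m -> 'I_n) :
  chi (ord_lo i) != chi (ord_hi i) -> class_enum chi a f ->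
  class_enum (perm_char (s_ i) chi) a (fun x => s_ i (f x)).
Proof.
move=> ne ce; split=> [x y xy|x|y].
- have fxy := ce_incr ce xy; have := ce_color ce x; have := ce_color ce y.
  have : ~ (f x = ord_lo i /\ f y = ord_hi i).
    by case=> ex ey; move: ne; rewrite -ex -ey !(ce_color ce) eqxx.
  move=> nxy _ _; rewrite !simple_permE.
  have : ~ (f x = i :> nat /\ f y = i.+1 :> nat).
    by case=> ex ey; apply: nxy; split; exact: val_inj.
  by split_nat_ifs; lia.
- by rewrite ffunE permK (ce_color ce).
- rewrite ffunE => /(ce_surj ce) [x ex]; exists x.
  by rewrite ex permKV.
Qed.

Lemma color_support_perm n (chi : {ffun 'I_n.+1 -> 'I_d}) w :
  color_support (perm_char w chi) = color_support chi.
Proof.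
apply: color_support_eq => a; apply/existsP/existsP => -[j].
  by rewrite ffunE; exists (w^-1%g j).
by exists (w j); rewrite ffunE permK.
Qed.

(** The two permutations are conjugate by [s_i]. Along the enumerations moved by [s_i], which remain
    increasing, they induce the same permutation on every class. *)
Lemma comp_trace_swap n (chi : {ffun 'I_n.+1 -> 'I_d}) (i : 'I_n.+1.-1) w :
  chi (ord_lo i) != chi (ord_hi i) ->
  F (E (perm_char (s_ i) chi) * gw (w * s_ i)%g) = F (E chi * gw (s_ i * w)%g).
Proof.
move=> ne; have [m [f ce]] := class_enum_exists chi.
have ce' a := swap_class_enum ne (ce a).
rewrite (comp_trace_basis H v_unit _ _ ce) (comp_trace_basis H v_unit _ _ ce').
rewrite color_support_perm !perm_charM.
rewrite (inj_eq (can_inj (perm_charK _))); congr (_ * (_ * _)).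
apply: eq_bigr => a _; congr (tau (Tw _)).
by rewrite std_conj simple_permV -!mulgA simple_permK mulg1.
Qed.

Lemma class_enum_pair n (chi : {ffun 'I_n -> 'I_d}) (i : 'I_n.-1) m (f : 'I_m -> 'I_n) :
  chi (ord_lo i) = chi (ord_hi i) -> class_enum chi (chi (ord_lo i)) f ->
  exists k : 'I_m.-1, f (ord_lo k) = ord_lo i /\ f (ord_hi k) = ord_hi i.
Proof.
move=> e ce; have [x ex] := ce_surj ce erefl; have [y ey] := ce_surj ce (esym e).
exact: (incr_adjacent (ce_incr ce) ex ey).
Qed.

Lemma std_simple_other n (chi : {ffun 'I_n -> 'I_d}) (i : 'I_n.-1) a m (f : 'I_m -> 'I_n) :
  chi (ord_lo i) = chi (ord_hi i) -> a != chi (ord_lo i) -> class_enum chi a f ->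
  stable f (s_ i) /\ std f (s_ i) = 1%g.
Proof.
move=> e ne ce.
have out x : f x != ord_lo i /\ f x != ord_hi i.
  split; apply: contraNneq ne => h; first by rewrite -h (ce_color ce).
  by rewrite e -h (ce_color ce).
by split; [exact: stable_simple_out | exact: (std_simple_out (ce_incr ce) out)].
Qed.

Lemma perm_char_same n (chi : {ffun 'I_n -> 'I_d}) (i : 'I_n.-1) :
  chi (ord_lo i) = chi (ord_hi i) -> perm_char (s_ i) chi = chi.
Proof.
by move=> e; apply/perm_char_color => x; rewrite /simple_perm; case: tpermP => // ->.
Qed.

(** Only the class containing i and i+1 sees [s_i]. There the points are neighbours, the descents
    are those of the induced permutation, and the identity is the commutation of tau with a
    generator. *)
Lemma comp_trace_g_same n (chi : {ffun 'I_n.+1 -> 'I_d}) (i : 'I_n.+1.-1) w :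
  chi (ord_lo i) = chi (ord_hi i) -> perm_char w chi = chi ->
  u * F (E chi * gw (w * s_ i)%g) + (v *+ ldescent i w) * F (E chi * gw w) =
  u * F (E chi * gw (s_ i * w)%g) + (v *+ rdescent i w) * F (E chi * gw w).
Proof.
move=> e we; have [m [f ce]] := class_enum_exists chi.
have se := perm_char_same e.
rewrite (comp_trace_fixed ce we).
have wse : perm_char (w * s_ i)%g chi = chi by rewrite perm_charM we se.
have swe : perm_char (s_ i * w)%g chi = chi by rewrite perm_charM se we.
rewrite (comp_trace_fixed ce wse) (comp_trace_fixed ce swe).
set a := chi (ord_lo i).
have pr w' : \prod_b tau (Tw (std (f b) w')) =
    tau (Tw (std (f a) w')) * \prod_(b | b != a) tau (Tw (std (f b) w')).
  by rewrite (bigD1 a).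
rewrite (pr w) (pr (w * s_ i)%g) (pr (s_ i * w)%g) {pr}.
have sw b : stable (f b) w by exact: (class_enum_stable (ce b) we).
have [k [klo khi]] := class_enum_pair e (ce a).
have ss := stable_simple_in (ce_incr (ce a)) klo khi.
rewrite (stdM (ce_incr (ce a)) (sw a) ss) (stdM (ce_incr (ce a)) ss (sw a)).
rewrite (std_simple_in (ce_incr (ce a)) klo khi).
have other b : b != a -> std (f b) (w * s_ i)%g = std (f b) w /\
    std (f b) (s_ i * w)%g = std (f b) w.
  move=> ba; have [sb s1] := std_simple_other e ba (ce b).
  by rewrite !(stdM (ce_incr (ce b))) // s1 mulg1 mul1g.
have -> : \prod_(b | b != a) tau (Tw (std (f b) (w * s_ i)%g)) =
    \prod_(b | b != a) tau (Tw (std (f b) w)).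
  by apply: eq_bigr => b ba; rewrite (other b ba).1.
have -> : \prod_(b | b != a) tau (Tw (std (f b) (s_ i * w)%g)) =
    \prod_(b | b != a) tau (Tw (std (f b) w)).
  by apply: eq_bigr => b ba; rewrite (other b ba).2.
have := tau_T_commute u_unit v_unit k (std (f a) w).
rewrite (ldescent_std (ce_incr (ce a)) klo khi) // (rdescent_std (ce_incr (ce a)) klo khi) //.
move: (tau (Tw (std (f a) w * simple_perm k)%g)) (tau (Tw (std (f a) w))).
move: (tau (Tw (simple_perm k * std (f a) w)%g)) (v *+ ldescent i w) (v *+ rdescent i w).
move: (alpha _) (\prod_(b | b != a) _) => al P t3 v1 v2 t1 t2 h.
transitivity (al * P * (u * t1 + v1 * t2)); first by ring.
by rewrite h; ring.
Qed.

Lemma comp_trace_g n (x : yh n.+1) (i : 'I_n.+1.-1) : F (x * g i) = F (g i * x).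
Proof.
move: x; apply: (yh_basis_ind H) => [x y ex ey|c x ex|chi w].
- by rewrite mulrDl mulrDr !comp_traceD ex ey.
- by rewrite -yh_scalerAl -yh_scalerAr !comp_traceZ ex.
rewrite E_gw_g g_E_gw !(comp_traceD, comp_traceZ).
have [ew|new] := eqVneq (perm_char w chi) chi; last first.
  rewrite (comp_trace_moved new) mulr0 addr0.
  have [ec|nec] := eqVneq (chi (ord_hi i)) (chi (ord_lo i)).
    rewrite (perm_char_same (esym ec)) (comp_trace_moved new) mulr0 addr0.
    have sc := perm_char_same (esym ec).
    have n1 : perm_char (s_ i * w)%g chi != chi by rewrite perm_charM sc.
    have n2 : perm_char (w * s_ i)%g chi != chi.
      by rewrite perm_charM -{2}sc (inj_eq (can_inj (perm_charK _))).
    by rewrite (comp_trace_moved n1) (comp_trace_moved n2).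
  by rewrite mulr0 mul0r addr0 comp_trace_swap // eq_sym.
have /perm_char_color ew' := ew; rewrite !ew' [chi (ord_hi i) == _]eq_sym.
have [ec|nec] := eqVneq (chi (ord_lo i)) (chi (ord_hi i)).
  rewrite (mulr1 (v *+ rdescent i w)) (mulr1 (v *+ ldescent i w)) (perm_char_same ec).
  exact/esym/comp_trace_g_same.
rewrite (mulr0 (v *+ rdescent i w)) (mulr0 (v *+ ldescent i w)).
by rewrite !mul0r !addr0 comp_trace_swap.
Qed.

Lemma comp_trace_mulC n (x y : yh n.+1) : F (x * y) = F (y * x).
Proof.
elim/yh_ind: y x => [|y y' ey ey'|c y ey|i y ey|j y ey] x.
- by rewrite mul1r mulr1.
- by rewrite mulrDl mulrDr !comp_traceD ey ey'.
- by rewrite -yh_scalerAl -yh_scalerAr !comp_traceZ ey.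
- by rewrite mulrA ey mulrA comp_trace_g mulrA.
- by rewrite mulrA ey mulrA comp_trace_t mulrA.
Qed.

End CompTraceMarkov.

(** * The candidate satisfies (M2) *)

Section ExtendEnum.
Variables (d n : nat).
Implicit Types (chi : {ffun 'I_n -> 'I_d}) (psi : {ffun 'I_n.+1 -> 'I_d}).
Local Notation wid := (widen_ord (leqnSn n)).

Definition extend_enum m (f : 'I_m -> 'I_n) (z : 'I_m.+1) : 'I_n.+1 :=
  if unlift ord_max z is Some x then wid (f x) else ord_max.

Lemma extend_enum_wid m (f : 'I_m -> 'I_n) x :
  extend_enum f (widen_ord (leqnSn m) x) = wid (f x).
Proof. by rewrite /extend_enum -lift_max_widen liftK. Qed.

Lemma extend_enum_max m (f : 'I_m -> 'I_n) : extend_enum f ord_max = ord_max.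
Proof. by rewrite /extend_enum unlift_none. Qed.

Lemma class_enum_widen psi a m (f : 'I_m -> 'I_n) :
  class_enum (restrict_char psi) a f -> a != psi ord_max -> class_enum psi a (fun x => wid (f x)).
Proof.
move=> ce ne; split=> [x y|x|y ey]; first exact: (ce_incr ce).
  by rewrite -(ce_color ce x) ffunE.
case: (widen_or_max y) ey => [-> e|[x -> ex]]; first by rewrite e eqxx in ne.
by have [|k <-] := ce_surj ce (y := x); [rewrite ffunE | exists k].
Qed.

Lemma class_enum_extend psi m (f : 'I_m -> 'I_n) :
  class_enum (restrict_char psi) (psi ord_max) f -> class_enum psi (psi ord_max) (extend_enum f).
Proof.
move=> ce; split=> [x y|x|y ey].
- case: (widen_or_max x) => [->|[x' ->]]; first by have := ltn_ord y; rewrite /=; lia.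
  case: (widen_or_max y) => [-> _|[y' ->]]; rewrite extend_enum_wid ?extend_enum_max.
    by rewrite /=.
  by rewrite extend_enum_wid => lt; exact: (ce_incr ce).
- case: (widen_or_max x) => [->|[x' ->]]; first by rewrite extend_enum_max.
  by rewrite extend_enum_wid -[RHS](ce_color ce x') ffunE.
- case: (widen_or_max y) ey => [-> _|[x -> ex]].
    by exists ord_max; rewrite extend_enum_max.
  have [|k <-] := ce_surj ce (y := x); first by rewrite ffunE.
  by exists (widen_ord (leqnSn m) k); rewrite extend_enum_wid.
Qed.

Lemma std_extend_lift psi m (f : 'I_m -> 'I_n) (w : 'S_n) :
  class_enum (restrict_char psi) (psi ord_max) f -> stable f w ->
  std (extend_enum f) (perm_lift w) = perm_lift (std f w).
Proof.
move=> ce st; apply: std_uniq => [|x]; first exact: ce_incr (class_enum_extend ce).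
case: (widen_or_max x) => [->|[x' ->]].
  by rewrite perm_lift_max extend_enum_max perm_lift_max.
by rewrite perm_lift_widen !extend_enum_wid perm_lift_widen (stdE (ce_incr ce)).
Qed.

End ExtendEnum.

Section CompTraceM2.
Variables (B : comUnitRingType) (u v : B) (d : nat) (xi : 'I_d -> B).
Hypothesis H : root_system u xi.
Hypothesis v_unit : v \is a GRing.unit.
Variable alpha : Comp0 d -> B.
Let u_unit := rs_u_unit H.
Local Notation yh := (yh u v d).
Local Notation E chi := (E_chi u v xi chi).
Local Notation gw := (@yh_gw B u v d _).
Local Notation Tw := (@heckeTw B u v _).
Local Notation tau := (@hecke_tau B u v _).
Local Notation F := (@comp_trace B u v d xi alpha _).
Local Notation s_ i := (simple_perm i).
Local Notation glast n := (@yh_g B u v d n.+2 ord_max).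
Local Notation elast n := (@yh_e B u v d n.+2 ord_max).

Section FixedWord.
Variables (n : nat) (chi : {ffun 'I_n.+1 -> 'I_d}) (w : 'S_n.+1).
Local Notation wid := (widen_ord (leqnSn n.+1)).
Local Notation last := (ord_max : 'I_n.+2.-1).
Local Notation psi0 := (extend_char chi (chi ord_max)).

Lemma ord_lo_last : ord_lo last = wid ord_max.
Proof. exact: val_inj. Qed.

Lemma ord_hi_last : ord_hi last = ord_max.
Proof. exact: val_inj. Qed.

(** In [psi0] the new point repeats the colour of the last one. So the support is unchanged and only
    one factor of the product over classes changes: by u^-1 if the last reflection links the new
    point to the old ones, by z if the new point is fixed. *)
Lemma comp_trace_extend (p : 'S_n.+2) (kappa : B) :
  perm_char w chi = chi -> perm_char p psi0 = psi0 ->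
  (forall a m (f : 'I_m -> 'I_n.+1), a != chi ord_max -> class_enum chi a f ->
     std (fun x => wid (f x)) p = std f w) ->
  (forall m (f : 'I_m -> 'I_n.+1), class_enum chi (chi ord_max) f ->
     tau (Tw (std (extend_enum f) p)) = kappa * tau (Tw (std f w))) ->
  F (E psi0 * gw p) = kappa * F (E chi * gw w).
Proof.
move=> we pe hout hin.
have [m [f ce]] := class_enum_exists chi; have [m' [f' ce']] := class_enum_exists psi0.
rewrite (comp_trace_fixed H v_unit alpha ce' pe) (comp_trace_fixed H v_unit alpha ce we).
have -> : color_support psi0 = color_support chi.
  apply: color_support_eq => a; apply/existsP/existsP => -[j]; last first.
    by exists (wid j); rewrite extend_char_wid.
  case: (widen_or_max j) => [->|[x ->]]; rewrite ?extend_char_max ?extend_char_wid => h.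
    by exists ord_max.
  by exists x.
rewrite mulrCA; congr (_ * _).
rewrite (bigD1 (chi ord_max)) //= [in RHS](bigD1 (chi ord_max)) //= mulrA; congr (_ * _).
  have ce1 := ce (chi ord_max); rewrite -(hin _ _ ce1).
  have cr : class_enum (restrict_char psi0) (psi0 ord_max) (f (chi ord_max)).
    by rewrite restrict_extend extend_char_max.
  have := class_enum_extend cr; rewrite extend_char_max; exact: tau_std_eq.
apply: eq_bigr => a ne; rewrite -(hout _ _ _ ne (ce a)).
apply: tau_std_eq (ce' _) _.
by apply: class_enum_widen; rewrite ?restrict_extend ?extend_char_max.
Qed.

(** The last point comes last in its class. Hence the reflection joining it to the new point becomes
    the last reflection of the enlarged class. *)
Lemma class_enum_last m (f : 'I_m -> 'I_n.+1) : class_enum chi (chi ord_max) f ->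
  exists m0 (e : m = m0.+1), f (cast_ord (esym e) ord_max) = ord_max.
Proof.
case: m f => [|m] f ce; have [x fx] := ce_surj ce erefl; first by case: x fx.
exists m, erefl; rewrite cast_ord_id.
have [//|xm] := eqVneq x ord_max; first by move=> <-.
have lt : (x < @ord_max m)%N.
  rewrite ltn_neqAle -ltnS ltn_ord andbT; apply: contraNneq xm => e.
  by apply/eqP/val_inj.
have := ce_incr ce lt; rewrite fx /=; have := ltn_ord (f ord_max); lia.
Qed.

(** The permutation sends the last old point to the new one, so an invariant colouring must give
    both the same colour. *)
Lemma swap_lift_fixed psi : restrict_char psi = chi ->
  perm_char (s_ last * perm_lift w)%g psi = psi <-> psi = psi0 /\ perm_char w chi = chi.
Proof.
move=> rp; have rpE x : psi (wid x) = chi x by rewrite -rp ffunE.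
rewrite !perm_char_color; split=> [h|[-> h] z].
  have h1 := h (ord_hi last); rewrite permM simple_perm_hi ord_lo_last ord_hi_last perm_lift_widen rpE in h1.
  have h2 := h (ord_lo last); rewrite permM simple_perm_lo ord_lo_last ord_hi_last perm_lift_max rpE in h2.
  split; first by rewrite -[LHS]extend_restrict rp h2.
  move=> x; have [->|xm] := eqVneq x ord_max; first by rewrite h1 h2.
  have := h (wid x); rewrite permM /simple_perm tpermD ?perm_lift_widen ?rpE //.
    by rewrite ord_lo_last (inj_eq (@wid_inj _)) eq_sym.
  by rewrite ord_hi_last -(inj_eq val_inj) /=; have := ltn_ord x; lia.
rewrite permM /simple_perm; case: tpermP => [->|->|/eqP zl /eqP zh].
- by rewrite ord_hi_last perm_lift_max ord_lo_last extend_char_max extend_char_wid.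
- by rewrite ord_lo_last perm_lift_widen extend_char_wid h ord_hi_last extend_char_max.
- case: (widen_or_max z) => [->|[x ->]]; first by rewrite perm_lift_max.
  by rewrite perm_lift_widen !extend_char_wid h.
Qed.

Lemma lift_fixed psi : restrict_char psi = chi ->
  perm_char (perm_lift w) psi = psi <-> perm_char w chi = chi.
Proof.
move=> rp; have rpE x : psi (wid x) = chi x by rewrite -rp ffunE.
rewrite !perm_char_color; split=> h z; first by rewrite -!rpE -perm_lift_widen h.
case: (widen_or_max z) => [->|[x ->]]; first by rewrite perm_lift_max.
by rewrite perm_lift_widen !rpE h.
Qed.

Lemma std_widen_lift a m (f : 'I_m -> 'I_n.+1) : perm_char w chi = chi -> class_enum chi a f ->
  std (fun x => wid (f x)) (perm_lift w) = std f w.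
Proof.
move=> we ce; apply: std_uniq => [x y|x]; first exact: (ce_incr ce).
by rewrite perm_lift_widen (stdE (ce_incr ce)) //; exact: (class_enum_stable ce we).
Qed.

Lemma comp_trace_lift_swap : perm_char w chi = chi ->
  F (E psi0 * gw (s_ last * perm_lift w)%g) = u^-1 * F (E chi * gw w).
Proof.
move=> we; apply: comp_trace_extend => //.
- by apply/swap_lift_fixed; rewrite ?restrict_extend.
- move=> a m f ne ce; rewrite -(std_widen_lift we ce).
  rewrite /std; congr odflt; apply: eq_pick => q; apply: eq_forallb => x; congr (_ == _).
  rewrite permM /simple_perm tpermD //.
    rewrite ord_lo_last (inj_eq (@wid_inj _)) eq_sym; apply: contraNneq ne => e.
    by rewrite -e (ce_color ce).
  by rewrite ord_hi_last -(inj_eq val_inj) /=; have := ltn_ord (f x); lia.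
- move=> m f ce; have [m0 [e fm]] := class_enum_last ce.
  subst m; rewrite cast_ord_id in fm.
  have cr : class_enum (restrict_char psi0) (psi0 ord_max) f.
    by rewrite restrict_extend extend_char_max.
  have ce' := class_enum_extend cr.
  have st := class_enum_stable ce we.
  have klo : extend_enum f (ord_lo (ord_max : 'I_m0.+2.-1)) = ord_lo last.
    have -> : ord_lo (ord_max : 'I_m0.+2.-1) = widen_ord (leqnSn _) ord_max by exact: val_inj.
    by rewrite extend_enum_wid fm ord_lo_last.
  have khi : extend_enum f (ord_hi (ord_max : 'I_m0.+2.-1)) = ord_hi last.
    have -> : ord_hi (ord_max : 'I_m0.+2.-1) = ord_max by exact: val_inj.
    by rewrite extend_enum_max ord_hi_last.
  have ss := stable_simple_in (ce_incr ce') klo khi.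
  have sl : stable (extend_enum f) (perm_lift w).
    by apply: (class_enum_stable ce'); apply/lift_fixed; rewrite ?restrict_extend.
  rewrite (stdM (ce_incr ce') ss sl) (std_simple_in (ce_incr ce') klo khi).
  rewrite (std_extend_lift cr st).
  set k := (ord_max : 'I_m0.+2.-1).
  have nd : ~~ rdescent k (perm_lift (std f w)).
    rewrite /rdescent -leqNgt.
    have -> : ord_hi k = ord_max by exact: val_inj.
    by rewrite perm_lift_max; exact: leq_ord.
  (* In terms of normalized basis elements, the product of the lifted element with the last
     generator carries a factor u; this is the origin of u^-1. *)
  have := heckeTw_rup v u_unit nd; rewrite -hecke_emb_Tw => h.
  have := hecke_markov_pos (hecke_tauP u_unit v_unit) (Tw (std f w)).
  rewrite h (tauZ u_unit v_unit) => <-.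
  by rewrite mulKr.
Qed.

Lemma comp_trace_lift : perm_char w chi = chi ->
  F (E psi0 * gw (perm_lift w)) = markov_z u v * F (E chi * gw w).
Proof.
move=> we; apply: comp_trace_extend => //.
- by apply/lift_fixed; rewrite ?restrict_extend.
- by move=> a m f ne ce; exact: std_widen_lift we ce.
- move=> m f ce; have [m0 [e fm]] := class_enum_last ce.
  subst m; rewrite cast_ord_id in fm.
  have cr : class_enum (restrict_char psi0) (psi0 ord_max) f.
    by rewrite restrict_extend extend_char_max.
  rewrite (std_extend_lift cr (class_enum_stable ce we)).
  by rewrite -hecke_emb_Tw (tau_emb u_unit v_unit).
Qed.

Lemma rdescent_lift : ~~ rdescent last (perm_lift w).
Proof. by rewrite /rdescent -leqNgt ord_hi_last perm_lift_max; exact: leq_ord. Qed.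

Lemma emb_basis :
  yh_emb (E chi * gw w) = \sum_(psi | restrict_char psi == chi) E psi * gw (perm_lift w).
Proof. by rewrite rmorphM /= yh_emb_gw (yh_emb_E v H) mulr_suml. Qed.

Lemma comp_trace_pos_basis :
  F (yh_emb (E chi * gw w) * glast n) = F (E chi * gw w).
Proof.
rewrite emb_basis mulr_suml (comp_trace_sum H v_unit).
under eq_bigr do rewrite -mulrA (gw_rup v H rdescent_lift) -(yh_scalerAr u) (comp_traceZ H v_unit).
have [we|wne] := eqVneq (perm_char w chi) chi; last first.
  rewrite (comp_trace_moved H v_unit _ wne) big1 // => psi /eqP rp.
  rewrite (comp_trace_moved H v_unit) ?mulr0 //.
  by apply: contraNneq wne => /(swap_lift_fixed rp) [_ ->].
rewrite (bigD1 psi0) ?restrict_extend //= comp_trace_lift_swap // mulVKr //.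
rewrite big1 ?addr0 // => psi /andP[/eqP rp ne].
rewrite (comp_trace_moved H v_unit) ?mulr0 //.
by apply: contraNneq ne => /(swap_lift_fixed rp) [-> _].
Qed.

(** The embedded idempotent is a sum over all colours of the new point; [elast n] keeps only the
    colour of the last old point, so that z occurs just once. *)
Lemma comp_trace_e_basis :
  F (yh_emb (E chi * gw w) * elast n) = markov_z u v * F (E chi * gw w).
Proof.
rewrite emb_basis mulr_suml (comp_trace_sum H v_unit).
under eq_bigr do rewrite (E_gw_e v H) (comp_traceZ H v_unit).
have [we|wne] := eqVneq (perm_char w chi) chi; last first.
  rewrite (comp_trace_moved H v_unit _ wne) mulr0 big1 // => psi /eqP rp.
  rewrite (comp_trace_moved H v_unit) ?mulr0 //.
  by apply: contraNneq wne => /(lift_fixed rp) ->.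
have /perm_char_color wc := we.
rewrite (bigD1 psi0) ?restrict_extend //= comp_trace_lift //.
rewrite ord_lo_last ord_hi_last perm_lift_widen perm_lift_max extend_char_wid extend_char_max wc eqxx.
rewrite mul1r big1 ?addr0 // => psi /andP[/eqP rp ne].
have -> : psi (wid (w ord_max)) = chi ord_max by rewrite -wc -rp ffunE.
have [e|_] := eqVneq (chi ord_max) (psi ord_max); last by rewrite mul0r.
by case/eqP: ne; rewrite -[LHS]extend_restrict rp e.
Qed.

End FixedWord.

Lemma comp_trace_pos n (x : yh n.+1) : F (yh_emb x * glast n) = F x.
Proof.
move: x; apply: (yh_basis_ind H) => [x y ex ey|c x ex|chi w].
- by rewrite rmorphD mulrDl !(comp_traceD H v_unit) ex ey.
- by rewrite yh_embZ -(yh_scalerAl c) !(comp_traceZ H v_unit) ex.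
- exact: comp_trace_pos_basis.
Qed.

Lemma comp_trace_e n (x : yh n.+1) : F (yh_emb x * elast n) = markov_z u v * F x.
Proof.
move: x; apply: (yh_basis_ind H) => [x y ex ey|c x ex|chi w].
- by rewrite rmorphD mulrDl !(comp_traceD H v_unit) ex ey mulrDr.
- by rewrite yh_embZ -(yh_scalerAl c) !(comp_traceZ H v_unit) ex mulrCA.
- exact: comp_trace_e_basis.
Qed.

Lemma comp_trace_neg n (x : yh n.+1) : F (yh_emb x * ring_inv (glast n)) = F x.
Proof.
rewrite (yh_ring_inv v H) -(yh_scalerAr (u ^- 2)) mulrBr -(yh_scalerAr v) (comp_traceZ H v_unit).
rewrite (comp_traceD H v_unit) -scaleNr (comp_traceZ H v_unit) comp_trace_pos comp_trace_e.
have -> : - v * (markov_z u v * F x) = (u ^+ 2 - 1) * F x.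
  by rewrite /markov_z mulrA mulNr (mulVKr v_unit) opprB.
by rewrite -{1}[F x]mul1r -mulrDl addrC subrK mulKr // unitrX.
Qed.

End CompTraceM2.

(** * Markov traces are determined by injective characters *)

Section Uniqueness.
Variables (B : comUnitRingType) (u v : B) (d : nat) (xi : 'I_d -> B).
Hypothesis H : root_system u xi.
Hypothesis v_unit : v \is a GRing.unit.
Let u_unit := rs_u_unit H.
Local Notation yh := (yh u v d).
Local Notation E chi := (E_chi u v xi chi).
Local Notation gw := (@yh_gw B u v d _).
Local Notation g := (@yh_g B u v d _).
Local Notation t := (@yh_t B u v d _).
Local Notation s_ i := (simple_perm i).
Local Notation glast n := (@yh_g B u v d n.+2 ord_max).
Local Notation elast n := (@yh_e B u v d n.+2 ord_max).

Section Factorization.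
Variable n : nat.
Local Notation last := (ord_max : 'I_n.+2.-1).
Local Notation wid := (widen_ord (leqnSn n.+1)).
Local Notation widg := (widen_ord (leq_pred n.+1) : 'I_n.+1.-1 -> 'I_n.+2.-1).

(** Induction on the distance of i, where w(i) is the last point, from the end. Since i is a right
    descent, a factor [g i] splits off on the right and the preimage moves to i+1. When i is the
    last reflection, what remains fixes the last point and is therefore embedded. *)
Lemma gw_through_last (w : 'S_n.+2) : w ord_max != ord_max ->
  exists x y : yh n.+1, gw w = yh_emb x * glast n * yh_emb y.
Proof.
move=> wm.
have [i wi] : exists i : 'I_n.+2.-1, w (ord_lo i) = ord_max.
  have lt : (w^-1%g ord_max < n.+2.-1)%N.
    have := ltn_ord (w^-1%g ord_max); rewrite ltnS leq_eqVlt => /orP[/eqP e|//].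
    case/eqP: wm; rewrite -{1}(_ : w^-1%g ord_max = ord_max) ?permKV //; exact: val_inj.
  by exists (Ordinal lt); rewrite (_ : ord_lo _ = w^-1%g ord_max) ?permKV //; exact: val_inj.
move: i wi {wm}; suff h k (i : 'I_n.+2.-1) (w' : 'S_n.+2) : (n - i)%N = k -> w' (ord_lo i) = ord_max ->
    exists x y : yh n.+1, gw w' = yh_emb x * glast n * yh_emb y.
  by move=> i; exact: h erefl.
elim: k i w' => [|k IH] i {}w ik wi.
all: have dw : rdescent i w
  by (rewrite /rdescent wi ltn_neqAle leq_ord andbT -wi (inj_eq val_inj) (inj_eq perm_inj)
       eq_sym ord_lo_neq_hi).
all: have nd : ~~ rdescent i (s_ i * w)%g by rewrite rdescentM dw.
all: have := gw_rup v H nd; rewrite mulgA simple_permK mul1g => gg.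
all: have {}gg : gw w = u^-1 *: (gw (s_ i * w)%g * g i) by rewrite gg scalerA mulVr // scale1r.
all: have w1 : (s_ i * w)%g (ord_hi i) = ord_max by rewrite permM simple_perm_hi.
- have il : i = last.
    apply: val_inj; apply/eqP; rewrite /= eqn_leq -ltnS (ltn_ord i) /= -subn_eq0; exact/eqP.
  subst i; rewrite ord_hi_last in w1; have [w' e] := perm_lift_exists w1.
  exists (u^-1 *: gw w'), 1; rewrite rmorph1 mulr1 yh_embZ yh_emb_gw -e gg.
  exact: yh_scalerAl.
- have iN : (i < n.+1.-1)%N by move: ik; rewrite /=; lia.
  have e1 : widg (Ordinal iN) = i by exact: val_inj.
  have iN1 : (i.+1 < n.+2.-1)%N by have := iN; rewrite /=; lia.
  have [||x [y e]] := IH (Ordinal iN1) (s_ i * w)%g; first by rewrite /= subnS ik.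
    by rewrite -[RHS]w1; congr (_ _); exact: val_inj.
  exists (u^-1 *: x), (y * g (Ordinal iN)).
  rewrite gg e rmorphM /= yh_emb_g e1 yh_embZ -(yh_scalerAl u^-1 (yh_emb x)).
  by rewrite -(yh_scalerAl u^-1) !mulrA.
Qed.

Lemma E_one_max_comm c (x : yh n.+1) :
  E_one u v xi c ord_max * yh_emb x = yh_emb x * E_one u v xi c ord_max.
Proof.
elim/yh_ind: x => [|x y ex ey|a x ex|i x ex|j x ex].
- by rewrite rmorph1 mul1r mulr1.
- by rewrite rmorphD mulrDl mulrDr ex ey.
- by rewrite yh_embZ -(yh_scalerAl a) -(yh_scalerAr a) ex.
- rewrite rmorphM /= -mulrA -ex !mulrA; congr (_ * _); rewrite yh_emb_g /E_one.
  rewrite -yh_scalerAl -yh_scalerAr mulr_suml mulr_sumr; congr (_ *: _); apply: eq_bigr => s _.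
  rewrite -(yh_scalerAl (xi c ^+ s)) -(yh_scalerAr (xi c ^+ s)); congr (_ *: _).
  apply/esym/commrX; rewrite /GRing.comm yh_gt; congr (t _ * _).
  rewrite -ord_hi_last perm_lift_simple ord_hi_last; exact: perm_lift_max.
- by rewrite rmorphM /= -mulrA -ex !mulrA yh_emb_t t_E_one_comm.
Qed.

(** With [E_one_max_comm], this moves the projection at the last point across [glast n], where it
    becomes an embedded element and (M2) can be applied. *)
Lemma E_one_last_g c : E_one u v xi c ord_max * glast n = glast n * yh_emb (E_one u v xi c ord_max).
Proof.
rewrite yh_emb_E_one /E_one -yh_scalerAl -yh_scalerAr mulr_suml mulr_sumr; congr (_ *: _).
apply: eq_bigr => s _.
rewrite -(yh_scalerAl (xi c ^+ s)) -(yh_scalerAr (xi c ^+ s)); congr (_ *: _).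
elim: (d - s)%N => [|k IH]; first by rewrite !expr0 mul1r mulr1.
have tg : t ord_max * glast n = glast n * t (wid ord_max).
  by rewrite yh_gt -ord_lo_last simple_perm_lo ord_hi_last.
by rewrite exprSr -mulrA tg mulrA IH exprSr !mulrA.
Qed.

Lemma E_restrict (chi : {ffun 'I_n.+2 -> 'I_d}) :
  E chi = yh_emb (E (restrict_char chi)) * E_one u v xi (chi ord_max) ord_max.
Proof.
rewrite E_chiE big_ord_recr /= E_chiE rmorph_prod; congr (_ * _).
by apply: eq_bigr => j _; rewrite /= yh_emb_E_one ffunE.
Qed.

End Factorization.

(** [D] stands for the difference of two Markov traces with the same parameters. *)
Variable D : forall n, yh n -> B.
Hypothesis D_scalar : forall n, scalar (@D n.+1).
Hypothesis D_markov : is_yh_markov_trace D.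
Hypothesis D_inj : forall n (chi : {ffun 'I_n.+1 -> 'I_d}), injective chi -> D (E chi) = 0.

Lemma D0 n : D (0 : yh n.+1) = 0.
Proof. by have := @D_scalar n (-1) 0 0; rewrite scaler0 addr0 mulN1r addNr. Qed.

Lemma DZ n c (x : yh n.+1) : D (c *: x) = c * D x.
Proof. by rewrite -[c *: x]addr0 D_scalar D0 addr0. Qed.

Lemma DD n (x y : yh n.+1) : D (x + y) = D x + D y.
Proof. by rewrite -{1}[x]scale1r D_scalar mul1r. Qed.

Lemma D_mulC n (x y : yh n.+1) : D (x * y) = D (y * x).
Proof. by apply: (yh_markov_trace D_markov). Qed.

(** Comparing the two halves of (M2) through the explicit inverse of the last generator, as in
    [tau_emb], with [elast n] in place of 1. *)
Lemma D_e n (x : yh n.+1) : D (yh_emb x * elast n) = markov_z u v * D x.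
Proof.
have := yh_markov_neg D_markov x; rewrite (yh_ring_inv v H).
rewrite -(yh_scalerAr (u ^- 2)) mulrBr -(yh_scalerAr v) DZ DD -scaleNr DZ.
rewrite (yh_markov_pos D_markov) => /(congr1 (fun c => u ^+ 2 * c)).
rewrite mulVKr ?unitrX // => h.
have {}h : v * D (yh_emb x * elast n) = (1 - u ^+ 2) * D x.
  by rewrite mulrBl mul1r -h mulNr opprD opprK addrA subrr add0r.
by rewrite /markov_z -mulrA -h mulKr.
Qed.

(** One copy of the idempotent [E chi] is cycled to the right and comes back through [gw w] as the
    idempotent of w(chi), orthogonal to [E chi]. *)
Lemma D_moved n (chi : {ffun 'I_n.+1 -> 'I_d}) w :
  perm_char w chi != chi -> D (E chi * gw w) = 0.
Proof.
move=> ne; rewrite -(E_idem v H chi) -mulrA D_mulC -mulrA -(E_gw v H) mulrA (E_orth v H).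
by rewrite eq_sym (negPf ne) scale0r mul0r D0.
Qed.

Definition vanishes n (chi : {ffun 'I_n.+1 -> 'I_d}) := forall w, D (E chi * gw w) = 0.

(** If the colours at i and i+1 differ, [E chi * gw (s_i * w) * g i] has no [v] term and equals u
    times the element sought. With [g i] cycled to the left, it lies in the ideal of s_i(chi), where
    D vanishes. *)
Lemma vanishes_swap n (chi : {ffun 'I_n.+1 -> 'I_d}) i :
  vanishes (perm_char (s_ i) chi) -> vanishes chi.
Proof.
have [e|ne] := eqVneq (chi (ord_lo i)) (chi (ord_hi i)); first by rewrite perm_char_same.
move=> h w; have [we|] := eqVneq (perm_char w chi) chi; last exact: D_moved.
have := D_mulC (E chi * gw (s_ i * w)%g) (g i).
rewrite (E_gw_g v H) (g_E_gw v H) !(DD, DZ) !h !mulr0 addr0 mulgA simple_permK mul1g.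
rewrite !permM simple_perm_lo simple_perm_hi.
have /perm_char_color we' := we; rewrite !we' eq_sym (negPf ne) mulr0 mul0r addr0.
by move=> /(congr1 (fun c => u^-1 * c)); rewrite mulKr // mulr0.
Qed.

Lemma vanishes_perm n (chi : {ffun 'I_n.+1 -> 'I_d}) p :
  vanishes (perm_char p chi) -> vanishes chi.
Proof.
rewrite -(reduced_wordK p); elim: (reduced_word p) => [|i r IH].
  by rewrite perm_char1.
by rewrite word_perm_cons perm_charM => /vanishes_swap.
Qed.

Lemma vanishes_injective n (chi : {ffun 'I_n.+1 -> 'I_d}) : injective chi -> vanishes chi.
Proof.
move=> ci w; have [we|] := eqVneq (perm_char w chi) chi; last exact: D_moved.
have -> : w = 1%g.
  by apply/permP => x; apply: ci; rewrite perm1; have /perm_char_color -> := we.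
by rewrite gw1 mulr1 D_inj.
Qed.

Lemma D_basis_zero n : (forall chi : {ffun 'I_n.+1 -> 'I_d}, vanishes chi) ->
  forall x : yh n.+1, D x = 0.
Proof.
move=> h; apply: (yh_basis_ind H) => [x y ex ey|c x ex|chi w].
- by rewrite DD ex ey addr0.
- by rewrite DZ ex mulr0.
- exact: h.
Qed.

Lemma two_point_perm n (x y a b : 'I_n) : x != y -> a != b ->
  exists p : 'S_n, p x = a /\ p y = b.
Proof.
move=> xy ab; exists (tperm x a * tperm (tperm x a y) b)%g; rewrite !permM tpermL; split.
  have h : tperm x a y != a.
    by apply: contraNneq xy => e; apply/eqP/(@perm_inj _ (tperm x a)); rewrite tpermL.
  by rewrite (@tpermD _ (tperm x a y)) // eq_sym.
by rewrite tpermL.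
Qed.

(** In both cases the element is reduced to size n + 1, by (M2) if [w] moves the last point and by
    [D_e] if it fixes it. *)
Lemma vanishes_last_pair n (chi : {ffun 'I_n.+2 -> 'I_d}) :
  (forall x : yh n.+1, D x = 0) ->
  chi (ord_lo (ord_max : 'I_n.+2.-1)) = chi (ord_hi (ord_max : 'I_n.+2.-1)) -> vanishes chi.
Proof.
move=> IH; rewrite ord_lo_last ord_hi_last => cc w.
have [wm|wm] := eqVneq (w ord_max) ord_max; last first.
  have [x [y ->]] := gw_through_last wm.
  rewrite E_restrict; set er := E _; set c := chi _.
  have -> : yh_emb er * E_one u v xi c ord_max * (yh_emb x * glast n * yh_emb y) =
      yh_emb (er * x) * glast n * yh_emb (E_one u v xi c ord_max * y).
    have embM (a b : yh n.+1) : yh_emb (a * b) = yh_emb a * yh_emb b by rewrite rmorphM.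
    rewrite (embM er) (embM (E_one u v xi _ _)) !mulrA.
    rewrite -(mulrA (yh_emb er) (E_one u v xi _ _) (yh_emb x)) E_one_max_comm !mulrA.
    by rewrite -(mulrA _ (E_one u v xi _ _) (glast n)) E_one_last_g !mulrA.
  by rewrite D_mulC mulrA -rmorphM (yh_markov_pos D_markov) IH.
have [we|] := eqVneq (perm_char w chi) chi; last exact: D_moved.
have /perm_char_color we' := we.
have [w' ew] := perm_lift_exists wm.
(* Among the characters with the same restriction as [chi], only [chi] has equal colours at the last
   two points, so [elast n] isolates its term. *)
have -> : E chi * gw w = yh_emb (E (restrict_char chi) * gw w') * elast n.
  rewrite (emb_basis v H) mulr_suml (bigD1 chi) //= -ew (E_gw_e v H) !we'.
  rewrite ord_lo_last ord_hi_last cc eqxx scale1r [X in _ + X]big1 ?addr0 // => psi /andP[/eqP pr pc].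
  rewrite (E_gw_e v H) (_ : _ == _ = false) ?scale0r // ord_lo_last ord_hi_last wm.
  apply: contraNF pc => /eqP pw; apply/eqP/ffunP => z.
  have pwid x : psi (widen_ord (leqnSn n.+1) x) = chi (widen_ord (leqnSn n.+1) x).
    by have /ffunP/(_ x) := pr; rewrite !ffunE.
  have [->|[x ->]] := widen_or_max z; last exact: pwid.
  by rewrite -pw ew perm_lift_widen pwid -perm_lift_widen -ew we' cc.
by rewrite D_e IH mulr0.
Qed.

Lemma markov_trace_eq0 n (x : yh n.+1) : D x = 0.
Proof.
elim: n x => [|n IH]; apply: D_basis_zero => chi.
  by apply: vanishes_injective => a b _; rewrite !ord1.
have [/injectiveP ci|/injectivePn[x [y xy cxy]]] := boolP (injectiveb chi).
  exact: vanishes_injective.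
have [p [px py]] := two_point_perm xy (ord_lo_neq_hi (ord_max : 'I_n.+2.-1)).
apply: (@vanishes_perm _ _ p); apply: vanishes_last_pair => //.
by rewrite -px -py !ffunE !permK.
Qed.

End Uniqueness.

(* Parameters of a Markov trace *)
From mathcomp Require Import reals complex.

(** For an injective character the number of points is the size of the support. Together with
    [injective_color_perm] it shows that a support determines the character up to permutation, so
    that one parameter per support suffices. *)
Lemma injective_color_support d n m (chi : {ffun 'I_n.+1 -> 'I_d}) (psi : {ffun 'I_m.+1 -> 'I_d}) :
  injective chi -> injective psi -> color_support chi = color_support psi -> n = m.
Proof.
move=> ci pi e; apply: succn_inj; rewrite -(card_ord n.+1) -(card_ord m.+1).
rewrite -(card_codom ci) -(card_codom pi); apply: eq_card => a.
have codE k (f : {ffun 'I_k.+1 -> 'I_d}) : (a \in codom f) = sval (color_support f) a.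
  rewrite color_supportE; apply/codomP/existsP => -[j]; first by move->; exists j.
  by move/eqP <-; exists j.
by rewrite !codE e.
Qed.

Lemma injective_color_perm d n (chi psi : {ffun 'I_n.+1 -> 'I_d}) :
  injective chi -> injective psi -> color_support chi = color_support psi ->
  exists p, perm_char p psi = chi.
Proof.
move=> ci pi e.
have h x : exists y, chi y == psi x.
  apply/existsP; rewrite -(color_supportE chi) e color_supportE; apply/existsP; by exists x.
pose q x := xchoose (h x); have qE x : chi (q x) = psi x by exact/eqP/(xchooseP (h x)).
have qi : injective q by move=> x y /(congr1 chi); rewrite !qE => /pi.
exists (perm qi); apply/ffunP => z; rewrite ffunE.
by rewrite -{2}(permKV (perm qi) z) permE qE.
Qed.

Section MarkovTraceClassification.
Variables (B : comUnitRingType) (u v : B) (d : nat) (xi : 'I_d -> B).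
Hypothesis H : root_system u xi.
Hypothesis v_unit : v \is a GRing.unit.
Let u_unit := rs_u_unit H.
Local Notation yh := (yh u v d).
Local Notation E chi := (E_chi u v xi chi).
Local Notation F alpha := (@comp_trace B u v d xi alpha _).

(** Conjugation by [g_i] carries [E chi] to the idempotent of s_i(chi), and a trace does not see
    conjugation. *)
Lemma trace_E_perm (A : Type) n (f : yh n -> A) (chi : {ffun 'I_n -> 'I_d}) p :
  (forall x y, f (x * y) = f (y * x)) -> f (E (perm_char p chi)) = f (E chi).
Proof.
move=> fC; rewrite -(reduced_wordK p); elim: (reduced_word p) => [|i r IH].
  by rewrite perm_char1.
rewrite word_perm_cons perm_charM -{}IH; move: (perm_char _ chi) => psi.
have [gy yg] := yh_g_inv v H i.
by rewrite -[LHS](congr1 f (mulr1 _)) -gy mulrA -(g_E v H) -mulrA fC -mulrA yg mulr1.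
Qed.

Lemma hecke_tau1 k : (k <= 1)%N -> hecke_tau (1 : hecke u v k) = 1.
Proof.
have T := hecke_tauP u_unit v_unit.
by case: k => [|[|//]] _; [exact: hecke_markov_0 T | exact: hecke_markov_1 T].
Qed.

Lemma comp_trace_injective alpha n (chi : {ffun 'I_n.+1 -> 'I_d}) :
  injective chi -> F alpha (E chi) = alpha (color_support chi).
Proof.
move=> ci; have [m [f ce]] := class_enum_exists chi.
rewrite -[E chi](mulr1 (E chi)) -(@gw1 B u v d n.+1).
rewrite (comp_trace_fixed H v_unit _ ce (perm_char1 _)) [X in _ * X]big1 ?mulr1 // => a _.
(* The classes have at most one point, so only the normalizations of tau in sizes 0 and 1 are
   involved. *)
rewrite (std1 (ce_incr (ce a))) heckeTw1 hecke_tau1 //.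
rewrite -[m a]card_ord; apply/card_le1P => x _ y; rewrite [RHS]inE; apply/esym/eqP.
by apply/(incr_inj (ce_incr (ce a)))/ci; rewrite !(ce_color (ce a)).
Qed.

Lemma comp_trace_markov (alpha : Comp0 d -> B) (rho : forall n, yh n -> B) :
  (forall n (x : yh n.+1), rho n.+1 x = F alpha x) -> is_yh_markov_trace rho.
Proof.
move=> h; split=> n x *; rewrite !h.
- exact: comp_trace_mulC.
- exact: comp_trace_pos.
- exact: comp_trace_neg.
Qed.

Lemma markov_comp_trace (rho : forall n, yh n -> B) :
  (forall n, scalar (rho n.+1)) -> is_yh_markov_trace rho ->
  exists alpha : Comp0 d -> B, forall n (x : yh n.+1), rho n.+1 x = F alpha x.
Proof.
move=> lin mk.
(* A parameter is the common value of [rho] on the idempotents of injective characters with the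
   given support. *)
pose P S c := exists n (chi : {ffun 'I_n.+1 -> 'I_d}),
  [/\ injective chi, color_support chi = S & c = rho n.+1 (E chi)].
pose alpha S := the 0 (P S); exists alpha.
have alphaE n (chi : {ffun 'I_n.+1 -> 'I_d}) :
    injective chi -> alpha (color_support chi) = rho n.+1 (E chi).
  move=> ci; have [m [psi [pi e eq]]] : P (color_support chi) (alpha (color_support chi)).
    by apply: theP; exists (rho n.+1 (E chi)), n, chi.
  rewrite eq; have en := injective_color_support pi ci e; subst m.
  have [p <-] := injective_color_perm pi ci e.
  exact/trace_E_perm/(yh_markov_trace mk).
(* The candidate only exists from size 1 on; the family is completed by 0 in size 0. *)
pose D n : yh n -> B :=
  match n with 0 => fun=> 0 | n'.+1 => fun x => rho n'.+1 x - F alpha x end.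
have Dlin n : scalar (@D n.+1).
  move=> c x y; rewrite /D lin (comp_trace_scalar H v_unit) mulrBr.
  by rewrite opprD addrACA.
have Dmk : is_yh_markov_trace D.
  split=> n x *; rewrite /D.
  - by rewrite (yh_markov_trace mk) (comp_trace_mulC H v_unit).
  - by rewrite (yh_markov_pos mk) (comp_trace_pos H v_unit).
  - by rewrite (yh_markov_neg mk) (comp_trace_neg H v_unit).
have D0 n (chi : {ffun 'I_n.+1 -> 'I_d}) : injective chi -> D n.+1 (E chi) = 0.
  by move=> ci; rewrite /D comp_trace_injective // alphaE // subrr.
move=> n x; apply/eqP; rewrite -subr_eq0; apply/eqP.
exact: (@markov_trace_eq0 _ _ _ _ _ H v_unit D Dlin Dmk D0).
Qed.

End MarkovTraceClassification.

(** * Roots of unity in the Laurent ring *)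

Module LaurentConstants.
Section LaurentConstants.
Variable K : fieldType.

Fact laurent_cst_is_zmod_morphism : zmod_morphism (@laurent_cst K).
Proof. by move=> a b; apply: val_inj; rewrite raddfB /= !rmorphB. Qed.

Fact laurent_cst_is_monoid_morphism : monoid_morphism (@laurent_cst K).
Proof.
by split=> [|a b]; apply: val_inj; rewrite ?rmorphM ?rmorph1 /= ?rmorphM ?rmorph1.
Qed.

HB.instance Definition _ := GRing.isZmodMorphism.Build K (laurent K)
  (@laurent_cst K) laurent_cst_is_zmod_morphism.
HB.instance Definition _ := GRing.isMonoidMorphism.Build K (laurent K)
  (@laurent_cst K) laurent_cst_is_monoid_morphism.

Lemma laurent_root_system d (xi : 'I_d -> K) : (0 < d)%N -> (d%:R : K) != 0 ->
  enumerates_unity_roots xi -> root_system (laurent_u K) (fun a => laurent_cst (xi a)).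
Proof.
move=> d0 dn0 [xi_inj xi_root].
have xid a : xi a ^+ d = 1 by apply/xi_root; exists a.
split=> //.
- exact: laurent_u_unit.
- by rewrite -(rmorph_nat (@laurent_cst K)) rmorph_unit // unitfE.
- by move=> a; rewrite -rmorphXn xid rmorph1.
move=> a b; rewrite -!(rmorph_nat (@laurent_cst K)) -rmorphM.
under eq_bigr do rewrite -!rmorphXn -rmorphM.
rewrite -rmorph_sum; congr (laurent_cst _).
have b0 : xi b != 0.
  apply/eqP => e; have := xid b; rewrite e expr0n eqn0Ngt d0 => /eqP.
  by rewrite eq_sym oner_eq0.
have -> : \sum_(s < d) xi a ^+ s * xi b ^+ (d - s) = \sum_(s < d) (xi a / xi b) ^+ s.
  apply: eq_bigr => s _; rewrite expr_div_n; congr (_ * _).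
  by apply: (mulfI (expf_neq0 s b0)); rewrite divff ?expf_neq0 // -exprD subnKC ?xid // ltnW.
have [->|ab] := eqVneq a b.
  by under eq_bigr do rewrite divff // expr1n; rewrite sumr_const card_ord mulr1.
rewrite mulr0; apply/eqP; have : xi a / xi b - 1 != 0.
  rewrite subr_eq0; apply: contraNneq ab => e; apply/eqP/xi_inj.
  by rewrite -[RHS]mul1r -e divfK.
(* The geometric sum of xi_a / xi_b, times the nonzero xi_a / xi_b - 1, is a difference of d-th
   powers equal to 1. *)
by move=> z1; rewrite -(mulrI_eq0 _ (mulfI z1)) -subrX1 expr_div_n !xid divr1 subrr.
Qed.

End LaurentConstants.
End LaurentConstants.
Import LaurentConstants.

Theorem theorem5p3 (R : realType) (d : nat) (hd : (0 < d)%N)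
  (xi : 'I_d -> R[i]) (hxi : enumerates_unity_roots xi)
  (rho : forall n : nat,
     yh (laurent_u R[i]) (laurent_v R[i]) d n -> laurent R[i])
  (rho_linear : forall n : nat, (0 < n)%N -> scalar (rho n)) :
  is_yh_markov_trace rho <->
  exists alpha : Comp0 d -> laurent R[i],
    forall (n : nat) (x : yh (laurent_u R[i]) (laurent_v R[i]) d n.+1),
      rho n.+1 x =
      \sum_(mu : Comp d n.+1)
        rho_mu alpha
          (\tr (Psi (EY_mul (fun a => laurent_cst (xi a)) mu x))).
Proof.
have dn0 : (d%:R : R[i]) != 0 by rewrite Num.Theory.pnatr_eq0 -lt0n.
have H := laurent_root_system hd dn0 hxi.
split=> [mk|[alpha h]].
- by apply: (markov_comp_trace H (laurent_v_unit _)) => // n; exact: rho_linear.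
- exact: (comp_trace_markov H (laurent_v_unit _) h).
Qed.
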